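(* Let $K \in \mathcal{K}^n$. Then $$\frac{1}{\sqrt n} \le \max_{A \in GL_n(\mathbb{R})}\frac{w(AK)}{2R(AK)} \le \begin{cases}\min\left\{\frac{\sqrt n}{s(K)},\frac{s(K)+1}{2s(K)}\right\}, & \text{if } n \text{ is odd},\\[4pt] \min\left\{\frac{n+1}{s(K)\sqrt{n+2}},\frac{s(K)+1}{2s(K)}\right\}, & \text{if } n \text{ is even}.\end{cases}$$ The upper bound is tight for any prescribed $s(K) \in [1,n]$ (i.e., for every $s\in[1,n]$ there is $K\in\mathcal{K}^n$ with $s(K)=s$ attaining equality in the upper bound). The lower bound is attained for cross-polytopes and parallelotopes in all dimensions, as well as for simplices in odd dimensions.
   Context: $\mathcal{K}^n$ is the family of convex bodies in $\mathbb{R}^n$, i.e., compact convex sets with non-empty interior. $w(K)$ is the Euclidean minimal width of $K$ (smallest distance between two parallel supporting hyperplanes) and $R(K)$ is the Euclidean circumradius (smallest radius of a Euclidean ball containing $K$). The Minkowski asymmetry $s(K)$ is the smallest $\rho \ge 0$ such that some translate of $-K$ is contained in $\rho K$; it takes values in $[1,n]$. Cross-polytopes and parallelotopes are the affine images (under invertible affine maps) of the regular cross-polytope $\mathrm{conv}\{\pm e^1,\dots,\pm e^n\}$ and the cube $[-1,1]^n$, respectively. *)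

(* Defs.v *)
From mathcomp Require Import all_boot all_order all_algebra.
From mathcomp Require Import all_classical all_reals all_analysis.

Set Implicit Arguments.
Unset Strict Implicit.
Unset Printing Implicit Defensive.

Import Order.TTheory GRing.Theory Num.Theory.
Import numFieldNormedType.Exports.

Local Open Scope classical_set_scope.
Local Open Scope ring_scope.

(** Points of R^n are row vectors. The library norm on ['rV[R]_n] is the sup
    norm, so the Euclidean norm is defined separately; the topology (used for
    [compact] and [interior]) is the same for both. *)

Section Bodies.
Context {R : realType} {n : nat}.
Implicit Types (K H : set 'rV[R]_n) (x y u : 'rV[R]_n) (S : set R).

Definition dot x y : R := \sum_(i < n) x 0 i * y 0 i.
Definition enorm x : R := Num.sqrt (dot x x).

Definition convex_body K : Prop :=
  [/\ compact K, convex_set K & interior K !=set0].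

Definition conv_hull (X : set 'rV[R]_n) : set 'rV[R]_n :=
  smallest (fun K => convex_set K) X.

(** The action of a matrix on row vectors is [x |-> x *m A]. *)
Definition linear_image (A : 'M[R]_n) K : set 'rV[R]_n :=
  [set x *m A | x in K].

Definition translate (c : 'rV[R]_n) K : set 'rV[R]_n := [set c + x | x in K].
Definition dilate (r : R) K : set 'rV[R]_n := [set r *: x | x in K].
Definition reflect_set K : set 'rV[R]_n := [set - x | x in K].

Definition hyperplane u (c : R) : set 'rV[R]_n := [set x | dot u x = c].

(** Replacing [(u, c)] by [(- u, - c)] covers both sides of the hyperplane. *)
Definition supporting_hyperplane K H : Prop :=
  exists u c, [/\ u != 0, H = hyperplane u c, H `&` K !=set0 &
                  K `<=` [set x | dot u x <= c]].

Definition parallel_hyperplanes H1 H2 : Prop :=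
  exists u c1 c2, [/\ u != 0, H1 = hyperplane u c1 & H2 = hyperplane u c2].

Definition set_dist K H : R := inf [set enorm (x - y) | x in K & y in H].

(** The two hyperplanes must be distinct: a hyperplane is parallel to itself
    under the above definition. *)
Definition min_width K : R :=
  inf [set d | exists H1 H2,
    [/\ supporting_hyperplane K H1, supporting_hyperplane K H2,
        parallel_hyperplanes H1 H2, H1 <> H2 & d = set_dist H1 H2]].

Definition eball (c : 'rV[R]_n) (r : R) : set 'rV[R]_n :=
  [set x | enorm (x - c) <= r].

Definition circumradius K : R :=
  inf [set r | 0 <= r /\ exists c, K `<=` eball c r].

Definition minkowski_asymmetry K : R :=
  inf [set rho | 0 <= rho /\
    exists c, translate c (reflect_set K) `<=` dilate rho K].

(** The values w(AK) / (2 R(AK)) for A ranging over GL_n(R). *)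
Definition width_radius_ratios K : set R :=
  [set min_width (linear_image A K) / (2 * circumradius (linear_image A K))
     | A in [set A : 'M[R]_n | A \in unitmx]].

Definition is_max S (m : R) : Prop := S m /\ ubound S m.

Definition affine_image_of (P K : set 'rV[R]_n) : Prop :=
  exists (A : 'M[R]_n) (c : 'rV[R]_n),
    A \in unitmx /\ K = translate c (linear_image A P).

Definition regular_crosspolytope : set 'rV[R]_n :=
  conv_hull [set x | exists i : 'I_n, x = delta_mx 0 i \/ x = - delta_mx 0 i].

Definition cube : set 'rV[R]_n := [set x | forall i, -1 <= x 0 i <= 1].

Definition is_crosspolytope K : Prop :=
  affine_image_of regular_crosspolytope K.

Definition is_parallelotope K : Prop := affine_image_of cube K.

Definition affinely_independent k (p : 'I_k -> 'rV[R]_n) : Prop :=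
  forall a : 'I_k -> R,
    \sum_i a i = 0 -> \sum_i a i *: p i = 0 -> forall i, a i = 0.

Definition is_simplex K : Prop :=
  exists p : 'I_n.+1 -> 'rV[R]_n,
    affinely_independent p /\ K = conv_hull (range p).

End Bodies.

Definition ratio_upper_bound {R : realType} (n : nat) (s : R) : R :=
  if odd n then
    Num.min (Num.sqrt n%:R / s) ((s + 1) / (2 * s))
  else
    Num.min ((n%:R + 1) / (s * Num.sqrt (n%:R + 2))) ((s + 1) / (2 * s)).

(* Main.v *)
Require Import Defs.
From mathcomp Require Import all_boot all_order all_algebra perm.
From mathcomp Require Import all_classical all_reals all_analysis.
From mathcomp Require Import ring lra zify.

(** Write [h] for the support function of a convex body [K].  Its width in the
direction [u] is [h u + h (- u)], and the minimal width is the infimum of this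
quantity over unit vectors ([min_widthE]).

Existence and lower bound.  The pairs [(A, c)] with [K A + c] inside the unit
ball form a compact set, so every continuous function of [A] has a maximum on
it ([max_over_ball_positions]).  For the function [\det A] the maximum is the
Loewner position.  There the width in each unit direction [v] is at least
[2 / sqrt n]: otherwise [K] lies in the part of the ball between two hyperplanes
orthogonal to [v] that are so close that this part fits into an ellipsoid of
smaller volume than the ball ([slab_ball_improvement], [loewner_position]).
For the function [A |-> w(KA)] the maximum solves the problem of the theorem,
because the ratio does not change under scaling; the maximiser is invertible
because the Loewner position already has positive width ([max_ratio_exists]).

Upper bounds.  Let [K] lie in a ball of radius [r] and let [w] be its width.
From [w |u| <= h u + h (- u)] and [h (- u) <= r |u|] (centre at the origin) it
follows that [(w / r - 1) h (- u) <= h u]; if [w > r], this bounds the asymmetry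
[s] by [r / (w - r)] ([width_asymmetry_le]).  The second bound is Steinhagen's
inequality: [K] contains a ball of radius [w / W], where [W] is the width of the
regular simplex of inradius one, so that [s <= r W / w].  For its proof, call [q]
the function [z |-> h z - (w / W) |z|].  If [q] has nonnegative sum over every
family of vectors with sum zero, then the largest sublinear function below [q]
is supported by a point, and this point is the centre of the ball
([sublinear_support], [steinhagen]).  By a Caratheodory reduction only families
of [n + 1] vectors matter ([caratheodory]), and such a family has a subfamily
whose sum [v] has length at least [1 / W] times the sum of all lengths
([balanced_subset]); the width in the direction [v] then gives the claim.

Tightness.  Let [T] be the regular simplex with inradius one and [K_s] the
intersection of [T] with the ball of radius [s].  The asymmetry of [K_s] is [s]
and its circumradius is at most [s], so only the width has to be bounded below
by [min (s + 1) W].  It suffices to do this for [s = W - 1]: larger [s] give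
larger bodies, and for smaller [s] the body contains a convex combination of
[K_(W - 1)] and the unit ball.  The support function of [K_s] at [v] is the
infimum over [a] of [h_T a + s |v - a|], again by [sublinear_support], so the
width estimate becomes [truncation_inequality].

Extremal bodies of the lower bound.  For suitable signs, a signed
sum of vectors is at least as long as the square root of the sum of their squared
lengths ([exists_signs]).  Applied to the generators of a parallelotope, this
bounds its circumradius from below; applied to the dual basis of the generators
of a cross-polytope, it gives a direction of small width.  A simplex has
asymmetry at least [n] ([asymmetry_simplex]), so for odd [n] the upper bound
[sqrt n / s] is [1 / sqrt n]. *)

Set Implicit Arguments.
Unset Strict Implicit.
Unset Printing Implicit Defensive.

Import Order.TTheory GRing.Theory Num.Theory.
Import numFieldNormedType.Exports.

Local Open Scope classical_set_scope.
Local Open Scope ring_scope.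

(** * Euclidean geometry of row vectors *)

Section Euclidean.
Context {R : realType} {n : nat}.
Implicit Types (x y z u v : 'rV[R]_n) (a b r : R).

Lemma dotC x y : dot x y = dot y x.
Proof. by apply: eq_bigr => i _; rewrite mulrC. Qed.

Lemma dotDl x y z : dot (x + y) z = dot x z + dot y z.
Proof. by rewrite -big_split; apply: eq_bigr => i _; rewrite mxE mulrDl. Qed.

Lemma dotZl a x y : dot (a *: x) y = a * dot x y.
Proof. by rewrite /dot mulr_sumr; apply: eq_bigr => i _; rewrite mxE mulrA. Qed.

Lemma dotDr x y z : dot x (y + z) = dot x y + dot x z.
Proof. by rewrite dotC dotDl !(dotC x). Qed.

Lemma dotZr a x y : dot x (a *: y) = a * dot x y.
Proof. by rewrite dotC dotZl dotC. Qed.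

Lemma dotNl x y : dot (- x) y = - dot x y.
Proof. by rewrite -scaleN1r dotZl mulN1r. Qed.

Lemma dotNr x y : dot x (- y) = - dot x y.
Proof. by rewrite dotC dotNl dotC. Qed.

Lemma dotBl x y z : dot (x - y) z = dot x z - dot y z.
Proof. by rewrite dotDl dotNl. Qed.

Lemma dotBr x y z : dot x (y - z) = dot x y - dot x z.
Proof. by rewrite dotDr dotNr. Qed.

Lemma dot0l x : dot 0 x = 0.
Proof. by rewrite -(scale0r 0) dotZl mul0r. Qed.

Lemma dot0r x : dot x 0 = 0.
Proof. by rewrite dotC dot0l. Qed.

Definition dotE := (dotDl, dotDr, dotNl, dotNr, dotZl, dotZr, dot0l, dot0r).

Lemma dot_suml (I : Type) (s : seq I) (P : pred I) (F : I -> 'rV[R]_n) y :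
  dot (\sum_(i <- s | P i) F i) y = \sum_(i <- s | P i) dot (F i) y.
Proof. by apply: (big_morph (dot^~ y)) => [? ?|]; rewrite ?dotDl ?dot0l. Qed.

Lemma dot_sumr (I : Type) (s : seq I) (P : pred I) (F : I -> 'rV[R]_n) y :
  dot y (\sum_(i <- s | P i) F i) = \sum_(i <- s | P i) dot y (F i).
Proof. by rewrite dotC dot_suml; apply: eq_bigr => i _; rewrite dotC. Qed.

Lemma dot_delta x i : dot x (delta_mx 0 i) = x 0 i.
Proof.
rewrite /dot (bigD1 i) //= !mxE !eqxx mulr1 big1 ?addr0 // => j /negPf ji.
by rewrite mxE ji andbF mulr0.
Qed.

Lemma dotxx_ge0 x : 0 <= dot x x.
Proof. by apply: sumr_ge0 => i _; rewrite -expr2 sqr_ge0. Qed.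

Lemma dotxx_eq0 x : (dot x x == 0) = (x == 0).
Proof.
apply/idP/eqP => [|->]; last by rewrite dot0l.
rewrite psumr_eq0 => [/allP h|i _]; last by rewrite -expr2 sqr_ge0.
apply/rowP => i; have := h i (mem_index_enum i).
by rewrite -expr2 sqrf_eq0 mxE => /eqP.
Qed.

Lemma enorm_ge0 x : 0 <= enorm x. Proof. exact: sqrtr_ge0. Qed.

Lemma sqr_enorm x : enorm x ^+ 2 = dot x x.
Proof. by rewrite sqr_sqrtr ?dotxx_ge0. Qed.

Lemma enorm_eq0 x : (enorm x == 0) = (x == 0).
Proof. by rewrite -sqrf_eq0 sqr_enorm dotxx_eq0. Qed.

Lemma enorm0 : enorm (0 : 'rV[R]_n) = 0.
Proof. by apply/eqP; rewrite enorm_eq0. Qed.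

Lemma enorm_gt0 x : (0 < enorm x) = (x != 0).
Proof. by rewrite lt_def enorm_ge0 andbT enorm_eq0. Qed.

Lemma enormZ a x : enorm (a *: x) = `|a| * enorm x.
Proof.
by rewrite /enorm dotZl dotZr mulrA -expr2 sqrtrM ?sqr_ge0 // sqrtr_sqr.
Qed.

Lemma enormN x : enorm (- x) = enorm x.
Proof. by rewrite /enorm dotNl dotNr opprK. Qed.

Lemma enormB x y : enorm (x - y) = enorm (y - x).
Proof. by rewrite -enormN opprB. Qed.

Lemma enorm_le x a : 0 <= a -> dot x x <= a ^+ 2 -> enorm x <= a.
Proof. by move=> a0; rewrite -sqr_enorm ler_sqr ?nnegrE ?enorm_ge0. Qed.

Lemma dot_le x y : dot x y <= enorm x * enorm y.
Proof.
have [->|y0] := eqVneq y 0; first by rewrite dot0r enorm0 mulr0.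
have [->|x0] := eqVneq x 0; first by rewrite dot0l enorm0 mul0r.
have hx := sqr_enorm x; have hy := sqr_enorm y.
have px : 0 < enorm x by rewrite enorm_gt0.
have py : 0 < enorm y by rewrite enorm_gt0.
have := dotxx_ge0 (enorm y *: x - enorm x *: y).
rewrite !(dotE) -hx -hy (dotC y x) => h.
have {}h : 0 <= (enorm x * enorm y) * (enorm x * enorm y - dot x y) by nra.
by rewrite pmulr_rge0 ?mulr_gt0 // subr_ge0 in h.
Qed.

Lemma ge_dot x y : - (enorm x * enorm y) <= dot x y.
Proof. by rewrite lerNl -dotNl -(enormN x) dot_le. Qed.

Lemma enormD x y : enorm (x + y) <= enorm x + enorm y.
Proof.
apply: enorm_le; first by rewrite addr_ge0 ?enorm_ge0.
rewrite !dotE (dotC y x) -!sqr_enorm; have := dot_le x y; lra.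
Qed.

Lemma enorm_sum (I : Type) (s : seq I) (F : I -> 'rV[R]_n) :
  enorm (\sum_(i <- s) F i) <= \sum_(i <- s) enorm (F i).
Proof.
elim: s => [|i s IH]; first by rewrite !big_nil enorm0.
by rewrite !big_cons (le_trans (enormD _ _)) // lerD2l.
Qed.

Lemma enorm_delta (i : 'I_n) : enorm (delta_mx 0 i : 'rV[R]_n) = 1.
Proof. by rewrite /enorm dot_delta mxE !eqxx sqrtr1. Qed.

Lemma enorm_normalize x : x != 0 -> enorm ((enorm x)^-1 *: x) = 1.
Proof.
rewrite -enorm_gt0 => x0; rewrite enormZ ger0_norm ?invr_ge0 ?ltW //.
by rewrite mulVf // gt_eqF.
Qed.

Lemma dot_mulmx m (A : 'M[R]_(m, n)) (x : 'rV[R]_m) y :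
  dot (x *m A) y = dot x (y *m A^T).
Proof.
have E k (p q : 'rV[R]_k) : dot p q = (p *m q^T) 0 0.
  by rewrite mxE; apply: eq_bigr => i _; rewrite mxE.
by rewrite !E trmx_mul trmxK mulmxA.
Qed.

Lemma coord_le_enorm x i : `|x 0 i| <= enorm x.
Proof.
have := dot_le x (delta_mx 0 i); have := ge_dot x (delta_mx 0 i).
by rewrite enorm_delta mulr1 dot_delta ler_norml => -> ->.
Qed.

Lemma coord_le_norm x i : `|x 0 i| <= `|x|.
Proof.
rewrite [in leRHS]/Num.norm /= mx_normrE.
by apply/bigmax_geP; right; exists (0, i).
Qed.

Lemma norm_le_enorm x : `|x| <= enorm x.
Proof.
rewrite [leLHS]/Num.norm /= mx_normrE; apply/bigmax_leP; split.
  exact: enorm_ge0.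
by move=> [j i] _ /=; rewrite ord1 coord_le_enorm.
Qed.

Lemma enorm_le_norm x : enorm x <= n%:R * `|x|.
Proof.
have {1}-> : x = \sum_(i < n) x 0 i *: delta_mx 0 i.
  exact: row_sum_delta.
apply: le_trans (enorm_sum _ _) _.
rewrite -[n in n%:R]card_ord -sumr_const mulr_suml; apply: ler_sum => i _.
by rewrite enormZ enorm_delta mulr1 mul1r coord_le_norm.
Qed.

End Euclidean.

(** * Convexity and compactness in coordinates *)

Section Topology.
Context {R : realType}.

(** The distance is one-sided because exchanging [A] and [B] gives the other
side. *)
Lemma lipschitz_continuous m n (f : 'M[R]_(m, n) -> R) (C : R) :
  (forall A B, f A - f B <= C * `|A - B|) -> continuous f.
Proof.
move=> fC A; apply/(@cvgrPdist_le _ _ _ (nbhs A)) => e e0.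
pose D := `|C| + 1.
have D0 : 0 < D by rewrite ltr_wpDl.
have fD X Y : f X - f Y <= D * `|X - Y|.
  apply: le_trans (fC _ _) _; apply: ler_wpM2r => //.
  by rewrite (le_trans (ler_norm C)) // lerDl.
apply/nbhs_ballP; exists (e / D) => /=; first exact: divr_gt0.
move=> B; rewrite -ball_normE /= ltr_pdivlMr // mulrC => /ltW AB.
rewrite ler_norml lerNl opprB !(le_trans _ AB) //.
by rewrite distrC fD.
Qed.

Lemma continuous_sumr (T : topologicalType) (I : Type) (s : seq I)
    (F : I -> T -> R) :
  (forall i, continuous (F i)) -> continuous (fun x => \sum_(i <- s) F i x).
Proof.
move=> cF x; elim: s => [|i s IH].
  under eq_fun do rewrite big_nil; exact: cvg_cst.
under eq_fun do rewrite big_cons.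
by apply: cvgD IH; exact: cF.
Qed.

Lemma continuous_prodr (T : topologicalType) (I : Type) (s : seq I)
    (F : I -> T -> R) :
  (forall i, continuous (F i)) -> continuous (fun x => \prod_(i <- s) F i x).
Proof.
move=> cF x; elim: s => [|i s IH].
  under eq_fun do rewrite big_nil; exact: cvg_cst.
under eq_fun do rewrite big_cons.
by apply: cvgM IH; exact: cF.
Qed.

Lemma continuous_mx (T : topologicalType) m n (F : T -> 'M[R]_(m, n)) :
  (forall i j, continuous (fun x => F x i j)) -> continuous F.
Proof.
move=> cF x; apply/cvgrPdist_le => e e0.
have h i j : \forall y \near x, `|F x i j - F y i j| <= e.
  by have /cvgrPdist_le := cF i j x; apply.
have : \forall y \near x, forall ij : 'I_m * 'I_n,
    `|F x ij.1 ij.2 - F y ij.1 ij.2| <= e.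
  by apply: filter_forall => ij; exact: h.
apply: filterS => y hy.
rewrite /Num.norm /= mx_normrE; apply/bigmax_leP; split; first exact: ltW.
by move=> ij _; rewrite !mxE.
Qed.

Lemma continuous_det n : continuous (fun A : 'M[R]_n => \det A).
Proof.
apply: (continuous_sumr (F := fun (s : {perm 'I_n}) (A : 'M[R]_n) =>
  (-1) ^+ s * \prod_i A i (s i))) => s A.
apply: (@continuousM R _ (fun=> (-1) ^+ s)); first exact: cst_continuous.
apply: (continuous_prodr (F := fun i (B : 'M[R]_n) => B i (s i))) => i.
exact: coord_continuous.
Qed.

End Topology.

Section Bodies.
Context {R : realType} {n : nat}.
Implicit Types (K : set 'rV[R]_n) (x y z u v : 'rV[R]_n) (a b r t : R).

Lemma convexP K :
  convex_set K <->
  forall x y t, K x -> K y -> 0 <= t <= 1 -> K (t *: x + (1 - t) *: y).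
Proof.
split => [cK x y t Kx Ky /andP[t0 t1]|cK x y t /set_mem Kx /set_mem Ky].
  by have := cK x y (Itv01 t0 t1); rewrite !inE => /(_ Kx Ky).
by apply/mem_set/(cK x y t%:num) => //; rewrite ge0 le1.
Qed.

Lemma continuous_enorm : continuous (@enorm R n).
Proof.
apply: (lipschitz_continuous (C := n%:R)) => x y.
apply: le_trans (enorm_le_norm (x - y)).
by rewrite lerBlDr -{1}(subrK y x) enormD.
Qed.

Lemma continuous_dot u : continuous (dot u).
Proof.
apply: (continuous_sumr (F := fun i (x : 'rV[R]_n) => u 0 i * x 0 i)) => i x.
apply: (@continuousM R _ (fun=> u 0 i)); first exact: cst_continuous.
exact: coord_continuous.
Qed.

Lemma compact_enorm_bounded K :
  compact K -> exists2 r, 0 < r & forall x, K x -> enorm x <= r.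
Proof.
move=> /compact_bounded/ex_strict_bound_gt0 [M M0 KM].
exists (n%:R * M + 1) => [|x Kx].
  by rewrite ltr_wpDl // mulr_ge0 // ltW.
apply: le_trans (enorm_le_norm x) _.
apply: le_trans (_ : n%:R * M <= _); last by rewrite lerDl.
by rewrite ler_wpM2l // ltW //; exact: KM.
Qed.

Lemma closed_enorm_bounded_compact K r :
  closed K -> (forall x, K x -> enorm x <= r) -> compact K.
Proof.
move=> cK Kr; apply: bounded_closed_compact => //.
exists r; split; first exact: num_real.
move=> M rM x Kx; apply: le_trans (norm_le_enorm x) _.
exact: le_trans (Kr _ Kx) (ltW rM).
Qed.

Lemma closed_le_fun (T : topologicalType) (f : T -> R) a :
  continuous f -> closed [set x | f x <= a].
Proof.
move=> cf; apply: (@preimage_closed _ _ f [set x | x <= a]).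
  by move=> x _; exact: cf.
exact: closed_le.
Qed.

(** The metric balls of row vectors are cubes; the factor [n + 1] absorbs the
comparison of the two norms and stays positive when [n = 0]. *)
Lemma interior_ball K x :
  interior K x <-> exists2 r, 0 < r & eball x r `<=` K.
Proof.
split=> [/nbhs_ballP[e /= e0 eK]|[r r0 rK]].
  exists (e / 2) => [|y /= yx]; first by rewrite divr_gt0.
  apply: eK; rewrite -ball_normE /= distrC.
  apply: le_lt_trans (norm_le_enorm _) _; apply: le_lt_trans yx _.
  by rewrite ltr_pdivrMr // mulr2n mulrDr mulr1 ltrDl.
have k0 : 0 < (n%:R + 1 : R) by rewrite ltr_wpDl.
apply/nbhs_ballP; exists (r / (n%:R + 1)) => /=; first by rewrite divr_gt0.
move=> y; rewrite -ball_normE /= distrC ltr_pdivlMr // => yx.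
apply: rK; rewrite /eball /=; apply: le_trans (enorm_le_norm _) _.
by apply: le_trans _ (ltW yx); rewrite mulrC ler_wpM2l // lerDl.
Qed.

Lemma compact_max K (f : 'rV[R]_n -> R) :
  K !=set0 -> compact K -> continuous f ->
  exists2 x, K x & forall y, K y -> f y <= f x.
Proof.
move=> K0 cK cf.
have [|x /set_mem Kx xm] := compact_EVT_max K0 cK (f := f).
  exact: continuous_subspaceT.
by exists x => // y Ky; apply: xm; rewrite inE.
Qed.

End Bodies.

(** * Support functions and minimal width *)

Section Support.
Context {R : realType} {n : nat}.
Implicit Types (K : set 'rV[R]_n) (x y z u v : 'rV[R]_n) (a b r t : R).

Definition supp K u : R := sup [set dot u x | x in K].

Definition width K u : R := supp K u + supp K (- u).

Lemma supp_attained K u : K !=set0 -> compact K ->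
  exists2 x, K x & supp K u = dot u x.
Proof.
move=> K0 cK; have [x Kx xm] := compact_max K0 cK (@continuous_dot R n u).
exists x => //; apply/eqP; rewrite eq_le; apply/andP; split.
  by apply: ge_sup => [|_ [y Ky <-]]; [exists (dot u x), x|exact: xm].
by apply: ub_le_sup; [exists (dot u x) => _ [y Ky <-]; exact: xm|exists x].
Qed.

Lemma supp_ge K u x : compact K -> K x -> dot u x <= supp K u.
Proof.
move=> cK Kx; have [y Ky ym] := compact_max (ex_intro _ x Kx) cK (@continuous_dot R n u).
by apply: ub_le_sup; [exists (dot u y) => _ [z Kz <-]; exact: ym|exists x].
Qed.

Lemma supp_le K u a : K !=set0 -> (forall x, K x -> dot u x <= a) -> supp K u <= a.
Proof.
by move=> [x Kx] h; apply: ge_sup => [|_ [y Ky <-]]; [exists (dot u x), x|exact: h].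
Qed.

Lemma suppD K u v : K !=set0 -> compact K -> supp K (u + v) <= supp K u + supp K v.
Proof.
by move=> K0 cK; apply: supp_le => // x Kx; rewrite dotDl lerD ?supp_ge.
Qed.

Lemma supp0 K : K !=set0 -> compact K -> supp K 0 = 0.
Proof.
by move=> K0 cK; have [x Kx ->] := supp_attained 0 K0 cK; rewrite dot0l.
Qed.

Lemma suppZ K u a : 0 <= a -> K !=set0 -> compact K ->
  supp K (a *: u) = a * supp K u.
Proof.
move=> a0 K0 cK; apply/eqP; rewrite eq_le; apply/andP; split.
  by apply: supp_le => // x Kx; rewrite dotZl ler_wpM2l // supp_ge.
have [x Kx ->] := supp_attained u K0 cK.
by rewrite -dotZl supp_ge.
Qed.

Lemma width_ge K u x y : compact K -> K x -> K y -> dot u (x - y) <= width K u.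
Proof. by move=> cK Kx Ky; rewrite dotBr -dotNl lerD ?supp_ge. Qed.

Lemma width_attained K u : K !=set0 -> compact K ->
  exists x y, [/\ K x, K y & width K u = dot u (x - y)].
Proof.
move=> K0 cK; have [x Kx hx] := supp_attained u K0 cK.
have [y Ky hy] := supp_attained (- u) K0 cK.
by exists x, y; rewrite /width hx hy dotBr dotNl.
Qed.

Lemma widthN K u : width K (- u) = width K u.
Proof. by rewrite /width opprK addrC. Qed.

Lemma widthZ K u a : K !=set0 -> compact K -> width K (a *: u) = `|a| * width K u.
Proof.
move=> K0 cK; have [a0|a0] := leP 0 a.
  by rewrite ger0_norm // /width -scalerN !suppZ // mulrDr.
rewrite ltr0_norm // -[a in LHS]opprK scaleNr widthN /width -scalerN.
by rewrite !suppZ ?oppr_ge0 1?ltW // mulrDr.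
Qed.

Lemma width0 K : K !=set0 -> compact K -> width K 0 = 0.
Proof. by move=> K0 cK; rewrite -(scale0r 0) widthZ // normr0 mul0r. Qed.

Lemma width_ge0 K u : K !=set0 -> compact K -> 0 <= width K u.
Proof.
by move=> [x Kx] cK; rewrite -(dot0r u) -(subrr x) width_ge.
Qed.

Lemma supp_linear_image A K u :
  supp (linear_image A K) u = supp K (u *m A^T).
Proof.
have E x : dot u (x *m A) = dot (u *m A^T) x by rewrite dotC dot_mulmx dotC.
congr sup; apply/seteqP; split => [_ [_ [x Kx <-] <-]|_ [x Kx <-]].
  by exists x.
by exists (x *m A); [exists x|].
Qed.

Lemma width_linear_image A K u :
  width (linear_image A K) u = width K (u *m A^T).
Proof. by rewrite /width !supp_linear_image mulNmx. Qed.

(** The nearest point [x] of [K] to [y] gives a separating direction [y - x]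
unless [x = y]: moving from [x] towards a point [z] of [K] must not decrease the
distance to [y], to first order. *)
Lemma compact_convex_separation K y :
  compact K -> convex_set K -> K !=set0 ->
  (forall u, dot u y <= supp K u) -> K y.
Proof.
move=> cK /convexP vK K0 h.
have cf : continuous (fun x => - enorm (x - y)).
  apply: (lipschitz_continuous (C := n%:R)) => x z.
  apply: le_trans (enorm_le_norm (x - z)).
  have := enormD (z - x) (x - y); rewrite addrA subrK (enormB z x); lra.
have [x Kx xm] := compact_max K0 cK cf.
have [->//|yx] := eqVneq y x.
have [u uE] : exists u, u = y - x by exists (y - x).
have u0 : 0 < dot u u by rewrite lt_def dotxx_ge0 dotxx_eq0 uE subr_eq0 yx.
suff uz z : K z -> dot u z <= dot u x.
  have : dot u y <= dot u x by apply: le_trans (h u) _; exact: supp_le.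
  by rewrite -subr_le0 -dotBr -uE leNgt u0.
move=> Kz; rewrite -subr_le0 -dotBr leNgt; apply/negP => p0.
have [w wE] : exists w, w = z - x by exists (z - x).
rewrite -wE in p0.
set p := dot u w in p0; set q := dot w w.
have q0 : 0 <= q by exact: dotxx_ge0.
have key t : 0 <= t <= 1 -> 2 * t * p <= t ^+ 2 * q.
  move=> t01; have := xm _ (vK _ _ t Kz Kx t01).
  rewrite lerN2 -ler_sqr ?nnegrE ?enorm_ge0 // !sqr_enorm.
  have -> : x - y = - u by rewrite uE opprB.
  have -> : t *: z + (1 - t) *: x - y = t *: w - u.
    by rewrite wE uE; apply/rowP => i; rewrite !mxE; ring.
  rewrite !dotE -/p -/q (dotC w u) -/p ?opprK; lra.
have [qp|pq] := leP q p.
  have := key 1; rewrite ler01 lexx => /(_ isT); lra.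
have q1 : 0 < q by exact: le_lt_trans (ltW p0) pq.
have := key (p / q); rewrite divr_ge0 ?(ltW p0) // ler_pdivrMr // mul1r (ltW pq).
move=> /(_ isT).
have sq : (p / q) ^+ 2 * q = p / q * p by rewrite expr2 -mulrA divfK // gt_eqF.
have : 0 < p / q * p by rewrite !mulr_gt0 ?invr_gt0.
rewrite sq -mulrA; lra.
Qed.

End Support.

Section MinWidth.
Context {R : realType} {n : nat}.
Implicit Types (K : set 'rV[R]_n) (x y z u v : 'rV[R]_n) (a b r t : R).

Lemma body_nonempty K : convex_body K -> K !=set0.
Proof. by move=> [_ _ [x /nbhs_singleton Kx]]; exists x. Qed.

Lemma width_inner_ball K u r : compact K -> 0 <= r ->
  (exists c, eball c r `<=` K) -> 2 * r * enorm u <= width K u.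
Proof.
move=> cK r0 [c cK'].
have [->|u0] := eqVneq u 0.
  by rewrite enorm0 mulr0 width_ge0 //; exists c; apply: cK'; rewrite /eball /= subrr enorm0.
pose e := (enorm u)^-1 *: u.
have in_ball a : `|a| <= r -> K (c + a *: e).
  by move=> ar; apply: cK'; rewrite /eball /= addrC addKr enormZ enorm_normalize // mulr1.
have := width_ge u cK (in_ball r _) (in_ball (- r) _).
rewrite normrN ger0_norm // lexx => /(_ isT isT); apply: le_trans.
have -> : c + r *: e - (c + - r *: e) = (2 * r) *: e.
  by apply/rowP => i; rewrite !mxE; ring.
by rewrite !dotZr -sqr_enorm expr2 mulKf // enorm_eq0.
Qed.

Lemma width_gt0 K u : convex_body K -> u != 0 -> 0 < width K u.
Proof.
move=> [cK _ [c /interior_ball[r r0 rK]]] u0.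
have := @width_inner_ball K u r cK (ltW r0) (ex_intro _ c rK).
by apply: lt_le_trans; rewrite !mulr_gt0 ?enorm_gt0.
Qed.

Lemma hyperplaneZ u a k : k != 0 -> hyperplane (k *: u) (k * a) = hyperplane u a.
Proof.
move=> k0; apply/seteqP; split => x; rewrite /hyperplane /= dotZl.
  by move=> /(mulfI k0).
by move=> ->.
Qed.

(** The component of [v] orthogonal to [u] can be added to a point of the
hyperplane without leaving it, so it is orthogonal to [v], hence zero. *)
Lemma hyperplane_eq_normal u v a b : u != 0 -> v != 0 ->
  hyperplane u a = hyperplane v b -> exists2 k, k != 0 & v = k *: u.
Proof.
move=> u0 v0 E; have uu0 : dot u u != 0 by rewrite dotxx_eq0.
pose k := dot v u / dot u u; pose z := v - k *: u.
have zu : dot z u = 0 by rewrite /z dotBl dotZl /k divfK // subrr.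
pose x0 := (a / dot u u) *: u.
have Hx0 : hyperplane u a x0 by rewrite /hyperplane /= /x0 dotZr divfK.
have Hx1 : hyperplane u a (x0 + z).
  by rewrite /hyperplane /= dotDr Hx0 (dotC u) zu addr0.
move: Hx0 Hx1; rewrite E /hyperplane /= dotDr => -> /eqP.
rewrite -subr_eq0 addrC addKr => /eqP vz.
have : dot z z == 0 by rewrite {1}/z dotBl dotZl vz dotC dotC (dotC u) zu mulr0 subrr.
rewrite dotxx_eq0 subr_eq0 => /eqP vE; exists k => //.
by apply: contra_neq v0 => k0; rewrite vE k0 scale0r.
Qed.

Lemma set_dist_hyperplanes u a b : enorm u = 1 ->
  set_dist (hyperplane u a) (hyperplane u b) = `|a - b|.
Proof.
move=> u1; have uu : dot u u = 1 by rewrite -sqr_enorm u1 expr1n.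
have lbd : lbound [set enorm (x - y) | x in hyperplane u a & y in hyperplane u b] `|a - b|.
  move=> _ [x /= ha [y /= hb <-]]; rewrite -ha -hb -dotBr.
  have := dot_le u (x - y); have := ge_dot u (x - y).
  by rewrite u1 mul1r ler_norml => -> ->.
have inS : [set enorm (x - y) | x in hyperplane u a & y in hyperplane u b] `|a - b|.
  exists (a *: u); first by rewrite /hyperplane /= dotZr uu mulr1.
  exists (b *: u); first by rewrite /hyperplane /= dotZr uu mulr1.
  by rewrite -scalerBl enormZ u1 mulr1.
apply/eqP; rewrite eq_le; apply/andP; split.
  by apply: ge_inf => //; exists `|a - b|.
by apply: lb_le_inf => //; exists `|a - b|.
Qed.

Lemma supporting_hyperplaneE K H : K !=set0 -> compact K ->
  supporting_hyperplane K H <->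
  exists2 e, enorm e = 1 & H = hyperplane e (supp K e).
Proof.
move=> K0 cK; split=> [[u [c [u0 -> [x [/= Hx Kx]] Kc]]]|[e e1 ->]].
  have cE : c = supp K u.
    apply/eqP; rewrite eq_le -{1}Hx supp_ge //=; exact: supp_le.
  have nu0 : (enorm u)^-1 != 0 by rewrite invr_neq0 // enorm_eq0.
  exists ((enorm u)^-1 *: u); first exact: enorm_normalize.
  by rewrite suppZ ?invr_ge0 ?enorm_ge0 // hyperplaneZ // cE.
exists e, (supp K e); split=> //.
- by rewrite -enorm_eq0 e1 oner_eq0.
- by have [x Kx hx] := supp_attained e K0 cK; exists x.
- by move=> x Kx; exact: supp_ge.
Qed.

(** A pair of parallel supporting hyperplanes has unit outer normals [e] and [f]
with [f = e] or [f = - e]; in the first case the hyperplanes coincide.  The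
interior of [K] makes the two hyperplanes with normals [e] and [- e] distinct. *)
Lemma min_widthE K : convex_body K ->
  min_width K = inf [set width K u | u in [set u | enorm u = 1]].
Proof.
move=> bK; have K0 := body_nonempty bK; have [cK _ _] := bK.
congr inf; apply/seteqP; split=> [d|d [e /= e1 <-]].
  move=> [H1 [H2 [/(supporting_hyperplaneE _ K0 cK)[e e1 E1]
    /(supporting_hyperplaneE _ K0 cK)[f f1 E2] [u [a [b [u0 P1 P2]]]] ne ->]]].
  have e0 : e != 0 by rewrite -enorm_eq0 e1 oner_eq0.
  have f0 : f != 0 by rewrite -enorm_eq0 f1 oner_eq0.
  have [k k0 uE] := hyperplane_eq_normal e0 u0 (etrans (esym E1) P1).
  have [l l0 uF] := hyperplane_eq_normal f0 u0 (etrans (esym E2) P2).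
  have fE : f = (k / l) *: e.
    by rewrite mulrC -scalerA -uE uF scalerA mulVf // scale1r.
  have /eqP : `|k / l| = 1 by move: f1; rewrite fE enormZ e1 mulr1.
  rewrite eqr_norml ler01 andbT => /orP[]/eqP kl; move: fE; rewrite kl.
    by rewrite scale1r => fe; case: ne; rewrite E1 E2 fe.
  rewrite scaleN1r => fe; exists e => //.
  have -> : H2 = hyperplane e (- supp K (- e)).
    rewrite E2 fe -[in RHS](@hyperplaneZ _ _ (-1)) ?oppr_eq0 ?oner_eq0 //.
    by rewrite scaleN1r mulN1r opprK.
  by rewrite E1 set_dist_hyperplanes // opprK ger0_norm //; exact: width_ge0.
have e0 : e != 0 by rewrite -enorm_eq0 e1 oner_eq0.
have E2 : hyperplane (- e) (supp K (- e)) = hyperplane e (- supp K (- e)).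
  rewrite -[in RHS](@hyperplaneZ _ _ (-1)) ?oppr_eq0 ?oner_eq0 //.
  by rewrite scaleN1r mulN1r opprK.
exists (hyperplane e (supp K e)), (hyperplane (- e) (supp K (- e))); split.
- by apply/supporting_hyperplaneE => //; exists e.
- by apply/supporting_hyperplaneE => //; exists (- e); rewrite ?enormN.
- by exists e, (supp K e), (- supp K (- e)).
- have w0 := width_gt0 bK e0.
  rewrite E2 => E; have : hyperplane e (supp K e) (supp K e *: e).
    by rewrite /hyperplane /= dotZr -sqr_enorm e1 expr1n mulr1.
  rewrite E /hyperplane /= dotZr -sqr_enorm e1 expr1n mulr1 => h.
  by move: w0; rewrite /width h addNr ltxx.
by rewrite E2 set_dist_hyperplanes // opprK ger0_norm //; exact: width_ge0.
Qed.

Lemma min_width_le K u : convex_body K -> min_width K * enorm u <= width K u.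
Proof.
move=> bK; have K0 := body_nonempty bK; have [cK _ _] := bK.
have [->|u0] := eqVneq u 0; first by rewrite enorm0 mulr0 width0.
rewrite min_widthE // -ler_pdivlMr ?enorm_gt0 //; apply: ge_inf.
  by exists 0 => _ [v _ <-]; exact: width_ge0.
exists ((enorm u)^-1 *: u); first exact: enorm_normalize.
by rewrite widthZ // ger0_norm ?invr_ge0 ?enorm_ge0 // mulrC.
Qed.

Lemma le_min_width K a : (0 < n)%N -> convex_body K ->
  (forall u, enorm u = 1 -> a <= width K u) -> a <= min_width K.
Proof.
move=> n0 bK h; rewrite min_widthE //; apply: lb_le_inf.
  exists (width K (delta_mx 0 (Ordinal n0))), (delta_mx 0 (Ordinal n0)) => //.
  exact: enorm_delta.
by move=> _ [u /= u1 <-]; exact: h.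
Qed.

End MinWidth.

(** * Supporting functionals of sublinear functions *)

Section Sublinear.
Context {R : realType} {n : nat}.
Implicit Types (p : 'rV[R]_n -> R) (x y z u v : 'rV[R]_n) (t : R).

(** Homogeneity is required in one direction only; the other one follows by
applying it to the inverse factor. *)
Definition sublinear p :=
  (forall x y, p (x + y) <= p x + p y) /\
  (forall t x, 0 <= t -> p (t *: x) <= t * p x).

Lemma sublinear0 p : sublinear p -> p 0 = 0.
Proof.
move=> [pD pZ]; apply/eqP; rewrite eq_le; apply/andP; split.
  by have := pZ 0 0 (lexx _); rewrite scale0r mul0r.
have := pD 0 0; rewrite addr0; lra.
Qed.

Lemma sublinear_geN p x : sublinear p -> - p (- x) <= p x.
Proof.
by move=> sp; have := sp.1 x (- x); rewrite subrr sublinear0 //; lra.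
Qed.

(** Among the sublinear functions below [p] with the same value at [v], the
function [z |-> inf_t (p (z + t v) - t p v)] is linear along the line of [v]. *)
Lemma sublinear_step p v : sublinear p ->
  exists p', [/\ sublinear p', forall z, p' z <= p z, p' v = p v &
                 p' (- v) = - p' v].
Proof.
move=> sp; have [pD pZ] := sp.
(* the values whose infimum is the new function at z *)
pose S z := [set p (z + t *: v) - t * p v | t in [set t | 0 <= t]].
have S0 z : S z !=set0 by exists (p (z + 0 *: v) - 0 * p v), 0 => //=.
have lbS z : has_lbound (S z).
  exists (- p (- z)) => _ [t /= t0 <-].
  have := pD (z + t *: v) (- z); rewrite addrAC subrr add0r.
  have -> : p (t *: v) = t * p v.
    apply/eqP; rewrite eq_le pZ //=; have [->|tn0] := eqVneq t 0.
      by rewrite mul0r scale0r sublinear0.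
    have := pZ t^-1 (t *: v); rewrite invr_ge0 scalerA mulVf // scale1r.
    by move=> /(_ t0); rewrite ler_pdivlMl // lt_def tn0.
  lra.
pose p' z := inf (S z).
have p1le z t : 0 <= t -> p' z <= p (z + t *: v) - t * p v.
  by move=> t0; apply: ge_inf => //; exists t.
have lep1 z a : (forall t, 0 <= t -> a <= p (z + t *: v) - t * p v) -> a <= p' z.
  by move=> h; apply: lb_le_inf => // _ [t /= t0 <-]; exact: h.
have p1p' z : p' z <= p z.
  by have := p1le z 0 (lexx _); rewrite scale0r mul0r addr0 subr0.
have sp' : sublinear p'.
  split=> [x y|t x t0].
    rewrite -lerBlDr; apply: (lep1 _ _) => t t0; rewrite lerBlDr -lerBlDl.
    apply: (lep1 _ _) => r r0; have := p1le (x + y) (t + r) (addr_ge0 t0 r0).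
    have := pD (x + t *: v) (y + r *: v).
    by rewrite addrACA -scalerDl; lra.
  have [->|tn0] := eqVneq t 0.
    by rewrite scale0r mul0r; apply: le_trans (p1p' 0) _; rewrite sublinear0.
  have tp : 0 < t by rewrite lt_def tn0.
  rewrite -ler_pdivrMl //; apply: (lep1 _ _) => r r0.
  rewrite ler_pdivrMl //; have := p1le (t *: x) (t * r) (mulr_ge0 t0 r0).
  rewrite -scalerA -scalerDr; have := pZ t (x + r *: v) t0; lra.
have p'v : p' v = p v.
  apply/eqP; rewrite eq_le p1p' /=; apply: (lep1 _ _) => t t0.
  have := sublinear_geN (v + t *: v) sp.
  have := pZ (1 + t)^-1 ((1 + t) *: v).
  have t1 : 0 < 1 + t by lra.
  rewrite invr_ge0 scalerA mulVf ?gt_eqF // !scale1r (ltW t1) => /(_ isT).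
  by rewrite ler_pdivlMl // scalerDl scale1r; lra.
exists p'; split=> //; apply/eqP; rewrite eq_le; apply/andP; split.
  have := p1le (- v) 1 ler01; rewrite scale1r addNr sublinear0 // p'v; lra.
have := sublinear_geN v sp'; lra.
Qed.

(** Linearity along a line persists when the sublinear function decreases, so the
directions can be treated one after the other. *)
Lemma sublinear_steps (s : seq 'rV[R]_n) p : sublinear p ->
  exists p', [/\ sublinear p', forall z, p' z <= p z &
                 forall v, v \in s -> p' (- v) = - p' v].
Proof.
elim: s p => [|v s IH] p sp; first by exists p; split.
have [p1 [sp1 p1p _ p1v]] := sublinear_step v sp.
have [p2 [sp2 p2p p2s]] := IH _ sp1.
exists p2; split=> // [z|w]; first exact: le_trans (p2p z) (p1p z).
rewrite in_cons => /orP[/eqP->|/p2s //].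
apply/eqP; rewrite eq_le; apply/andP; split.
  by have := p2p (- v); have := sublinear_geN (- v) sp2; have := p2p v;
     rewrite opprK; lra.
by have := sublinear_geN v sp2; lra.
Qed.

(** The Hahn-Banach theorem in finite dimension: a sublinear function that is
linear along [v] and along all coordinate directions is linear. *)
Lemma sublinear_support p v : sublinear p ->
  exists x, (forall z, dot x z <= p z) /\ dot x v = p v.
Proof.
move=> sp; have [p1 [sp1 p1p p1v p1Nv]] := sublinear_step v sp.
have [p2 [sp2 p2p p2e]] :=
  sublinear_steps [seq delta_mx 0 i | i : 'I_n] sp1.
have {}p2e i : p2 (- delta_mx 0 i) = - p2 (delta_mx 0 i).
  by apply: p2e; apply/mapP; exists i => //; rewrite mem_enum.
pose x := \row_i p2 (delta_mx 0 i).
have p2x z : p2 z <= dot x z.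
  have -> : dot x z = \sum_i z 0 i * p2 (delta_mx 0 i).
    by apply: eq_bigr => i _; rewrite mxE mulrC.
  rewrite {1}(row_sum_delta z).
  elim/big_rec2: _ => [|i a b _ ab]; first by rewrite sublinear0.
  apply: le_trans (sp2.1 _ _) _; apply: lerD => //.
  have [z0|z0] := leP 0 (z 0 i); first exact: sp2.2.
  rewrite -[z 0 i]opprK scaleNr -scalerN mulNr -mulrN -p2e.
  by apply: sp2.2; rewrite oppr_ge0 ltW.
have xE z : dot x z = p2 z.
  apply/eqP; rewrite eq_le p2x andbT.
  by apply: le_trans (sublinear_geN z sp2); rewrite -[dot x z]opprK -dotNr lerN2 p2x.
exists x; split=> [z|]; first by rewrite xE (le_trans (p2p z)).
rewrite xE; apply/eqP; rewrite eq_le (le_trans (p2p v)) ?p1v //=.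
by have := sublinear_geN v sp2; have := p2p (- v); lra.
Qed.

End Sublinear.

(** * Balanced subfamilies of vectors with zero sum *)

Section BalancedSubset.
Context {R : realType} {d N : nat}.
Context (z : 'I_N -> 'rV[R]_d) (z0 : \sum_i z i = 0).
Implicit Types (I : {set 'I_N}) (i j : 'I_N).

Let part I := \sum_(i in I) z i.
Let sq I := \sum_(i in I) dot (z i) (z i).

Lemma sum_setC_opp I : part (~: I) = - part I.
Proof.
apply/eqP; rewrite -addr_eq0 addrC -z0 [X in _ == X](bigID (mem I)) /=.
by apply/eqP; congr (_ + _); apply: eq_bigl => i; rewrite finset.in_setC.
Qed.

Lemma sum_swap I i j : i \in I -> j \notin I ->
  part (j |: (I :\ i)) = part I - z i + z j.
Proof.
move=> iI jI; rewrite /part big_setU1 /=; last by rewrite !inE (negPf jI) andbF.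
by rewrite (big_setD1 i iI) /= [z i + _]addrC addrK addrC.
Qed.

Lemma card_swap I i j : i \in I -> j \notin I -> #|j |: (I :\ i)| = #|I|.
Proof.
move=> iI jI; rewrite cardsU1 !inE (negPf jI) andbF /=.
by rewrite [in RHS](cardsD1 i) iI.
Qed.

(** Optimality against exchanging one index of [I] with one outside gives an
inequality for each such pair; the bound is their sum. *)
Lemma swap_optimal I :
  (forall J : {set 'I_N}, #|J| = #|I| -> dot (part J) (part J) <= dot (part I) (part I)) ->
  #|~: I|%:R * sq I + #|I|%:R * sq (~: I) <= (2 * N%:R - 2) * dot (part I) (part I).
Proof.
move=> opt; set v := part I.
have key i j : i \in I -> j \in ~: I ->
    dot (z i) (z i) + dot (z j) (z j) - 2 * dot (z i) (z j)
      <= 2 * dot v (z i) - 2 * dot v (z j).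
  rewrite finset.in_setC => iI jI; have := opt _ (card_swap iI jI).
  rewrite sum_swap // -/v !dotE (dotC (z i) v) (dotC (z j) v) (dotC (z j) (z i)).
  lra.
have : \sum_(i in I) \sum_(j in ~: I)
    (dot (z i) (z i) + dot (z j) (z j) - 2 * dot (z i) (z j))
    <= \sum_(i in I) \sum_(j in ~: I) (2 * dot v (z i) - 2 * dot v (z j)).
  by apply: ler_sum => i iI; apply: ler_sum => j jI; exact: key.
have vC : \sum_(j in ~: I) z j = - v by rewrite -sum_setC_opp.
have E1 : \sum_(i in I) \sum_(j in ~: I)
    (dot (z i) (z i) + dot (z j) (z j) - 2 * dot (z i) (z j))
    = #|~: I|%:R * sq I + #|I|%:R * sq (~: I) + 2 * dot v v.
  under eq_bigr => i _.
    rewrite sumrB big_split /= sumr_const -mulr_sumr -dot_sumr vC -/(sq _).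
    rewrite dotNr mulrN opprK; over.
  rewrite big_split big_split /= sumr_const -mulr_sumr -dot_suml -/v.
  by rewrite -/(part I) -/v sumrMnl !mulr_natl.
have E2 : \sum_(i in I) \sum_(j in ~: I) (2 * dot v (z i) - 2 * dot v (z j))
    = 2 * N%:R * dot v v.
  under eq_bigr => i _.
    rewrite sumrB sumr_const -mulr_sumr -dot_sumr vC dotNr mulrN opprK; over.
  rewrite big_split /= sumr_const sumrMnl -mulr_sumr -dot_sumr -/(part I) -/v.
  rewrite -mulrnDr [RHS]mulrAC mulr_natr; congr (_ *+ _).
  by rewrite addnC cardsC card_ord.
rewrite E1 E2 -/v; lra.
Qed.

(** The sum, over the indices outside [I], of the inequalities that express
optimality against adding one index. *)
Lemma add_optimal I :
  (forall J : {set 'I_N}, #|J| = #|I|.+1 -> dot (part J) (part J) <= dot (part I) (part I)) ->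
  sq (~: I) <= 2 * dot (part I) (part I).
Proof.
move=> opt; set v := part I.
have key j : j \in ~: I -> dot (z j) (z j) <= - 2 * dot v (z j).
  rewrite finset.in_setC => jI; have := opt (j |: I); rewrite cardsU1 jI => /(_ erefl).
  rewrite /part big_setU1 //= -/(part I) -/v !dotE (dotC (z j) v); lra.
have -> : 2 * dot v v = \sum_(j in ~: I) (- 2 * dot v (z j)).
  by rewrite -mulr_sumr -dot_sumr -/(part _) sum_setC_opp dotNr mulNr mulrN opprK.
exact: ler_sum.
Qed.

End BalancedSubset.

Section SimplexWidth.
Context {R : realType}.

(** The minimal width of the regular simplex with inradius one, which is the
constant of Steinhagen's inequality. *)
Definition simplex_width (n : nat) : R :=
  if odd n then 2 * Num.sqrt n%:R
  else 2 * (n%:R + 1) / Num.sqrt (n%:R + 2).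

Lemma simplex_width_gt0 n : (0 < n)%N -> 0 < simplex_width n.
Proof.
move=> n0; rewrite /simplex_width; case: ifP => _.
  by rewrite mulr_gt0 // sqrtr_gt0 ltr0n.
by rewrite divr_gt0 ?mulr_gt0 ?sqrtr_gt0 ?ltr_wpDl.
Qed.

Lemma sqr_simplex_width_odd n : odd n -> simplex_width n ^+ 2 = 4 * n%:R.
Proof.
by move=> on; rewrite /simplex_width on exprMn sqr_sqrtr //; congr (_ * _); ring.
Qed.

Lemma sqr_simplex_width_even n : ~~ odd n ->
  simplex_width n ^+ 2 * (n%:R + 2) = 4 * (n%:R + 1) ^+ 2.
Proof.
move=> /negPf on; rewrite /simplex_width on.
have n2 : 0 < n%:R + 2 :> R by rewrite ltr_wpDl.
rewrite expr_div_n sqr_sqrtr ?(ltW n2) // divfK ?gt_eqF // exprMn; ring.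
Qed.

Lemma sqr_sum_le N (a : 'I_N -> R) :
  (\sum_i a i) ^+ 2 <= N%:R * \sum_i a i ^+ 2.
Proof.
have : 0 <= \sum_i \sum_j (a i - a j) ^+ 2.
  by apply: sumr_ge0 => i _; apply: sumr_ge0 => j _; exact: sqr_ge0.
set A := \sum_i a i; set Q := \sum_i a i ^+ 2.
have E i : \sum_j (a i - a j) ^+ 2 = N%:R * a i ^+ 2 - 2 * A * a i + Q.
  rewrite (eq_bigr (fun j => a i ^+ 2 - 2 * a i * a j + a j ^+ 2)); last first.
    by move=> j _; ring.
  rewrite !big_split /= sumr_const card_ord sumrN -mulr_sumr -/A -/Q -mulr_natl.
  ring.
rewrite (eq_bigr _ (fun i _ => E i)) !big_split /= sumr_const card_ord sumrN.
rewrite -!mulr_sumr -/A -/Q -mulr_natl; lra.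
Qed.

Lemma exists_optimal_set N (P : pred {set 'I_N})
    (F : {set 'I_N} -> R) :
  (exists I, P I) -> exists2 I, P I & forall J, P J -> F J <= F I.
Proof.
by move=> [I0 PI0]; case: (@arg_maxP _ _ _ I0 P F PI0) => I PI Imax; exists I.
Qed.

Lemma exists_set_card N k : (k <= N)%N -> exists I : {set 'I_N}, #|I| == k.
Proof.
move=> kN; have : (0 < #|[set A : {set 'I_N} | #|A| == k]%SET|)%N.
  by rewrite card_draws card_ord bin_gt0.
by move=> /card_gt0P[I]; rewrite finset.inE => h; exists I.
Qed.

(** Choose, among the subsets of half the size, one with the longest sum.  When
the number of indices is odd, both sizes next to the half compete; since the
total sum is zero, complementary subsets have sums of equal length, and a subset
of the smaller size can be assumed optimal. *)
Lemma balanced_subset d n (z : 'I_n.+1 -> 'rV[R]_d) : (0 < n)%N -> \sum_i z i = 0 ->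
  exists I : {set 'I_n.+1},
    \sum_i enorm (z i) <= simplex_width n * enorm (\sum_(i in I) z i).
Proof.
move=> n0 z0; pose part (I : {set 'I_n.+1}) := \sum_(i in I) z i.
pose S := \sum_i dot (z i) (z i).
pose F (I : {set 'I_n.+1}) := dot (part I) (part I).
have W0 := ltW (simplex_width_gt0 n0).
suff [I hI] : exists I : {set 'I_n.+1}, n.+1%:R * S <= simplex_width n ^+ 2 * F I.
  exists I; rewrite -ler_sqr ?nnegrE ?mulr_ge0 ?enorm_ge0 ?sumr_ge0 //; last first.
    by move=> i _; exact: enorm_ge0.
  apply: le_trans (sqr_sum_le _) _; rewrite exprMn sqr_enorm.
  by apply: le_trans hI; under eq_bigr do rewrite sqr_enorm.
have SE (I : {set 'I_n.+1}) : S = \sum_(i in I) dot (z i) (z i) + \sum_(i in ~: I) dot (z i) (z i).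
  rewrite /S (bigID (mem I)) /=; congr (_ + _).
  by apply: eq_bigl => i; rewrite finset.in_setC.
have cardC (I : {set 'I_n.+1}) : (#|I| + #|~: I| = n.+1)%N by rewrite cardsC card_ord.
have FC (I : {set 'I_n.+1}) : F (~: I) = F I by rewrite /F /part (sum_setC_opp z0) dotNl dotNr opprK.
have [on|en] := boolP (odd n).
  rewrite (sqr_simplex_width_odd on); pose k := n.+1./2.
  have nk : n.+1 = (k + k)%N by rewrite addnn -[LHS]odd_double_half /= on.
  have [|I /eqP Ik Iopt] := @exists_optimal_set n.+1 (fun I => #|I| == k) F.
    by apply: exists_set_card; rewrite nk leq_addr.
  exists I; have := swap_optimal z0 (I := I).
  have -> : #|~: I| = k by apply/(@addnI k); rewrite -{1}Ik cardC.
  rewrite Ik -mulrDr -SE -/(F I) => /(_ (fun J Jk => Iopt J (introT eqP Jk))).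
  (* n + 1 = 2 k, and the swap inequality reads k S <= 2 n F *)
  have nkR : n%:R = k%:R + k%:R - 1 :> R by rewrite -natrD -nk -natr1 addrK.
  rewrite nkR -[n.+1%:R]natr1 nkR; lra.
pose k := n./2.
have nk : n.+1 = (k + k.+1)%N.
  by rewrite addnS addnn -[in LHS](odd_double_half n) (negPf en).
have [|I0 PI0 I0opt] := @exists_optimal_set n.+1
    (fun I => (#|I| == k) || (#|I| == k.+1)) F.
  have [I Ik] := @exists_set_card n.+1 k (leq_trans (leq_addr k.+1 k) (eq_leq (esym nk))).
  by exists I; rewrite Ik.
have [I Ik Iopt] : exists2 I : {set 'I_n.+1}, #|I| = k &
    forall J : {set 'I_n.+1}, (#|J| == k) || (#|J| == k.+1) -> F J <= F I.
  case/orP: PI0 => /eqP Ik; first by exists I0.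
  exists (~: I0); last by move=> J /I0opt; rewrite FC.
  by apply/(@addnI k.+1); rewrite -{1}Ik cardC nk addnC.
exists I; have := SE I.
set A := (X in _ = X + _); set B := (X in _ = _ + X) => SAB.
have add : B <= 2 * F I.
  apply: (add_optimal z0) => J; rewrite Ik => Jk; apply: Iopt.
  by rewrite Jk eqxx orbT.
have swap : k.+1%:R * A + k%:R * B <= (2 * n.+1%:R - 2) * F I.
  have := swap_optimal z0 (I := I); rewrite Ik.
  have -> : #|~: I| = k.+1 by apply/(@addnI k); rewrite -{1}Ik cardC.
  by apply=> J Jk; apply: Iopt; rewrite Jk eqxx.
have nkR : n%:R = k%:R + k%:R :> R by rewrite -natrD addnn -[in LHS](odd_double_half n) (negPf en).
have n2 : 0 < n%:R + 2 :> R by rewrite ltr_wpDl.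
have k0 : 0 <= k%:R :> R by [].
rewrite -(ler_pM2r n2) [leRHS]mulrAC sqr_simplex_width_even //.
move: swap; rewrite SAB -[n.+1%:R]natr1 -[k.+1%:R]natr1 nkR.
move=> swap; have : 0 <= (2 * (k%:R + k%:R + 1)) * (2 * (k%:R + k%:R + 1) * F I - (k%:R + 1) * (A + B)).
  apply: mulr_ge0; lra.
lra.
Qed.

End SimplexWidth.

(** * Caratheodory reduction *)

Section Caratheodory.
Context {R : realType} {n : nat}.
Implicit Types (q : 'rV[R]_n -> R).

(** The vectors, extended by a last coordinate one, have a nontrivial linear
relation by dimension. *)
Lemma affine_dependence m (f : 'I_m -> 'rV[R]_n) : (n.+1 < m)%N ->
  exists mu : 'I_m -> R,
    [/\ exists i, mu i != 0, \sum_i mu i = 0 & \sum_i mu i *: f i = 0].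
Proof.
move=> nm; pose M := \matrix_i row_mx (f i) (1 : 'rV[R]_1).
have : kermx M != 0.
  rewrite -mxrank_eq0 mxrank_ker -lt0n subn_gt0.
  by apply: leq_ltn_trans (rank_leq_col _) _; rewrite addn1.
move=> /rowV0Pn[mu /sub_kermxP muM mu0].
have E : mu *m M = row_mx (\sum_i mu 0 i *: f i) (\sum_i mu 0 i)%:M.
  apply/rowP => j; rewrite !mxE; case: splitP => k jk.
    rewrite summxE; apply: eq_bigr => i _; rewrite !mxE.
    by rewrite (_ : j = lshift 1 k) ?(unsplitK (inl _)) //; exact: val_inj.
  rewrite !mxE [k]ord1 /= mulr1n; apply: eq_bigr => i _; rewrite !mxE.
  rewrite (_ : j = rshift n k) ?(unsplitK (inr _)) /=; last exact: val_inj.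
  by rewrite ord1 mxE eqxx mulr1.
move: muM; rewrite E -(row_mx0 R 1 n 1) => /eq_row_mx[muf mu1].
exists (mu 0); split=> //.
  apply/existsP; apply: contraNT mu0; rewrite negb_exists => /forallP h.
  by apply/eqP/rowP => i; rewrite mxE; apply/eqP; have := h i; rewrite negbK.
by have /matrixP/(_ 0 0) := mu1; rewrite !mxE eqxx mulr1n.
Qed.

(** In a family of more than [n + 1] vectors with sum zero, an affine dependence
[mu], oriented so that it does not increase the sum of [q], allows to rescale the
vectors by [1 + t mu i] until the first of them vanishes. *)
Lemma caratheodory q :
  (forall t z, 0 <= t -> q (t *: z) = t * q z) ->
  (forall f : 'I_n.+1 -> 'rV[R]_n, \sum_i f i = 0 -> 0 <= \sum_i q (f i)) ->
  forall m (f : 'I_m -> 'rV[R]_n), \sum_i f i = 0 -> 0 <= \sum_i q (f i).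
Proof.
move=> qZ base; pose P m := forall f : 'I_m -> 'rV[R]_n,
  \sum_i f i = 0 -> 0 <= \sum_i q (f i).
have q0 : q 0 = 0 by rewrite -(scale0r 0) qZ // mul0r.
have down m : P m.+1 -> P m.
  move=> Pm f f0; pose g i := oapp f 0 (unlift ord_max i).
  have gl i : g (lift ord_max i) = f i by rewrite /g liftK.
  have gm : g ord_max = 0 by rewrite /g unlift_none.
  have := Pm g; rewrite (bigD1_ord ord_max) //= gm add0r.
  rewrite (bigD1_ord ord_max) //= gm q0 add0r.
  rewrite (eq_bigr _ (fun i _ => gl i)) => /(_ f0).
  by under eq_bigr do rewrite gl.
have up m : (n < m)%N -> P m -> P m.+1.
  move=> nm Pm f f0.
  (* replacing mu by its opposite if needed, the sum of q does not increase along mu *)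
  have [mu [mu_neq mu0 muf muq]] : exists mu : 'I_m.+1 -> R,
      [/\ exists i, mu i != 0, \sum_i mu i = 0, \sum_i mu i *: f i = 0 &
          \sum_i mu i * q (f i) <= 0].
    have [mu [[i mui] mu0 muf]] := affine_dependence f (nm : (n.+1 < m.+1)%N).
    have [mq|mq] := leP (\sum_i mu i * q (f i)) 0.
      by exists mu; split=> //; exists i.
    exists (fun i => - mu i); split.
    - by exists i; rewrite oppr_eq0.
    - by rewrite sumrN mu0 oppr0.
    - by under eq_bigr do rewrite scaleNr; rewrite sumrN muf oppr0.
    - by under eq_bigr do rewrite mulNr; rewrite sumrN oppr_le0 ltW.
  have [i0 i0min] : exists i0, forall i, mu i0 <= mu i.
    by case: (@arg_minP _ _ _ (ord0 : 'I_m.+1) predT mu) => // i _ h;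
      exists i => j; exact: h.
  have mui0 : mu i0 < 0.
    rewrite ltNge; apply/negP => h; case: mu_neq => i /negP; apply.
    have : \sum_j mu j == 0 by rewrite mu0.
    rewrite psumr_eq0 => [/allP/(_ i)|j _]; last exact: le_trans h (i0min j).
    by rewrite mem_index_enum => /(_ isT).
  pose t := - (mu i0)^-1.
  have t0 : 0 < t by rewrite oppr_gt0 invr_lt0.
  have c0 i : 0 <= 1 + t * mu i.
    have -> : 1 = - (t * mu i0) by rewrite /t mulNr opprK mulVf // lt_eqF.
    by rewrite addrC subr_ge0 ler_pM2l.
  have ci0 : 1 + t * mu i0 = 0 by rewrite /t mulNr mulVf ?lt_eqF // subrr.
  pose g i := (1 + t * mu i) *: f i.
  have gi0 : g i0 = 0 by rewrite /g ci0 scale0r.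
  have g0 : \sum_i g i = 0.
    under eq_bigr do rewrite /g scalerDl scale1r -scalerA.
    by rewrite big_split /= f0 -scaler_sumr muf scaler0 addr0.
  have gq : \sum_i q (g i) <= \sum_i q (f i).
    under eq_bigr do rewrite /g qZ // mulrDl mul1r -mulrA.
    by rewrite big_split /= -mulr_sumr gerDl pmulr_rle0.
  apply: le_trans _ gq; rewrite (bigD1_ord i0) //= gi0 q0 add0r.
  by apply: Pm; move: g0; rewrite (bigD1_ord i0) //= gi0 add0r.
move=> m; change (P m); have [mn|nm] := leqP m n.+1.
  rewrite -(subKn mn); elim: (n.+1 - m)%N => [|k IH]; first by rewrite subn0.
  have [kn|nk] := ltnP k n.+1; last first.
    by move: IH; rewrite (eqP (leqW nk : _ - _ == 0)%N) (eqP (nk : _ - _ == 0)%N).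
  by apply: down; rewrite subnSK.
rewrite -(subnKC nm) addSn; elim: (m - n.+2)%N => [|k IH].
  by rewrite addn0; exact: up.
by rewrite addnS; apply: up => //; rewrite -addnS leq_addr.
Qed.

End Caratheodory.

(** * Steinhagen's inequality *)

Section Steinhagen.
Context {R : realType} {n : nat}.
Implicit Types (K : set 'rV[R]_n) (x y z u v c : 'rV[R]_n) (a b r t rho : R).

Lemma supp_sum K (I : Type) (s : seq I) (P : pred I) (z : I -> 'rV[R]_n) :
  K !=set0 -> compact K ->
  supp K (\sum_(i <- s | P i) z i) <= \sum_(i <- s | P i) supp K (z i).
Proof.
move=> K0 cK; elim/big_rec2: _ => [|i a y _ ya]; first by rewrite supp0.
by apply: le_trans (suppD _ _ K0 cK) _; rewrite lerD2l.
Qed.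

Lemma min_width_ge0 K : convex_body K -> 0 <= min_width K.
Proof.
move=> bK; have K0 := body_nonempty bK; have [cK _ _] := bK.
rewrite min_widthE //.
have [->|S0] := eqVneq [set width K u | u in [set u | enorm u = 1]] set0.
  by rewrite inf0.
by apply: lb_le_inf => [|_ [u _ <-]]; [exact/set0P|exact: width_ge0].
Qed.

(** With [v] the sum over a balanced subset, [- v] is the sum over the
complement, so the width in the direction [v] is at most the sum of the support
values. *)
Lemma steinhagen_sum K (z : 'I_n.+1 -> 'rV[R]_n) : (0 < n)%N ->
  convex_body K -> \sum_i z i = 0 ->
  min_width K / simplex_width n * \sum_i enorm (z i) <= \sum_i supp K (z i).
Proof.
move=> n0 bK z0; have K0 := body_nonempty bK; have [cK _ _] := bK.
have W0 := @simplex_width_gt0 R n n0.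
have [I hI] := balanced_subset n0 z0; set v := \sum_(i in I) z i in hI.
have vC : \sum_(i in ~: I) z i = - v by rewrite sum_setC_opp.
apply: (@le_trans _ _ (min_width K * enorm v)).
  rewrite -mulrA ler_wpM2l ?min_width_ge0 // ler_pdivrMl //.
apply: le_trans (min_width_le v bK) _.
rewrite [leRHS](bigID (mem I)) /= /width -vC lerD ?supp_sum //.
rewrite (eq_bigl _ _ (fun i => finset.in_setC i I)).
exact: supp_sum.
Qed.

(** A convex body contains a ball of radius [w / W].  The function [p] below is the
largest sublinear function under [q]; a point that supports it is a centre. *)
Lemma steinhagen K : (0 < n)%N -> convex_body K ->
  exists c, eball c (min_width K / simplex_width n) `<=` K.
Proof.
move=> n0 bK; have K0 := body_nonempty bK; have [cK vK _] := bK.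
have W0 := @simplex_width_gt0 R n n0.
set psi := _ / _; have psi0 : 0 <= psi.
  by rewrite divr_ge0 ?min_width_ge0 // ltW.
pose q z := supp K z - psi * enorm z.
have qZ t z : 0 <= t -> q (t *: z) = t * q z.
  by move=> t0; rewrite /q suppZ // enormZ ger0_norm //; ring.
have q0 (s : seq 'rV[R]_n) : \sum_(z <- s) z = 0 -> 0 <= \sum_(z <- s) q z.
  rewrite 2!(big_nth (0 : 'rV[R]_n)) !big_mkord.
  apply: (@caratheodory _ _ q qZ _ (size s) (fun i => s`_i)) => f f0.
  by rewrite sumrB -mulr_sumr subr_ge0; exact: steinhagen_sum.
pose S y := [set \sum_(z <- s) q z | s in [set s : seq 'rV[R]_n | \sum_(z <- s) z = y]].
have S0 y : S y !=set0.
  by exists (\sum_(z <- [:: y]) q z), [:: y] => //=; rewrite big_seq1.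
have lbS y : has_lbound (S y).
  exists (- q (- y)) => _ [s /= sy <-].
  by have := q0 (- y :: s); rewrite !big_cons sy addNr => /(_ erefl); lra.
pose p y := inf (S y).
have ple s : p (\sum_(z <- s) z) <= \sum_(z <- s) q z.
  by apply: ge_inf => //; exists s.
have lep y a : (forall s : seq 'rV[R]_n,
    \sum_(z <- s) z = y -> a <= \sum_(z <- s) q z) -> a <= p y.
  by move=> h; apply: lb_le_inf => // _ [s /= sy <-]; exact: h.
have sp : sublinear p.
  split=> [x y|t x t0].
    rewrite -lerBlDr; apply: (lep) => s sx; rewrite lerBlDr -lerBlDl.
    apply: (lep) => s' sy; have := ple (s ++ s'); rewrite !big_cat /= sx sy; lra.
  have [->|tn0] := eqVneq t 0.
    by rewrite scale0r mul0r; have := ple [::]; rewrite !big_nil.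
  have tp : 0 < t by rewrite lt_def tn0.
  rewrite -ler_pdivrMl //; apply: (lep) => s sx; rewrite ler_pdivrMl //.
  have := ple [seq t *: z | z <- s]; rewrite !big_map -scaler_sumr sx.
  by under [in X in _ <= X]eq_bigr do rewrite qZ //; rewrite mulr_sumr.
have [x [xp _]] := sublinear_support 0 sp.
exists x => y yx; apply: compact_convex_separation => // u.
rewrite -[y](subrK x) dotDr addrC.
have xq : dot u x <= supp K u - psi * enorm u.
  by rewrite dotC; apply: le_trans (xp u) _; have := ple [:: u]; rewrite !big_seq1.
have := le_trans (dot_le u (y - x)) (ler_wpM2l (enorm_ge0 u) yx); lra.
Qed.

End Steinhagen.

(** * Circumradius, Minkowski asymmetry and the upper bounds *)

Section Functionals.
Context {R : realType} {n : nat}.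
Implicit Types (K : set 'rV[R]_n) (x y z u v c : 'rV[R]_n) (a b r t rho : R).
Implicit Types (A B : 'M[R]_n).

Lemma circumradius_le K c r : 0 <= r -> K `<=` eball c r -> circumradius K <= r.
Proof.
by move=> r0 Kr; apply: ge_inf; [exists 0 => ? []|split=> //; exists c].
Qed.

Lemma le_circumradius K a : compact K ->
  (forall r c, 0 <= r -> K `<=` eball c r -> a <= r) -> a <= circumradius K.
Proof.
move=> cK h; apply: lb_le_inf => [|r [r0 [c Kr]]]; last exact: h Kr.
have [r r0 Kr] := compact_enorm_bounded cK; exists r; split; first exact: ltW.
by exists 0 => x /Kr; rewrite /eball /= subr0.
Qed.

Lemma width_outer_ball K c r u : K !=set0 -> compact K -> K `<=` eball c r ->
  width K u <= 2 * r * enorm u.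
Proof.
move=> K0 cK Kr; have [x [y [Kx Ky ->]]] := width_attained u K0 cK.
have -> : x - y = (x - c) - (y - c) by rewrite opprB addrA subrK.
rewrite dotBr; have := dot_le u (x - c); have := ge_dot u (y - c).
have := ler_wpM2l (enorm_ge0 u) (Kr x Kx); have := ler_wpM2l (enorm_ge0 u) (Kr y Ky).
lra.
Qed.

Lemma min_width_outer_ball K c r : (0 < n)%N -> convex_body K ->
  K `<=` eball c r -> min_width K <= 2 * r.
Proof.
move=> n0 bK Kr; have K0 := body_nonempty bK; have [cK _ _] := bK.
pose e : 'rV[R]_n := delta_mx 0 (Ordinal n0).
have := min_width_le e bK; have := width_outer_ball e K0 cK Kr.
by rewrite enorm_delta !mulr1 => h1 h2; exact: le_trans h2 h1.
Qed.

Lemma min_width_gt0 K : (0 < n)%N -> convex_body K -> 0 < min_width K.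
Proof.
move=> n0 bK; have [cK _ [c /interior_ball[r r0 rK]]] := bK.
apply: (@lt_le_trans _ _ (2 * r)); first by rewrite mulr_gt0.
apply: le_min_width => // u u1.
by have := width_inner_ball u cK (ltW r0) (ex_intro _ c rK); rewrite u1 mulr1.
Qed.

Lemma circumradius_gt0 K : (0 < n)%N -> convex_body K -> 0 < circumradius K.
Proof.
move=> n0 bK; have [cK _ _] := bK.
apply: (@lt_le_trans _ _ (min_width K / 2)).
  by rewrite divr_gt0 // min_width_gt0.
apply: le_circumradius => // r c _ Kr.
by rewrite ler_pdivrMr // mulrC (min_width_outer_ball n0 bK Kr).
Qed.

Lemma ratio_le K a : (0 < n)%N -> convex_body K -> 0 < a ->
  (forall r c, 0 <= r -> K `<=` eball c r -> min_width K <= a * (2 * r)) ->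
  min_width K / (2 * circumradius K) <= a.
Proof.
move=> n0 bK a0 h; have [cK _ _] := bK.
rewrite ler_pdivrMr ?mulr_gt0 ?circumradius_gt0 // mulrA -ler_pdivrMl ?mulr_gt0 //.
apply: le_circumradius => // r c r0 Kr.
by rewrite ler_pdivrMl ?mulr_gt0 // -mulrA; exact: h Kr.
Qed.

Lemma asymmetry_le K c rho : 0 <= rho ->
  translate c (reflect_set K) `<=` dilate rho K -> minkowski_asymmetry K <= rho.
Proof.
by move=> r0 h; apply: ge_inf; [exists 0 => ? []|split=> //; exists c].
Qed.

Lemma mem_dilate K rho y : rho != 0 -> dilate rho K y <-> K (rho^-1 *: y).
Proof.
move=> r0; split=> [[x Kx <-]|h]; first by rewrite scalerA mulVf // scale1r.
by exists (rho^-1 *: y) => //; rewrite scalerA mulfV // scale1r.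
Qed.

(** The reflection of the outer ball is a translate of the outer ball, hence a
translate of the dilated inner ball. *)
Lemma asymmetry_nested_balls K c0 r0 c1 r1 : 0 < r0 -> 0 < r1 ->
  eball c0 r0 `<=` K -> K `<=` eball c1 r1 -> minkowski_asymmetry K <= r1 / r0.
Proof.
move=> r00 r10 hi ho; have rho0 : 0 < r1 / r0 by rewrite divr_gt0.
apply: (@asymmetry_le _ ((r1 / r0) *: c0 + c1)); first exact: ltW.
move=> _ [_ [x Kx <-] <-]; apply/mem_dilate; first by rewrite gt_eqF.
apply: hi; rewrite /eball /=.
have -> : (r1 / r0)^-1 *: ((r1 / r0) *: c0 + c1 + - x) - c0
    = (r1 / r0)^-1 *: (c1 - x).
  by apply/rowP => i; rewrite !mxE; field; rewrite !gt_eqF.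
rewrite enormZ ger0_norm ?invr_ge0 ?(ltW rho0) // invf_div enormB.
by rewrite mulrAC ler_pdivrMr // ler_wpM2l ?(ltW r00) //; exact: ho.
Qed.

Lemma le_asymmetry K a : convex_body K ->
  (forall rho c, 0 <= rho -> translate c (reflect_set K) `<=` dilate rho K -> a <= rho) ->
  a <= minkowski_asymmetry K.
Proof.
move=> [cK _ [c0 /interior_ball[r0 r00 hi]]] h.
apply: lb_le_inf => [|rho [r1 [c hc]]]; last exact: h hc.
have [r1 r10 Kr] := compact_enorm_bounded cK.
have rho0 : 0 < r1 / r0 by rewrite divr_gt0.
exists (r1 / r0); split; first exact: ltW.
exists ((r1 / r0) *: c0) => _ [_ [x Kx <-] <-]; apply/mem_dilate.
  by rewrite gt_eqF.
apply: hi; rewrite /eball /= scalerDr scalerA mulVf ?gt_eqF // scale1r.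
rewrite addrC addKr scalerN enormN enormZ ger0_norm ?invr_ge0 ?(ltW rho0) //.
by rewrite invf_div mulrAC ler_pdivrMr // ler_wpM2l ?(ltW r00) //; exact: Kr.
Qed.

(** Reflection does not change the width and dilation by [rho] multiplies it by
[rho]. *)
Lemma asymmetry_ge1 K : (0 < n)%N -> convex_body K -> 1 <= minkowski_asymmetry K.
Proof.
move=> n0 bK; have K0 := body_nonempty bK; have [cK _ _] := bK.
apply: le_asymmetry => // rho c rho0 h.
pose e : 'rV[R]_n := delta_mx 0 (Ordinal n0).
have e0 : e != 0 by rewrite -enorm_eq0 enorm_delta oner_eq0.
have [x [y [Kx Ky wE]]] := width_attained e K0 cK.
have im z : K z -> exists2 z', K z' & rho *: z' = c - z.
  by move=> Kz; have [|z' Kz' <-] := h (c - z); [exists (- z) => //; exists z|exists z'].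
have [x' Kx' xE] := im x Kx; have [y' Ky' yE] := im y Ky.
have w0 := width_gt0 bK e0.
rewrite -(ler_pM2r w0) mul1r {1}wE.
have -> : x - y = rho *: (y' - x').
  by rewrite scalerBr xE yE; apply/rowP => i; rewrite !mxE; ring.
by rewrite dotZr ler_wpM2l // width_ge.
Qed.

Lemma asymmetry_linear_image K A : A \in unitmx ->
  minkowski_asymmetry (linear_image A K) = minkowski_asymmetry K.
Proof.
move=> uA; congr inf; apply/seteqP; split => rho [rho0 [c h]]; split=> //.
  exists (c *m invmx A) => _ [_ [x Kx <-] <-].
  have [|_ [y Ky <-] E] := h (c - x *m A).
    by exists (- (x *m A)) => //; exists (x *m A) => //; exists x.
  by exists y => //; rewrite -[LHS](mulmxK uA) -scalemxAl E mulmxBl mulmxK.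
exists (c *m A) => _ [_ [_ [x Kx <-] <-] <-].
have [|y Ky E] := h (c - x); first by exists (- x) => //; exists x.
by exists (y *m A); [exists y|rewrite scalemxAl E mulmxBl].
Qed.

(** With the centre of the ball at the origin, [w |u| <= h u + h (- u)] and
[h (- u) <= r |u|] combine to [(w - r) h (- u) <= r h u], so that
[- K] lies in [r / (w - r)] times [K]. *)
Lemma width_asymmetry_le K c r : (0 < n)%N -> convex_body K -> 0 <= r ->
  K `<=` eball c r ->
  minkowski_asymmetry K * min_width K <= r * (minkowski_asymmetry K + 1).
Proof.
move=> n0 bK r0 Kr; have K0 := body_nonempty bK; have [cK vK _] := bK.
have w0 := min_width_gt0 n0 bK; have w2 := min_width_outer_ball n0 bK Kr.
have s1 := asymmetry_ge1 n0 bK.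
set w := min_width K in w0 w2 *; set s := minkowski_asymmetry K in s1 *.
have [wr|rw] := leP w r; first by nra.
have rp : 0 < r by lra.
suff : s <= r / (w - r) by rewrite ler_pdivlMr ?subr_gt0 //; lra.
have rho0 : 0 < r / (w - r) by rewrite divr_gt0 ?subr_gt0.
apply: (@asymmetry_le _ ((w / (w - r)) *: c)); first exact: ltW.
move=> _ [_ [x Kx <-] <-]; apply/mem_dilate; first by rewrite gt_eqF.
apply: compact_convex_separation => // u.
rewrite dotZr invf_div mulrC mulrA ler_pdivrMr // dotDr dotZr dotNr.
have hN : supp K (- u) <= - dot u c + r * enorm u.
  apply: supp_le => // z /Kr /= zr.
  have -> : dot (- u) z = - dot u c - dot u (z - c) by rewrite !dotE; ring.
  have := ge_dot u (z - c); have := ler_wpM2l (enorm_ge0 u) zr; lra.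
have hx := supp_ge (- u) cK Kx; rewrite dotNl in hx.
have hw := min_width_le u bK; rewrite -/w /width in hw.
have wr0 : w - r != 0 by rewrite gt_eqF // subr_gt0.
have -> : (w / (w - r) * dot u c - dot u x) * (w - r)
   = w * dot u c - (w - r) * dot u x by field.
have h1 : w * (supp K (- u) + dot u c) <= r * (supp K u + supp K (- u)).
  apply: (@le_trans _ _ (w * (r * enorm u))); first by apply: ler_wpM2l; lra.
  by rewrite mulrCA ler_wpM2l.
have h2 : 0 <= (w - r) * (supp K (- u) + dot u x) by rewrite mulr_ge0; lra.
lra.
Qed.

Lemma simplex_width_asymmetry_le K c r : (0 < n)%N -> convex_body K -> 0 <= r ->
  K `<=` eball c r ->
  minkowski_asymmetry K * min_width K <= r * simplex_width n.
Proof.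
move=> n0 bK r0 Kr; have [c0 hc0] := steinhagen n0 bK.
have w0 := min_width_gt0 n0 bK; have w2 := min_width_outer_ball n0 bK Kr.
have W0 := @simplex_width_gt0 R n n0.
have psi0 : 0 < min_width K / simplex_width n by rewrite divr_gt0.
have := asymmetry_nested_balls psi0 _ hc0 Kr.
have rp : 0 < r by lra.
by move=> /(_ rp); rewrite invf_div mulrA ler_pdivlMr.
Qed.

Lemma ratio_upper_boundE (s : R) :
  ratio_upper_bound n s = Num.min (simplex_width n / (2 * s)) ((s + 1) / (2 * s)).
Proof.
rewrite /ratio_upper_bound /simplex_width; case: ifP => _; congr (Num.min _ _).
  by rewrite !invfM; move: s^-1 => a; field.
by rewrite !invfM; move: s^-1 (Num.sqrt _)^-1 => a b; field.
Qed.

Lemma ratio_le_upper_bound K : (0 < n)%N -> convex_body K ->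
  min_width K / (2 * circumradius K) <= ratio_upper_bound n (minkowski_asymmetry K).
Proof.
move=> n0 bK; have s1 := asymmetry_ge1 n0 bK.
have W0 := @simplex_width_gt0 R n n0.
have s2 : 0 < 2 * minkowski_asymmetry K by lra.
rewrite ratio_upper_boundE le_min; apply/andP; split; apply: ratio_le => //.
- by rewrite divr_gt0.
- move=> r c r0 Kr; rewrite mulrAC ler_pdivlMr //.
  by have := simplex_width_asymmetry_le n0 bK r0 Kr; lra.
- by rewrite divr_gt0 //; lra.
- move=> r c r0 Kr; rewrite mulrAC ler_pdivlMr //.
  by have := width_asymmetry_le n0 bK r0 Kr; lra.
Qed.

End Functionals.

(** * Affine images and positions in the unit ball *)

Section AffineImages.
Context {R : realType} {n : nat}.
Implicit Types (K : set 'rV[R]_n) (x y z u v c : 'rV[R]_n) (a b r t rho : R).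
Implicit Types (A B : 'M[R]_n).

(** Linear maps are bounded; this makes images of balls under invertible maps
contain balls. *)
Lemma mulmx_enorm_le A : exists2 C, 0 < C & forall x, enorm (x *m A) <= C * enorm x.
Proof.
exists (\sum_i enorm (row i A) + 1) => [|x].
  by rewrite ltr_wpDl // sumr_ge0 // => i _; exact: enorm_ge0.
rewrite mulmx_sum_row; apply: le_trans (enorm_sum _ _) _.
apply: (@le_trans _ _ ((\sum_i enorm (row i A)) * enorm x)).
  rewrite mulr_suml; apply: ler_sum => i _; rewrite enormZ mulrC.
  by rewrite ler_wpM2l ?enorm_ge0 // coord_le_enorm.
by rewrite ler_wpM2r ?enorm_ge0 // lerDl.
Qed.

Lemma body_linear_image K A : A \in unitmx -> convex_body K ->
  convex_body (linear_image A K).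
Proof.
move=> uA [cK vK [c /interior_ball[r r0 rK]]]; split.
- apply: continuous_compact cK; apply: continuous_subspaceT.
  apply: continuous_mx => i j.
  have -> : (fun x => (x *m A) i j) = dot (\row_k A k j).
    apply/funext => x; rewrite !mxE; apply: eq_bigr => k _.
    by rewrite !mxE mulrC (ord1 i).
  exact: continuous_dot.
- apply/convexP => _ _ t [x Kx <-] [y Ky <-] t01.
  exists (t *: x + (1 - t) *: y); first by move/convexP: vK; apply.
  by rewrite mulmxDl !scalemxAl.
have [C C0 hC] := mulmx_enorm_le (invmx A).
exists (c *m A); apply/interior_ball; exists (r / C); first by rewrite divr_gt0.
move=> y; rewrite /eball /= ler_pdivlMr // mulrC => yr.
exists (y *m invmx A); last by rewrite mulmxKV.
apply: rK; apply: le_trans yr; rewrite -{1}(mulmxK uA c) -mulmxBl; exact: hC.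
Qed.

Lemma body_translate K c : convex_body K -> convex_body (translate c K).
Proof.
move=> [cK vK [d /interior_ball[r r0 rK]]]; split.
- apply: continuous_compact cK; apply: continuous_subspaceT => x.
  by apply: continuousD; [exact: cst_continuous|exact: cvg_id].
- apply/convexP => _ _ t [x Kx <-] [y Ky <-] t01.
  exists (t *: x + (1 - t) *: y); first by move/convexP: vK; apply.
  by apply/rowP => i; rewrite !mxE; ring.
exists (c + d); apply/interior_ball; exists r => // y yr.
exists (y - c); last by rewrite addrC subrK.
by apply: rK; move: yr; rewrite /eball /= opprD addrA.
Qed.

Lemma supp_translate K c u : K !=set0 -> compact K ->
  supp (translate c K) u = dot u c + supp K u.
Proof.
move=> K0 cK; have [x Kx hx] := supp_attained u K0 cK.
have ub : ubound [set dot u z | z in translate c K] (dot u c + supp K u).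
  by move=> _ [_ [y Ky <-] <-]; rewrite dotDr lerD2l supp_ge.
apply/eqP; rewrite eq_le; apply/andP; split.
  by apply: ge_sup => //; exists (dot u (c + x)), (c + x) => //; exists x.
rewrite hx -dotDr; apply: ub_le_sup; first by exists (dot u c + supp K u).
by exists (c + x) => //; exists x.
Qed.

Lemma min_width_translate K c : convex_body K ->
  min_width (translate c K) = min_width K.
Proof.
move=> bK; have K0 := body_nonempty bK; have [cK _ _] := bK.
rewrite !min_widthE //; last exact: body_translate.
congr inf; apply: eq_imagel => u _.
by rewrite /width !supp_translate // dotNl addrACA addrN add0r.
Qed.

Lemma linear_image_mul K A B :
  linear_image B (linear_image A K) = linear_image (A *m B) K.
Proof.
apply/seteqP; split => [_ [_ [x Kx <-] <-]|_ [x Kx <-]].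
  by exists x => //; rewrite mulmxA.
by exists (x *m A); [exists x|rewrite mulmxA].
Qed.

Lemma linear_image_translate K A c :
  linear_image A (translate c K) = translate (c *m A) (linear_image A K).
Proof.
apply/seteqP; split => [_ [_ [x Kx <-] <-]|_ [_ [x Kx <-] <-]].
  by exists (x *m A); [exists x|rewrite mulmxDl].
by exists (c + x); [exists x|rewrite mulmxDl].
Qed.

(** The pairs [(A, c)] are encoded as row vectors of length [n * n + n], for which
closed bounded sets are compact.  They are bounded because [K] contains a ball of
radius [r], so the rows of [A] have length at most [1 / r]. *)
Lemma max_over_ball_positions K (F : 'M[R]_n -> R) :
  convex_body K -> continuous F ->
  exists A c, (forall x, K x -> enorm (x *m A + c) <= 1) /\
    forall B d, (forall x, K x -> enorm (x *m B + d) <= 1) -> F B <= F A.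
Proof.
move=> [cK vK [x0 /interior_ball[r r0 rK]]] cF.
pose dec (w : 'rV[R]_(n * n + n)) : 'M[R]_n := vec_mx (lsubmx w).
pose off (w : 'rV[R]_(n * n + n)) : 'rV[R]_n := rsubmx w.
have c_dec : continuous dec.
  apply: continuous_mx => i j.
  have -> : (fun w => dec w i j) = (fun w => w 0 (lshift n (mxvec_index i j))).
    by apply/funext => w; rewrite !mxE.
  exact: coord_continuous.
have c_off : continuous off.
  apply: continuous_mx => i j.
  have -> : (fun w => off w i j) = (fun w => w 0 (rshift (n * n) j)).
    by apply/funext => w; rewrite !mxE ord1.
  exact: coord_continuous.
pose S := [set w | forall x, K x -> enorm (x *m dec w + off w) <= 1].
have c_img x : continuous (fun w => x *m dec w + off w).
  apply: continuous_mx => i j.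
  have -> : (fun w => (x *m dec w + off w) i j) =
      (fun w => \sum_k x i k * dec w k j + off w i j).
    by apply/funext => w; rewrite !mxE.
  move=> w; apply: continuousD.
    apply: (continuous_sumr (F := fun k w => x i k * dec w k j)) => k w'.
    apply: (@continuousM R _ (fun=> x i k)); first exact: cst_continuous.
    apply: (@continuous_comp _ _ _ dec (fun B : 'M[R]_n => B k j)).
      exact: c_dec.
    exact: coord_continuous.
  apply: (@continuous_comp _ _ _ off (fun x : 'rV[R]_n => x i j)).
    exact: c_off.
  exact: coord_continuous.
have clS : closed S.
  have -> : S = \bigcap_(x in K) [set w | enorm (x *m dec w + off w) <= 1].
    by [].
  apply: closed_bigI => x _; apply: closed_le_fun => w.
  apply: (@continuous_comp _ _ _ (fun w => x *m dec w + off w) enorm).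
    exact: c_img.
  exact: continuous_enorm.
have Kx0 : K x0 by apply: rK; rewrite /eball /= subrr enorm0 ltW.
have row_le w i : S w -> enorm (row i (dec w)) <= r^-1.
  move=> Sw; pose e : 'rV[R]_n := delta_mx 0 i.
  have Ke s : `|s| <= r -> K (x0 + s *: e).
    by move=> sr; apply: rK; rewrite /eball /= addrC addKr enormZ enorm_delta mulr1.
  have rr : `|r| <= r by rewrite ger0_norm // ltW.
  have Nrr : `|- r| <= r by rewrite normrN.
  have h1 := Sw _ (Ke r rr); have h2 := Sw _ (Ke (- r) Nrr).
  have := enormD ((x0 + r *: e) *m dec w + off w)
    (- ((x0 + - r *: e) *m dec w + off w)).
  rewrite [in X in _ <= X -> _]enormN.
  have -> : (x0 + r *: e) *m dec w + off w - ((x0 + - r *: e) *m dec w + off w)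
      = (2 * r) *: row i (dec w).
    rewrite rowE -/e !mulmxDl -!scalemxAl; apply/rowP => j; rewrite !mxE; ring.
  rewrite enormZ ger0_norm; last by rewrite mulr_ge0 // ltW.
  move=> h; rewrite -[r^-1]mulr1 ler_pdivlMl //; lra.
pose M := r^-1 + (1 + \sum_i `|x0 0 i| * r^-1).
have ri0 : 0 <= r^-1 by rewrite invr_ge0 ltW.
have sx0 : 0 <= \sum_i `|x0 0 i| * r^-1 by apply: sumr_ge0 => i _; exact: mulr_ge0.
have bS w : S w -> enorm w <= (n * n + n)%:R * M.
  move=> Sw; apply: le_trans (enorm_le_norm _) _; rewrite ler_wpM2l //.
  rewrite [leLHS]/Num.norm /= mx_normrE; apply/bigmax_leP; split.
    by rewrite /M; lra.
  move=> [i0 k] _ /=; rewrite ord1; have [k' ->|k' ->] := split_ordP k.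
    case/mxvec_indexP: k' => i j.
    have -> : w 0 (lshift n (mxvec_index i j)) = row i (dec w) 0 j by rewrite !mxE.
    have := coord_le_enorm (row i (dec w)) j; have := row_le w i Sw.
    rewrite /M; lra.
  have -> : w 0 (rshift (n * n) k') = off w 0 k' by rewrite !mxE.
  apply: le_trans (coord_le_enorm _ _) _.
  have -> : off w = (x0 *m dec w + off w) - x0 *m dec w by rewrite addrC addKr.
  apply: le_trans (enormD _ _) _; rewrite enormN.
  have : enorm (x0 *m dec w) <= \sum_i `|x0 0 i| * r^-1.
    rewrite mulmx_sum_row; apply: le_trans (enorm_sum _ _) _.
    by apply: ler_sum => i _; rewrite enormZ ler_wpM2l // row_le.
  have := Sw _ Kx0; rewrite /M; lra.
have S0 : S !=set0.
  exists 0 => x _; have -> : dec 0 = 0 by rewrite /dec !linear0.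
  by rewrite mulmx0 add0r /off linear0 enorm0.
have cFd : continuous (F \o dec).
  by move=> w; apply: continuous_comp; [exact: c_dec|exact: cF].
have [w Sw wmax] := compact_max S0 (closed_enorm_bounded_compact clS bS) cFd.
exists (dec w), (off w); split=> // B d h.
pose w' := row_mx (mxvec B) d.
have dE : dec w' = B by rewrite /dec row_mxKl mxvecK.
have oE : off w' = d by rewrite /off row_mxKr.
by have /= := wmax w'; rewrite dE; apply=> x Kx; rewrite dE oE; exact: h.
Qed.

End AffineImages.

(** * Loewner position and existence of the maximum *)

Section Positions.
Context {R : realType} {n : nat}.
Implicit Types (K : set 'rV[R]_n) (x y z u v c : 'rV[R]_n) (a b r t rho : R).
Implicit Types (A B : 'M[R]_n).

(** Both factorisations of the same block matrix, eliminating either of its two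
off-diagonal blocks. *)
Lemma det_add_rank1 (u v : 'rV[R]_n) : \det (1%:M + u^T *m v) = 1 + dot v u.
Proof.
pose X : 'M[R]_(1 + n) := block_mx 1%:M (- v) u^T 1%:M.
have E1 : block_mx 1%:M 0 u^T 1%:M *m block_mx 1%:M (- v) 0 (1%:M + u^T *m v) = X.
  rewrite mulmx_block !(mul0mx, mulmx0, mul1mx, mulmx1, add0r, addr0).
  by rewrite mulmxN addrCA addNr addr0.
have E2 : block_mx 1%:M (- v) 0 1%:M *m block_mx (1%:M + v *m u^T) 0 u^T 1%:M = X.
  rewrite mulmx_block !(mul0mx, mulmx0, mul1mx, mulmx1, add0r, addr0).
  by rewrite mulNmx addrK.
have := congr1 determinant (etrans E1 (esym E2)).
rewrite !det_mulmx !det_ublock !det_lblock !det1 !mul1r mulr1 => ->.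
rewrite det_mx11 !mxE eqxx; congr (_ + _).
by apply: eq_bigr => i _; rewrite mxE.
Qed.

(** An upper bound for [(1 + y) ^+ k] that stays close to [1 + k y] for small
[y]. *)
Lemma bernoulli_inv (y : R) (k : nat) : 0 <= y -> (1 + y) ^+ k * (1 - k%:R * y) <= 1.
Proof.
move=> y0; elim: k => [|k IH]; first by rewrite expr0 mul0r subr0 mulr1.
apply: le_trans IH; rewrite exprSr -mulrA ler_wpM2l ?exprn_ge0 //; first lra.
rewrite -natr1; have : 0 <= k%:R * y ^+ 2 by rewrite mulr_ge0 ?sqr_ge0.
have := sqr_ge0 y; lra.
Qed.

(** On the slab [(b - t) (t - a) >= 0] with [t = dot y v], so the points of the ball
in the slab satisfy [|y|^2 - e (b - t) (t - a) <= 1] for [e > 0].  This describes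
an ellipsoid, which [y |-> y B + d] sends into the unit ball; the squared
determinant of [B] is [(1 + e) / (1 + e (q + e)) ^+ n], which exceeds one for small
[e] since [n q < 1]. *)
Lemma slab_ball_improvement v a b : (0 < n)%N -> enorm v = 1 ->
  -1 <= a -> a <= b -> b <= 1 -> n%:R * ((b - a) / 2) ^+ 2 < 1 ->
  exists B d, 1 < \det B /\
    forall y, enorm y <= 1 -> a <= dot y v <= b -> enorm (y *m B + d) <= 1.
Proof.
move=> n0 v1 a1 ab b1; set q := _ ^+ 2 => nq.
have vv : dot v v = 1 by rewrite -sqr_enorm v1 expr1n.
have q0 : 0 <= q by exact: sqr_ge0.
have nR : 1 <= n%:R :> R by rewrite ler1n.
(* small enough for n (q + e) (1 + e) < 1 *)
pose e : R := (1 - n%:R * q) / (2 * (1 + 2 * n%:R)).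
have eE : e * (2 * (1 + 2 * n%:R)) = 1 - n%:R * q by rewrite divfK //; lra.
have e0 : 0 < e by rewrite divr_gt0 //; lra.
have nq0 : 0 <= n%:R * q by rewrite mulr_ge0.
have e1 : e <= 1 by nra.
pose y := e * (q + e).
have y0 : 0 <= y by rewrite /y mulr_ge0 //; lra.
pose rho := 1 + y.
have rho1 : 1 <= rho by rewrite /rho; lra.
have ny : 1 < (1 + e) * (1 - n%:R * y).
  have h : n%:R * (q + e) * (1 + e) < 1 by nra.
  have : 0 < e * (1 - n%:R * (q + e) * (1 + e)) by rewrite mulr_gt0 //; lra.
  rewrite /y; lra.
have rhon : rho ^+ n < 1 + e.
  rewrite ltNge; apply/negP => h; have := bernoulli_inv n y0; rewrite -/rho.
  have ny1 : 0 < 1 - n%:R * y by nra.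
  have := ler_wpM2r (ltW ny1) h; lra.
pose s := Num.sqrt (1 + e); pose w := Num.sqrt rho.
have ss : s ^+ 2 = 1 + e by rewrite sqr_sqrtr //; lra.
have ww : w ^+ 2 = rho by rewrite sqr_sqrtr //; lra.
have s0 : 0 < s by rewrite sqrtr_gt0; lra.
have w0 : 0 < w by rewrite sqrtr_gt0; lra.
pose S : 'M[R]_n := 1%:M + ((s - 1) *: v)^T *m v.
have xS x : x *m S = x + ((s - 1) * dot x v) *: v.
  rewrite /S mulmxDr mulmx1 linearZ /= -scalemxAl -scalemxAr mulmxA; congr (_ + _).
  rewrite -scalerA; congr (_ *: _).
  have -> : x *m v^T = (dot x v)%:M.
    apply/matrixP => i j; rewrite !ord1 !mxE eqxx mulr1n.
    by apply: eq_bigr => k _; rewrite mxE.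
  by rewrite mul_scalar_mx.
have dS : \det S = s by rewrite det_add_rank1 dotZr vv; lra.
(* the centre of the ellipsoid is k v *)
pose k := e * (a + b) / (2 * (1 + e)).
exists (w^-1 *: S), (- k *: v *m (w^-1 *: S)); split.
  rewrite detZ dS exprVn mulrC ltr_pdivlMr ?exprn_gt0 // mul1r.
  rewrite -ltr_sqr ?nnegrE ?exprn_ge0 ?(ltW w0) ?(ltW s0) //.
  by rewrite ss exprAC ww.
move=> x x1 /andP[ax xb]; rewrite -mulmxDl -scalemxAr enormZ.
rewrite ger0_norm ?invr_ge0 ?(ltW w0) // ler_pdivrMl // mulr1.
apply: enorm_le; first exact: ltW.
rewrite xS ww; set t := dot x v in ax xb *.
have xx : dot x x <= 1 by rewrite -sqr_enorm expr_le1 ?enorm_ge0.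
have -> : dot (x + - k *: v) v = t - k by rewrite dotDl dotZl vv -/t; lra.
have kE : 2 * (1 + e) * k = e * (a + b).
  by rewrite /k mulrC divfK // gt_eqF //; lra.
have normE r : dot (x + - k *: v + r *: v) (x + - k *: v + r *: v) =
    dot x x - t ^+ 2 + (t - k + r) ^+ 2.
  by rewrite !dotE vv (dotC v x) -/t; ring.
rewrite normE (_ : _ + (t - k + _) ^+ 2 = dot x x - t ^+ 2 + s ^+ 2 * (t - k) ^+ 2);
  last by ring.
rewrite ss /rho /y.
have h1 : 0 <= e * ((b - t) * (t - a)) by rewrite !mulr_ge0 ?subr_ge0 // ltW.
have h2 : q + a * b = ((a + b) / 2) ^+ 2 by rewrite /q; field.
have h3 : (1 + e) * k ^+ 2 <= e ^+ 2.
  have : (1 + e) * ((1 + e) * k ^+ 2) <= (1 + e) * e ^+ 2.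
    have -> : (1 + e) * ((1 + e) * k ^+ 2) = (e * (a + b) / 2) ^+ 2.
      by rewrite -kE; field.
    have : ((a + b) / 2) ^+ 2 <= 1 by nra.
    nra.
  by rewrite ler_pM2l //; lra.
have h4 := sqr_ge0 ((a + b) / 2).
have h5 : 0 <= e * ((a + b) / 2) ^+ 2 by rewrite mulr_ge0 // ltW.
have -> : dot x x - t ^+ 2 + (1 + e) * (t - k) ^+ 2 =
  dot x x + e * t ^+ 2 - 2 * (1 + e) * k * t + (1 + e) * k ^+ 2 by ring.
rewrite kE; nra.
Qed.

End Positions.

Section Maximum.
Context {R : realType} {n : nat}.
Implicit Types (K : set 'rV[R]_n) (x y z u v c : 'rV[R]_n) (a b r t rho : R).
Implicit Types (A B : 'M[R]_n).

(** At the maximum of the determinant, an improvement by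
[slab_ball_improvement] is impossible. *)
Lemma loewner_position K : (0 < n)%N -> convex_body K ->
  exists A c, [/\ A \in unitmx, forall x, K x -> enorm (x *m A + c) <= 1 &
    2 / Num.sqrt n%:R <= min_width (linear_image A K)].
Proof.
move=> n0 bK; have K0 := body_nonempty bK; have [cK vK _] := bK.
have [A [c [Ac Amax]]] := max_over_ball_positions bK (@continuous_det R n).
have detA : 0 < \det A.
  have [r r0 Kr] := compact_enorm_bounded cK.
  have := Amax (r^-1)%:M 0; rewrite det_scalar => h.
  apply: lt_le_trans (h _); first by rewrite exprn_gt0 // invr_gt0.
  move=> x /Kr xr; rewrite addr0 mul_mx_scalar enormZ ger0_norm ?invr_ge0 ?(ltW r0) //.
  by rewrite ler_pdivrMl // mulr1.
have uA : A \in unitmx by rewrite unitmxE unitfE gt_eqF.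
exists A, c; split=> //.
have bL := body_linear_image uA bK.
have [cL _ _] := bL; have L0 := body_nonempty bL.
have nR : 0 < n%:R :> R by rewrite ltr0n.
have sn : 0 < Num.sqrt n%:R :> R by rewrite sqrtr_gt0.
apply: le_min_width => // v v1; rewrite leNgt; apply/negP => wlt.
have [p [q [[p' Kp pE] [q' Kq qE] wE]]] := width_attained v L0 cL.
pose b := dot v (p + c); pose a := dot v (q + c).
have wab : width (linear_image A K) v = b - a by rewrite wE /a /b !dotE; ring.
have bnd x : K x -> `|dot v (x *m A + c)| <= 1.
  move=> Kx; rewrite ler_norml; have := dot_le v (x *m A + c).
  have := ge_dot v (x *m A + c); have := Ac _ Kx; rewrite v1 !mul1r => h1 h2 h3.
  by apply/andP; split; lra.
have ab : a <= b by rewrite -subr_ge0 -wab width_ge0.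
have a1 : -1 <= a by have := bnd _ Kq; rewrite qE ler_norml => /andP[].
have b1 : b <= 1 by have := bnd _ Kp; rewrite pE ler_norml => /andP[].
have small : n%:R * ((b - a) / 2) ^+ 2 < 1.
  rewrite wab ltr_pdivlMr // in wlt.
  have : ((b - a) * Num.sqrt n%:R) ^+ 2 < 2 ^+ 2.
    by rewrite ltr_sqr ?nnegrE ?mulr_ge0 ?subr_ge0 // ltW.
  rewrite exprMn sqr_sqrtr ?ler0n //; lra.
have [B [d [detB hB]]] := slab_ball_improvement n0 v1 a1 ab b1 small.
have := Amax (A *m B) (c *m B + d); rewrite det_mulmx => h.
have : \det A * \det B <= \det A.
  apply: h => x Kx; rewrite mulmxA addrA -mulmxDl; apply: hB; first exact: Ac.
  have inL : linear_image A K (x *m A) by exists x.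
  have := width_ge v cL inL (ex_intro2 _ _ q' Kq qE).
  have := width_ge v cL (ex_intro2 _ _ p' Kp pE) inL.
  by rewrite wab /a /b (dotC _ v) !dotE => h1 h2; apply/andP; split; lra.
by rewrite -ler_pdivlMl // mulVf ?gt_eqF // leNgt detB.
Qed.

Lemma enorm_mulmx_le x A : enorm (x *m A) <= n%:R * n%:R * `|A| * enorm x.
Proof.
apply: le_trans (enorm_le_norm _) _; rewrite -!mulrA ler_wpM2l //.
rewrite [leLHS]/Num.norm /= mx_normrE; apply/bigmax_leP; split.
  by rewrite !mulr_ge0 ?enorm_ge0.
move=> [i j] _ /=; rewrite ord1 mxE; apply: le_trans (ler_norm_sum _ _ _) _.
rewrite -[n in n%:R]card_ord -sumr_const mulr_suml; apply: ler_sum => k _.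
rewrite normrM mul1r mulrC ler_pM // ?coord_le_enorm //.
rewrite [leRHS]/Num.norm /= mx_normrE.
by apply/bigmax_geP; right; exists (k, j).
Qed.

Lemma max_ratio_exists K : (0 < n)%N -> convex_body K ->
  exists m, is_max (width_radius_ratios K) m /\ 1 / Num.sqrt n%:R <= m.
Proof.
move=> n0 bK; have K0 := body_nonempty bK; have [cK vK _] := bK.
have [r r0 Kr] := compact_enorm_bounded cK.
pose S A := [set width K (u *m A^T) | u in [set u | enorm u = 1]].
pose W A := inf (S A).
have Wle A u : enorm u = 1 -> W A <= width K (u *m A^T).
  move=> u1; apply: ge_inf; last by exists u.
  by exists 0 => _ [v _ <-]; exact: width_ge0.
have leW A a : (forall u, enorm u = 1 -> a <= width K (u *m A^T)) -> a <= W A.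
  move=> h; apply: lb_le_inf => [|_ [u /= u1 <-]]; last exact: h.
  exists (width K (delta_mx 0 (Ordinal n0) *m A^T)), (delta_mx 0 (Ordinal n0)) => //.
  exact: enorm_delta.
have widthD u v : width K (u + v) <= width K u + width K v.
  by rewrite /width opprD addrACA lerD ?suppD.
have cW : continuous W.
  apply: (lipschitz_continuous (C := 2 * r * (n%:R * n%:R))) => A B.
  rewrite lerBlDr addrC -lerBlDr; apply: (leW) => u u1.
  rewrite lerBlDr; apply: le_trans (Wle A u u1) _.
  have -> : u *m A^T = u *m B^T + u *m (A - B)^T.
    by rewrite linearB /= mulmxBr addrC subrK.
  apply: le_trans (widthD _ _) _; rewrite lerD2l.
  have Kr' : K `<=` eball 0 r by move=> x /Kr; rewrite /eball /= subr0.
  apply: le_trans (width_outer_ball _ K0 cK Kr') _.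
  rewrite -!mulrA !ler_wpM2l ?(ltW r0) //.
  have := enorm_mulmx_le u (A - B)^T; rewrite u1 mulr1 mulrA => h; apply: le_trans h _.
  rewrite -!mulrA !ler_wpM2l //.
  rewrite [leLHS]/Num.norm /= mx_normrE; apply/bigmax_leP; split=> // -[i j] _ /=.
  rewrite !mxE [leRHS]/Num.norm /= mx_normrE; apply/bigmax_geP; right.
  by exists (j, i) => //=; rewrite !mxE.
have WE A : A \in unitmx -> W A = min_width (linear_image A K).
  move=> uA; rewrite min_widthE; last exact: body_linear_image.
  congr inf; apply: eq_imagel => u _; by rewrite width_linear_image.
have [A [c [Ac Amax]]] := max_over_ball_positions bK cW.
have [B [d [uB Bd hB]]] := loewner_position n0 bK.
have sn : 0 < Num.sqrt n%:R :> R by rewrite sqrtr_gt0 ltr0n.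
have WA : 2 / Num.sqrt n%:R <= W A.
  by apply: le_trans hB _; rewrite -WE //; exact: Amax Bd.
have W0 : 0 < W A by apply: lt_le_trans WA; rewrite divr_gt0.
have uA : A \in unitmx.
  apply/negPn/negP; rewrite -unitmx_tr unitmxE unitfE negbK => /eqP/eqP/det0P[u u0 uA0].
  have := Wle A _ (enorm_normalize u0).
  by rewrite -scalemxAl uA0 scaler0 width0 // leNgt W0.
have bA := body_linear_image uA bK.
have RA0 := circumradius_gt0 n0 bA.
have RA : circumradius (linear_image A K) <= 1.
  apply: (@circumradius_le _ _ _ (- c)); first exact: ler01.
  by move=> _ [x Kx <-]; rewrite /eball /= opprK; exact: Ac.
have mE : W A / 2 <= min_width (linear_image A K) / (2 * circumradius (linear_image A K)).
  rewrite WE // ler_pdivlMr ?mulr_gt0 //.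
  rewrite -mulrA mulKf ?pnatr_eq0 // ler_piMr // -WE // ltW //.
exists (min_width (linear_image A K) / (2 * circumradius (linear_image A K))); split.
  split; first by exists A.
  move=> _ [D /= uD <-]; apply: le_trans mE; have bD := body_linear_image uD bK.
  apply: ratio_le => //; first by rewrite divr_gt0.
  move=> t e t0 Dt; rewrite mulrA divfK ?pnatr_eq0 //.
  have tp : 0 < t.
    have := min_width_outer_ball n0 bD Dt; have := min_width_gt0 n0 bD; lra.
  have uD' : t^-1 *: D \in unitmx by rewrite unitmxZ // unitfE invr_neq0 // gt_eqF.
  have := Amax (t^-1 *: D) (- (t^-1 *: e)).
  rewrite -ler_pdivrMr // => h; apply: le_trans (h _); last first.
    move=> x Kx; have := Dt (x *m D); rewrite /eball /= => hx.
    rewrite -scalemxAr -scalerBr enormZ ger0_norm ?invr_ge0 //.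
    by rewrite ler_pdivrMl // mulr1; apply: hx; exists x.
  apply: (leW) => u u1; rewrite linearZ /= -scalemxAr widthZ //.
  rewrite ger0_norm ?invr_ge0 // mulrC ler_wpM2l ?invr_ge0 //.
  by have := min_width_le u bD; rewrite u1 mulr1 width_linear_image.
by apply: le_trans mE; rewrite ler_pdivlMr // mulrAC mul1r.
Qed.

End Maximum.

(** * A discrete inequality for an odd number of coordinates *)

Section Parity.
Context {R : realType}.

Lemma sum_part_le_half N (z : 'I_N -> R) (J : {set 'I_N}) : \sum_i z i = 0 ->
  2 * \sum_(i in J) z i <= \sum_i `|z i|.
Proof.
move=> z0; have := z0; rewrite (bigID (mem J)) [X in _ <= X](bigID (mem J)) /=.
have h1 : \sum_(i in J) z i <= \sum_(i in J) `|z i|.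
  by apply: ler_sum => i _; exact: ler_norm.
have h2 : - \sum_(i | i \notin J) z i <= \sum_(i | i \notin J) `|z i|.
  by rewrite -sumrN; apply: ler_sum => i _; rewrite -normrN ler_norm.
lra.
Qed.

(** The first term on the right is the largest possible sum of squares of an odd
number of reals with mean zero in an interval of length [l = m + M], attained when
[k] or [k + 1] of them lie at the upper end.  The second term measures the price
for [a] and [b] being different.  Expanding the sum of [(a i + m) (M - b i)]
reduces the claim to a lower bound for this sum in terms of the difference [t]
between [(2 k + 1) m / l] and the integer [k]. *)
Lemma sum_mul_le_odd k N (a b : 'I_N -> R) (m M : R) :
  N = (2 * k + 1)%N -> (0 < k)%N ->
  0 < m + M -> (forall i, - m <= a i) -> (forall i, b i <= M) ->
  \sum_i a i = 0 -> \sum_i b i = 0 ->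
  \sum_i a i * b i <= (m + M) ^+ 2 * (k%:R * (k%:R + 1)) / (2 * k%:R + 1)
    + (m + M) / (2 * (2 * k%:R - 1)) * \sum_i `|a i - b i|.
Proof.
move=> hN k0; set l := m + M => l0 am bM a0 b0.
have kR : 1 <= k%:R :> R by rewrite ler1n.
pose NR : R := 2 * k%:R + 1; have NE : N%:R = NR.
  by rewrite hN natrD natrM.
have N0 : 0 < NR by rewrite /NR; lra.
have N1 : 0 < 2 * k%:R - 1 :> R by lra.
pose x i := a i + m; pose y i := M - b i; pose z i := a i - b i.
have x0 i : 0 <= x i by rewrite /x; have := am i; lra.
have y0 i : 0 <= y i by rewrite /y; have := bM i; lra.
have xyz i : x i = l + z i - y i by rewrite /x /y /z /l; ring.
have z0 : \sum_i z i = 0 by rewrite sumrB a0 b0 subrr.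
have sx : \sum_i x i = NR * m.
  by rewrite big_split /= a0 add0r sumr_const card_ord -mulr_natl NE.
have sy : \sum_i y i = NR * M.
  by rewrite sumrB b0 subr0 sumr_const card_ord -mulr_natl NE.
set Z := \sum_i `|a i - b i|; have Z0 : 0 <= Z by apply: sumr_ge0 => i _; exact: normr_ge0.
set G := \sum_i x i * y i.
have xy0 i : 0 <= x i * y i by rewrite mulr_ge0.
have GE : \sum_i a i * b i = NR * m * M - G.
  have -> : G = \sum_i (a i * M - a i * b i + m * M - m * b i).
    by apply: eq_bigr => i _; rewrite /x /y; ring.
  rewrite sumrB big_split sumrB /= -[\sum_i a i * M]mulr_suml a0.
  rewrite -[\sum_i m * b i]mulr_sumr b0 sumr_const card_ord -mulr_natl NE; ring.
(* (NR m) (NR M) = l^2 (k (k + 1) + t (1 - t)) *)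
pose t := NR * m / l - k%:R.
have mE : NR * m = l * (k%:R + t) by rewrite /t; field; rewrite gt_eqF.
have ME : NR * M = l * (k%:R + 1 - t).
  have -> : NR * M = NR * l - NR * m by rewrite /l; ring.
  by rewrite mE /NR; ring.
have mME : NR * m * M = l ^+ 2 * (k%:R * (k%:R + 1)) / NR + l ^+ 2 * (t * (1 - t)) / NR.
  have -> : NR * m * M = (NR * m) * (NR * M) / NR by field; rewrite gt_eqF.
  by rewrite mE ME; field; rewrite gt_eqF.
suff key : l ^+ 2 * (t * (1 - t)) / NR <= G + l / (2 * (2 * k%:R - 1)) * Z.
  rewrite GE mME -/NR; lra.
have G0 : 0 <= G by apply: sumr_ge0 => i _; exact: xy0.
have c0 : 0 <= l / (2 * (2 * k%:R - 1)) by rewrite divr_ge0 ?ltW ?mulr_gt0.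
have r0 : 0 <= G + l / (2 * (2 * k%:R - 1)) * Z.
  by apply: addr_ge0 => //; exact: mulr_ge0.
have [t0|t0] := leP t 0.
  apply: le_trans r0.
  rewrite pmulr_lle0 ?invr_gt0 // pmulr_rle0 ?exprn_gt0 // mulr_le0_ge0 //; lra.
have [t1|t1] := leP 1 t.
  apply: le_trans r0.
  rewrite pmulr_lle0 ?invr_gt0 // pmulr_rle0 ?exprn_gt0 // mulr_ge0_le0 //; lra.
suff : l * (t * (1 - t)) <= NR / l * G + (1 / 2 + (2 * k%:R - 1)^-1) * Z.
  rewrite -(ler_pM2l (divr_gt0 l0 N0)) => h.
  have -> : l ^+ 2 * (t * (1 - t)) / NR = l / NR * (l * (t * (1 - t))).
    by field; rewrite gt_eqF.
  apply: le_trans h _; rewrite le_eqVlt; apply/orP; left; apply/eqP.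
  by rewrite /NR; field; rewrite !gt_eqF.
have Gpart (J : {set 'I_N}) : \sum_(i in J) x i * y i <= G.
  rewrite /G [leRHS](bigID (mem J)) /= lerDl; apply: sumr_ge0 => i _.
  exact: xy0.
(* on J the product x i * y i controls y i, unless z i is far from 0;
   off J it controls x i *)
pose J : {set 'I_N} := [set i | NR * y i < l]%SET.
have Zk : 0 <= (2 * k%:R - 1)^-1 * Z by rewrite mulr_ge0 // invr_ge0 ltW.
have lt1 : l * (t * (1 - t)) <= l * t /\ l * (t * (1 - t)) <= l * (1 - t).
  have : 0 <= l * t ^+ 2 by rewrite mulr_ge0 ?sqr_ge0 // ltW.
  have : 0 <= l * (1 - t) ^+ 2 by rewrite mulr_ge0 ?sqr_ge0 // ltW.
  by split; lra.
have lN i : NR / l * (x i * y i) = NR * x i * y i / l by field; rewrite gt_eqF.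
have cardJ : (#|J| + #|~: J| = N)%N by rewrite cardsC card_ord.
have [Jk|kJ] := leqP #|J| k.
  apply: le_trans lt1.1 _.
  have h1 : \sum_(i in J) x i <= l * k%:R + \sum_(i in J) z i.
    apply: (@le_trans _ _ (\sum_(i in J) (l + z i))).
      by apply: ler_sum => i _; rewrite xyz gerBl.
    rewrite big_split /= sumr_const lerD2r -[l *+ _]mulr_natr ler_wpM2l ?(ltW l0) //.
    by rewrite ler_nat.
  have h2 : \sum_(i in ~: J) x i <= NR / l * G.
    apply: (@le_trans _ _ (NR / l * \sum_(i in ~: J) x i * y i)).
      rewrite mulr_sumr; apply: ler_sum => i; rewrite !finset.inE -leNgt => yi.
      by have := ler_wpM2l (x0 i) yi; rewrite lN ler_pdivlMr //; lra.
    by apply: ler_wpM2l; [rewrite divr_ge0 // ltW|exact: Gpart].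
  have := sum_part_le_half J z0; rewrite -/Z => h3.
  have : \sum_i x i = \sum_(i in J) x i + \sum_(i in ~: J) x i.
    rewrite (bigID (mem J)) /=; congr (_ + _).
    by apply: eq_bigl => i; rewrite finset.in_setC.
  rewrite sx mE; lra.
apply: le_trans lt1.2 _.
have h1 : \sum_(i in ~: J) y i <= l * k%:R + \sum_(i in ~: J) z i.
  apply: (@le_trans _ _ (\sum_(i in ~: J) (l + z i))).
    by apply: ler_sum => i _; have := x0 i; rewrite xyz; lra.
  rewrite big_split /= sumr_const lerD2r -[l *+ _]mulr_natr ler_wpM2l ?(ltW l0) //.
  by rewrite ler_nat; move: hN cardJ kJ; move: #|J| #|~: J| => p q; clear; lia.
have h2 : \sum_(i in J) y i <= NR / l * G + (2 * k%:R - 1)^-1 * Z.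
  apply: (@le_trans _ _ (\sum_(i in J) (NR / l * (x i * y i) + (2 * k%:R - 1)^-1 * `|z i|))).
    apply: ler_sum => i; rewrite finset.inE => yi.
    have [xi|xi] := leP l (NR * x i).
      apply: (@le_trans _ _ (NR / l * (x i * y i))).
        by have := ler_wpM2r (y0 i) xi; rewrite lN ler_pdivlMr //; lra.
      by rewrite lerDl mulr_ge0 // invr_ge0 ltW.
    apply: (@le_trans _ _ ((2 * k%:R - 1)^-1 * `|z i|)).
      rewrite ler_pdivlMl //.
      (* both x i and y i are below l / NR, so x i + y i is far from l *)
      have : - z i <= `|z i| by rewrite -normrN ler_norm.
      apply: le_trans; have := xyz i => E.
      have -> : - z i = l - x i - y i by lra.
      rewrite -(ler_pM2l N0); move: xi yi; rewrite /NR; nra.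
    rewrite lerDr mulr_ge0 // divr_ge0 // ltW //.
  rewrite big_split /= -!mulr_sumr lerD // ler_wpM2l ?invr_ge0 ?(ltW N1) //.
    by rewrite divr_ge0 // ltW.
  rewrite /Z [leRHS](bigID (mem J)) /= lerDl; apply: sumr_ge0 => i _.
  exact: normr_ge0.
have := sum_part_le_half (~: J) z0; rewrite -/Z => h3.
have : \sum_i y i = \sum_(i in J) y i + \sum_(i in ~: J) y i.
  rewrite (bigID (mem J)) /=; congr (_ + _).
  by apply: eq_bigl => i; rewrite finset.in_setC.
rewrite sy ME; lra.
Qed.

End Parity.

(** * The regular simplex and its support function *)

(** The outer unit normals of a regular simplex.  The last condition says that
they form a tight frame. *)
Definition regular_simplex {R : realType} {n : nat} (u : 'I_n.+1 -> 'rV[R]_n) :=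
  [/\ \sum_i u i = 0,
      forall i, dot (u i) (u i) = 1,
      forall i j, i != j -> dot (u i) (u j) = - n%:R^-1 &
      forall x y, \sum_i dot x (u i) * dot y (u i) = (n%:R + 1) / n%:R * dot x y].

Section Simplex.
Context {R : realType} {n : nat}.
Implicit Types (x y z v c : 'rV[R]_n) (a b r t : R).

(** The last normal is [- 1 / sqrt n] times the all-ones vector, the others are
[al e_i + be 1], with [al] and [be] determined by the required inner products. *)
Lemma regular_simplex_exists : (0 < n)%N ->
  exists u : 'I_n.+1 -> 'rV[R]_n, regular_simplex u.
Proof.
move=> n0; have nR : 0 < n%:R :> R by rewrite ltr0n.
pose q : R := Num.sqrt n%:R; have qq : q ^+ 2 = n%:R by rewrite sqr_sqrtr // ltW.
have q0 : 0 < q by rewrite sqrtr_gt0.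
pose al : R := Num.sqrt (n%:R + 1) / q.
have alal : al ^+ 2 = (n%:R + 1) / n%:R.
  by rewrite expr_div_n qq sqr_sqrtr // addr_ge0 // ltW.
pose be : R := (q^-1 - al) / n%:R.
have nbe : n%:R * be = q^-1 - al by rewrite mulrC divfK // gt_eqF.
have qi2 : q^-1 ^+ 2 = n%:R^-1 by rewrite exprVn qq.
have ab : 2 * al * be + n%:R * be ^+ 2 = - n%:R^-1.
  have : n%:R * (2 * al * be + n%:R * be ^+ 2) = n%:R * - n%:R^-1.
    have -> : n%:R * (2 * al * be + n%:R * be ^+ 2) =
      2 * al * (n%:R * be) + (n%:R * be) ^+ 2 by ring.
    rewrite nbe.
    have -> : 2 * al * (q^-1 - al) + (q^-1 - al) ^+ 2 = q^-1 ^+ 2 - al ^+ 2 by ring.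
    by rewrite qi2 alal; field; rewrite gt_eqF.
  by move/(mulfI (lt0r_neq0 nR)).
pose one : 'rV[R]_n := const_mx 1.
have d1 x : dot x one = \sum_i x 0 i.
  by apply: eq_bigr => i _; rewrite mxE mulr1.
have d11 : dot one one = n%:R.
  by rewrite d1; under eq_bigr do rewrite mxE; rewrite sumr_const card_ord.
have de i : dot one (delta_mx 0 i) = 1 by rewrite dot_delta mxE.
pose w (i : 'I_n) : 'rV[R]_n := al *: delta_mx 0 i + be *: one.
pose u (i : 'I_n.+1) : 'rV[R]_n := oapp w (- q^-1 *: one) (unlift ord_max i).
have ul i : u (lift ord_max i) = w i by rewrite /u liftK.
have um : u ord_max = - q^-1 *: one by rewrite /u unlift_none.
have sumE (V : nmodType) (F : 'I_n.+1 -> V) :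
    \sum_i F i = F ord_max + \sum_i F (lift ord_max i) by rewrite (bigD1_ord ord_max).
have dxw x i : dot x (w i) = al * x 0 i + be * dot x one.
  by rewrite /w !dotE dot_delta.
have dww i j : dot (w i) (w j) = al ^+ 2 * (i == j)%:R + (2 * al * be + n%:R * be ^+ 2).
  rewrite dxw /w !dotE d11 !mxE eqxx /= [dot (delta_mx 0 i) one]dotC de.
  by rewrite [j == i]eq_sym; ring.
have dwm i : dot (w i) (- q^-1 *: one) = - n%:R^-1.
  have -> : dot (w i) (- q^-1 *: one) = - q^-1 * (al + n%:R * be).
    by rewrite dotZr /w !dotE [dot (delta_mx 0 i) one]dotC de d11; ring.
  by rewrite nbe -qi2; ring.
exists u; split.
- rewrite sumE um; under eq_bigr do rewrite ul.
  rewrite big_split /= sumr_const card_ord -scaler_sumr.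
  have -> : \sum_i delta_mx 0 i = one :> 'rV[R]_n.
    rewrite [RHS]row_sum_delta; apply: eq_bigr => i _; by rewrite mxE scale1r.
  rewrite -scaler_nat scalerA nbe -!scalerDl (_ : _ + _ = 0) ?scale0r //; ring.
- move=> i; case: (unliftP ord_max i) => [j ->|->].
    rewrite ul dww eqxx mulr1 ab alal; field; by rewrite gt_eqF.
  by rewrite um dotZl dotZr d11 mulrA mulrNN -expr2 qi2 mulVf // gt_eqF.
- move=> i j; case: (unliftP ord_max i) => [i' ->|->]; case: (unliftP ord_max j) => [j' ->|->].
  + rewrite (inj_eq (@lift_inj _ _)) => /negPf ne.
    by rewrite !ul dww ne mulr0 add0r ab.
  + by move=> _; rewrite ul um dwm.
  + by move=> _; rewrite ul um dotC dwm.
  + by rewrite eqxx.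
move=> x y; rewrite sumE um; under eq_bigr do rewrite ul.
set X := dot x one; set Y := dot y one.
have -> : \sum_i dot x (w i) * dot y (w i) =
    al ^+ 2 * dot x y + (2 * al * be + n%:R * be ^+ 2) * (X * Y).
  rewrite (eq_bigr (fun i => al ^+ 2 * (x 0 i * y 0 i) + al * be * Y * x 0 i
     + al * be * X * y 0 i + be ^+ 2 * (X * Y))); last first.
    by move=> i _; rewrite !dxw -/X -/Y; ring.
  rewrite !big_split /= -!mulr_sumr -!d1 -/X -/Y sumr_const card_ord -/(dot x y).
  rewrite -[Y *+ _]mulr_natl; ring.
by rewrite !dotZr -/X -/Y ab alal -qi2; ring.
Qed.

End Simplex.

Section SimplexGauge.
Context {R : realType} {n : nat} (u : 'I_n.+1 -> 'rV[R]_n).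
Context (n0 : (0 < n)%N) (ru : regular_simplex u).
Implicit Types (x y z v c a b : 'rV[R]_n) (r t s m M : R).

Let nR : 0 < n%:R :> R. Proof. by rewrite ltr0n. Qed.

(** The support function of the simplex [T] with outer unit normals [u i] and
inradius one: the vertices of [T] are the vectors [- n u i]. *)
Definition simplex_supp a : R :=
  n%:R * - dot a (u [arg min_(i < ord0) dot a (u i)]%O).

Lemma simplex_supp_ge a i : - (n%:R * dot a (u i)) <= simplex_supp a.
Proof.
rewrite /simplex_supp; case: arg_minP => // j _ h.
by rewrite -mulrN ler_wpM2l ?(ltW nR) // lerN2 h.
Qed.

Lemma simplex_supp_attained a : exists i, simplex_supp a = - (n%:R * dot a (u i)).
Proof. by eexists; rewrite -mulrN. Qed.

Lemma simplex_suppD a b : simplex_supp (a + b) <= simplex_supp a + simplex_supp b.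
Proof.
have [i ->] := simplex_supp_attained (a + b).
by rewrite dotDl mulrDr opprD lerD ?simplex_supp_ge.
Qed.

Lemma simplex_suppZ t a : 0 <= t -> simplex_supp (t *: a) = t * simplex_supp a.
Proof.
move=> t0; apply/eqP; rewrite eq_le; apply/andP; split.
  have [i ->] := simplex_supp_attained (t *: a).
  by rewrite dotZl mulrCA -mulrN ler_wpM2l // simplex_supp_ge.
have [i ->] := simplex_supp_attained a.
by rewrite mulrN mulrCA -dotZl simplex_supp_ge.
Qed.

Lemma coord_ge_supp a i : - (simplex_supp a / n%:R) <= dot a (u i).
Proof.
rewrite lerNl ler_pdivlMr // mulrC mulrN; exact: simplex_supp_ge.
Qed.

Lemma coord_le_suppN a i : dot a (u i) <= simplex_supp (- a) / n%:R.
Proof. by have := coord_ge_supp (- a) i; rewrite dotNl lerN2. Qed.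

Lemma sum_coord a : \sum_i dot a (u i) = 0.
Proof. by rewrite -dot_sumr; case: ru => -> _ _ _; rewrite dot0r. Qed.

Lemma dot_frame x y : dot x y = n%:R / (n%:R + 1) * \sum_i dot x (u i) * dot y (u i).
Proof.
have nz : n%:R != 0 :> R by rewrite gt_eqF.
have nz1 : n%:R + 1 != 0 :> R by rewrite gt_eqF // addr_gt0.
by case: ru => _ _ _ ->; rewrite mulrA mulrA mulfVK // mulfV // mul1r. 
Qed.

(** The sum of [(<a, u_i> + m) (M - <b, u_i>)] is nonnegative; both linear terms
vanish because the normals have sum zero. *)
Lemma dot_le_bounds a b m M : (forall i, - m <= dot a (u i)) ->
  (forall i, dot b (u i) <= M) -> dot a b <= n%:R * (m * M).
Proof.
move=> am bM.
have : 0 <= \sum_i (dot a (u i) + m) * (M - dot b (u i)).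
  by apply: sumr_ge0 => i _; rewrite mulr_ge0 //; have := am i; have := bM i; lra.
have -> : \sum_i (dot a (u i) + m) * (M - dot b (u i)) =
    (n%:R + 1) * (m * M) - \sum_i dot a (u i) * dot b (u i).
  rewrite (eq_bigr (fun i => M * dot a (u i) + - m * dot b (u i) + m * M
     - dot a (u i) * dot b (u i))); last by move=> i _; ring.
  rewrite sumrB !big_split /= -!mulr_sumr !sum_coord sumr_const card_ord.
  by rewrite -(mulr_natl M) -natr1; ring.
rewrite subr_ge0 dot_frame => h; rewrite mulrAC ler_pdivrMr ?addr_gt0 //.
by rewrite -mulrA ler_wpM2l ?(ltW nR) // mulrC.
Qed.

(** [T] contains the unit ball. *)
Lemma enorm_le_simplex_supp a : enorm a <= simplex_supp a.
Proof.
set m := simplex_supp a / n%:R.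
have mE : simplex_supp a = n%:R * m by rewrite mulrC divfK // gt_eqF.
have am i : - m <= dot a (u i) by exact: coord_ge_supp.
have aM i : dot a (u i) <= n%:R * m.
  have := sum_coord a; rewrite (bigD1 i) //= => /eqP.
  rewrite addr_eq0 => /eqP ->; rewrite -sumrN.
  apply: (@le_trans _ _ (\sum_(j < n.+1 | j != i) m)).
    by apply: ler_sum => j _; rewrite lerNl.
  by rewrite sumr_const cardC1 card_ord /= mulr_natl.
have m0 : 0 <= m.
  have : 0 <= (n%:R + 1) * m; last by rewrite pmulr_rge0 // addr_gt0.
  have : \sum_(i < n.+1) (- m) <= \sum_i dot a (u i).
    by apply: ler_sum => i _; exact: am.
  rewrite sum_coord sumr_const card_ord -[_ *+ _]mulr_natl -natr1; lra.
rewrite mE; apply: enorm_le; first by rewrite mulr_ge0 // ltW.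
by apply: le_trans (dot_le_bounds am aM) _; rewrite exprMn; lra.
Qed.

(** [T] lies in the ball of radius [n]. *)
Lemma simplex_supp_le_enorm a : simplex_supp a <= n%:R * enorm a.
Proof.
have [i ->] := simplex_supp_attained a.
rewrite -mulrN ler_wpM2l ?(ltW nR) //; have := ge_dot a (u i).
rewrite {2}/enorm; case: ru => _ -> _ _; rewrite sqrtr1; lra.
Qed.

Lemma simplex_supp0 : simplex_supp 0 = 0.
Proof. by rewrite -(scale0r 0) simplex_suppZ // mul0r. Qed.

Lemma simplex_supp_vertex i : simplex_supp (u i) <= 1.
Proof.
have [j ->] := simplex_supp_attained (u i); case: ru => _ h1 h2 _.
have [->|ij] := eqVneq i j; first by rewrite h1; have := ltW nR; lra.
by rewrite h2 // mulrN opprK mulfV // gt_eqF.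
Qed.

End SimplexGauge.

(** * Arithmetic behind the width of truncated simplices *)

Section TruncationArithmetic.
Context {R : realType}.

Lemma simplex_width_bounds n : (0 < n)%N ->
  2 <= simplex_width n :> R /\ simplex_width n <= n%:R + 1 :> R.
Proof.
move=> n0; have W0 := ltW (@simplex_width_gt0 R n n0).
have nR : 1 <= n%:R :> R by rewrite ler1n.
have [on|en] := boolP (odd n).
  have W2 := sqr_simplex_width_odd (R := R) on.
  by split; rewrite -ler_sqr ?nnegrE ?W2 //; nra.
have W2 := sqr_simplex_width_even (R := R) en.
have n2 : 2 <= n%:R :> R by rewrite ler_nat; move: n n0 en {W0 nR W2} => [|[|]].
have p2 : 0 < n%:R + 2 :> R by lra.
have lower (x : R) : 2 <= x -> 2 ^+ 2 * (x + 2) <= 4 * (x + 1) ^+ 2.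
  by move=> x2; have : 0 <= (x - 2) * x; [rewrite mulr_ge0|]; lra.
have upper (x : R) : 2 <= x -> 4 * (x + 1) ^+ 2 <= (x + 1) ^+ 2 * (x + 2).
  move=> x2; have : 0 <= (x + 1) ^+ 2 * (x - 2); last by lra.
  by rewrite mulr_ge0 ?sqr_ge0 ?subr_ge0.
split; rewrite -ler_sqr ?nnegrE //.
- by rewrite -(ler_pM2r p2) W2; exact: lower.
- by rewrite -(ler_pM2r p2) W2; exact: upper.
Qed.

(** If [p = v - a] and [q = v - b] then [dot a b = 1 - dot v (p + q) + dot p q]; the
point is that [|p + q| <= |p| + |q| + dot p q], even when [dot p q] is negative, as
long as [|p| + |q| <= 2]. *)
Lemma dist_sum_ge n (a b v : 'rV[R]_n) : enorm v = 1 ->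
  enorm (v - a) + enorm (v - b) <= 2 ->
  1 - dot a b <= enorm (v - a) + enorm (v - b).
Proof.
move=> v1; have [p pE] : exists p, p = v - a by exists (v - a).
have [q qE] : exists q, q = v - b by exists (v - b).
rewrite -pE -qE => D2.
have aE : a = v - p by rewrite pE opprB addrC subrK.
have bE : b = v - q by rewrite qE opprB addrC subrK.
have vv : dot v v = 1 by rewrite -sqr_enorm v1 expr1n.
have -> : dot a b = 1 - dot v (p + q) + dot p q.
  by rewrite aE bE !dotE vv (dotC p v); ring.
have P0 := enorm_ge0 p; have Q0 := enorm_ge0 q.
have g1 := dot_le p q; have g2 := ge_dot p q.
suff : enorm (p + q) <= enorm p + enorm q + dot p q.
  have := dot_le v (p + q); rewrite v1; lra.
set P := enorm p in P0 D2 g1 g2 *; set Q := enorm q in Q0 D2 g1 g2 *.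
set g := dot p q in g1 g2 *.
apply: enorm_le; first by nra.
have -> : dot (p + q) (p + q) = P ^+ 2 + Q ^+ 2 + 2 * g.
  by rewrite !dotE (dotC q p) -!sqr_enorm -/P -/Q -/g; ring.
have h1 : 0 <= (P + Q) * (P * Q + g) by rewrite mulr_ge0 //; lra.
have h2 : 0 <= (2 - (P + Q)) * (P * Q - g) by rewrite mulr_ge0 //; lra.
have := sqr_ge0 g; lra.
Qed.

(** In this and the following three lemmas [mu] and [eta] stand for [h_T a] and
[h_T (- b)], [lam] for their sum, [T] for the bound [mu * eta / n] of [dot a b], and [D1],
[D2], [D] for the distances of [v] to [a] and [b] and for their sum. *)
Lemma truncation_arith_small (s mu eta T D1 D2 : R) : 1 <= s -> 0 <= mu -> mu <= 1 ->
  0 <= eta -> 0 <= D2 -> s * T <= mu * eta -> 1 - mu <= D1 -> 1 - eta <= D2 ->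
  1 - T - mu * D2 <= D1 -> s + 1 <= mu + eta + s * (D1 + D2).
Proof.
move=> s1 mu0 mu1 eta0 D20 sT h1 h2 h3.
have h4 : s * (1 - T - mu * D2 + D2) <= s * (D1 + D2) by rewrite ler_wpM2l; lra.
have [e1|e1] := leP 1 eta.
  have : 0 <= s * ((1 - mu) * D2) by rewrite !mulr_ge0; lra.
  have : 0 <= (1 - mu) * (eta - 1) by rewrite mulr_ge0; lra.
  lra.
have [l1|l1] := leP (mu + eta) 1.
  have : s * ((1 - mu) + (1 - eta)) <= s * (D1 + D2) by rewrite ler_wpM2l; lra.
  have : 0 <= (s - 1) * (1 - (mu + eta)) by rewrite mulr_ge0; lra.
  lra.
have : s * ((1 - mu) * (1 - eta)) <= s * ((1 - mu) * D2).
  by rewrite ler_wpM2l ?ler_wpM2l; lra.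
have : 0 <= (s - 1) * ((1 - mu) * (1 - eta)) by rewrite !mulr_ge0; lra.
lra.
Qed.

(** The claim reduces to [(W - lam) ((W - 1) lam - W) >= 0], which for
[W ^+ 2 = 4 nn] is [4 nn] times the inequality to be shown. *)
Lemma truncation_arith_large (W nn lam T D : R) : 2 <= lam -> lam <= W -> W ^+ 2 <= 4 * nn ->
  0 < nn -> 4 * nn * T <= lam ^+ 2 -> 1 - T <= D -> W <= lam + (W - 1) * D.
Proof.
move=> l2 lW W2 n0 hT hD.
have s0 : 0 <= W - 1 by lra.
have h1 : (W - 1) * (1 - T) <= (W - 1) * D by rewrite ler_wpM2l.
suff : (W - 1) * T <= lam - 1 by lra.
have h2 : (W - 1) * (4 * nn * T) <= (W - 1) * lam ^+ 2 by rewrite ler_wpM2l.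
have h3 : W ^+ 2 * (lam - 1) <= 4 * nn * (lam - 1) by rewrite ler_wpM2r //; lra.
have h4 : 0 <= (W - lam) * ((W - 1) * lam - W).
  rewrite mulr_ge0 //; first lra.
  have : (W - 1) * 2 <= (W - 1) * lam by rewrite ler_wpM2l.
  lra.
have n4 : 0 < 4 * nn by rewrite mulr_gt0.
by rewrite -(ler_pM2l n4); lra.
Qed.

(** For even dimensions [W ^+ 2] is slightly larger than [4 nn].  The estimate
[T <= lam ^+ 2 / (4 nn)] is then too weak near [lam = W], but on [2, 3] there is
room, by the chord inequality [lam ^+ 2 <= 5 lam - 6]. *)
Lemma truncation_arith_even_mid (W nn lam T D : R) : 2 <= lam -> lam <= 3 -> 4 <= nn ->
  1 <= W -> W ^+ 2 * (nn + 2) = 4 * (nn + 1) ^+ 2 ->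
  4 * nn * T <= lam ^+ 2 -> 1 - T <= D -> W <= lam + (W - 1) * D.
Proof.
move=> l2 l3 n4 W1 W2 hT hD.
have s0 : 0 <= W - 1 by lra.
have h1 : (W - 1) * (1 - T) <= (W - 1) * D by rewrite ler_wpM2l.
suff : (W - 1) * T <= lam - 1 by lra.
have h2 : (W - 1) * (4 * nn * T) <= (W - 1) * lam ^+ 2 by rewrite ler_wpM2l.
have Wn : 9 * (W - 1) <= 8 * nn.
  have : 9 * W <= 8 * nn + 9; last by lra.
  rewrite -ler_sqr ?nnegrE; [|lra|lra].
  have n2 : 0 < nn + 2 by lra.
  rewrite -(ler_pM2r n2) exprMn -mulrA W2; nra.
have h3 : 0 <= (W - 1) * ((lam - 2) * (3 - lam)).
  by rewrite !mulr_ge0 //; lra.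
have h4 : 0 <= (3 - lam) * (nn - (W - 1)) by rewrite mulr_ge0; lra.
have h5 : 0 <= (lam - 2) * (8 * nn - 9 * (W - 1)) by rewrite mulr_ge0; lra.
have p4 : 0 < 4 * nn by lra.
by rewrite -(ler_pM2l p4); lra.
Qed.

(** The sharper hypothesis makes the claim an inequality that is linear in [lam]
after division by [W - lam]; it is checked at [lam = 3] and [lam = W]. *)
Lemma truncation_arith_even_far (W nn lam D : R) : 3 <= lam -> lam <= W -> 4 <= nn ->
  W ^+ 2 * (nn + 2) = 4 * (nn + 1) ^+ 2 -> 0 <= D ->
  4 * (nn - 1) * (W ^+ 2 - lam ^+ 2) <= D * (W ^+ 2 * (4 * (nn - 1) + lam)) ->
  W <= lam + (W - 1) * D.
Proof.
move=> l3 lW n4 W2 D0 hD.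
have n2 : 0 < nn + 2 by lra.
have W0 : 0 <= W by lra.
have W4 : 4 <= W.
  rewrite -ler_sqr ?nnegrE //; rewrite -(ler_pM2r n2) W2; nra.
have Wu : W ^+ 2 <= 4 * nn + 2 / 3.
  rewrite -(ler_pM2r n2) W2; nra.
have n1 : 0 < nn - 1 by lra.
have Q3 : 0 <= 4 * (nn - 1) * (2 * W - 3) - 3 * W ^+ 2.
  have : 4 * (nn - 1) * 5 <= 4 * (nn - 1) * (2 * W - 3) by rewrite ler_pM2l; lra.
  lra.
have QW : 0 <= W * (4 * (nn - 1) * (W - 2) - W ^+ 2).
  rewrite mulr_ge0 //.
  have : 4 * (nn - 1) * 2 <= 4 * (nn - 1) * (W - 2) by rewrite ler_pM2l; lra.
  lra.
have Ql : 0 <= 4 * (nn - 1) * ((W - 1) * (W + lam)) - W ^+ 2 * (4 * (nn - 1) + lam).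
  have W3 : 0 < W - 3 by lra.
  rewrite -(pmulr_rge0 _ W3).
  have -> : (W - 3) * (4 * (nn - 1) * ((W - 1) * (W + lam)) - W ^+ 2 * (4 * (nn - 1) + lam))
    = (W - lam) * (4 * (nn - 1) * (2 * W - 3) - 3 * W ^+ 2)
      + (lam - 3) * (W * (4 * (nn - 1) * (W - 2) - W ^+ 2)) by ring.
  by rewrite addr_ge0 // mulr_ge0 //; lra.
set C := W ^+ 2 * (4 * (nn - 1) + lam) in hD Ql.
have C0 : 0 < C by rewrite /C mulr_gt0 ?exprn_gt0 //; lra.
have h1 : 0 <= (W - lam) * (4 * (nn - 1) * ((W - 1) * (W + lam)) - C).
  by rewrite mulr_ge0 //; lra.
have h2 : (W - 1) * (4 * (nn - 1) * (W ^+ 2 - lam ^+ 2)) <= (W - 1) * (D * C).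
  by rewrite ler_wpM2l //; lra.
rewrite -lerBlDl -(ler_pM2r C0); lra.
Qed.

End TruncationArithmetic.

(** * The width inequality for truncated simplices *)

Section TruncationGeometry.
Context {R : realType} {n : nat} (u : 'I_n.+1 -> 'rV[R]_n).
Context (n0 : (0 < n)%N) (ru : regular_simplex u).
Implicit Types (x y z v c a b : 'rV[R]_n) (r t s m M : R).

Let nR : 0 < n%:R :> R. Proof. by rewrite ltr0n. Qed.
Let W : R := simplex_width n.
Let h := simplex_supp u.

Lemma enorm_vertex i : enorm (u i) = 1.
Proof. by rewrite /enorm; case: ru => _ -> _ _; rewrite sqrtr1. Qed.

(** The support values [h a] and [h (- b)] bound the coordinates of [a] from below
and those of [b] from above. *)
Lemma dot_le_simplex_supp a b : dot a b <= h a * h (- b) / n%:R.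
Proof.
apply: le_trans (dot_le_bounds n0 ru (coord_ge_supp u n0 a) (coord_le_suppN u n0 b)) _.
by rewrite /h le_eqVlt; apply/orP; left; apply/eqP; field; rewrite gt_eqF.
Qed.

Lemma simplex_suppN_near a b : h (- a) <= h (- b) + n%:R * enorm (a - b).
Proof.
apply: (@le_trans _ _ (h (- b) + h (- (a - b)))).
  by rewrite -{1}(subrK b a) opprD addrC; exact: simplex_suppD.
rewrite lerD2l -(enormN (a - b)); exact: simplex_supp_le_enorm.
Qed.

(** The second bound improves on the first one when [b] is close to [v]: it comes
from [1 - |v - a| <= dot a v] and the bound of [dot a v] by support values. *)
Lemma dist_ge_simplex_supp a b v : enorm v = 1 ->
  1 - h a <= enorm (v - a) /\
  1 - h a * h (- b) / n%:R - h a * enorm (v - b) <= enorm (v - a).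
Proof.
move=> v1; have ha := enorm_le_simplex_supp n0 ru a; rewrite -/h in ha.
split.
  have := enormD a (v - a); rewrite addrC subrK v1; lra.
have h1 : 1 - enorm (v - a) <= dot a v.
  have := dot_le (v - a) v; rewrite dotBl -sqr_enorm v1 expr1n mulr1; lra.
have h2 := dot_le_simplex_supp a v.
have h3 : h a * h (- v) / n%:R <= h a * (h (- b) + n%:R * enorm (v - b)) / n%:R.
  rewrite ler_wpM2r ?invr_ge0 ?(ltW nR) // ler_wpM2l ?simplex_suppN_near //.
  exact: le_trans (enorm_ge0 a) ha.
have E : h a * (h (- b) + n%:R * enorm (v - b)) / n%:R =
   h a * h (- b) / n%:R + h a * enorm (v - b) by field; rewrite gt_eqF.
rewrite E in h3; lra.
Qed.

(** The sharp form of [dot_le_simplex_supp] in even dimensions, where the number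
[n + 1] of coordinates is odd; for [a = b] it says that the width of [T] is at
least [W]. *)
Lemma dot_le_even k a b : n = (2 * k)%N -> 0 < h a + h (- b) ->
  dot a b <= (h a + h (- b)) ^+ 2 / W ^+ 2
    + (h a + h (- b)) / (2 * (n%:R + 1) * (n%:R - 1))
       * \sum_i `|dot a (u i) - dot b (u i)|.
Proof.
move=> nk lam0; set lam := h a + h (- b).
have k0 : (0 < k)%N by move: n0; rewrite nk; case: (k).
have l0 : 0 < h a / n%:R + h (- b) / n%:R by rewrite -mulrDl divr_gt0.
have nk1 : n.+1 = (2 * k + 1)%N by rewrite nk addn1.
have := sum_mul_le_odd nk1 k0 l0 (coord_ge_supp u n0 a)
  (coord_le_suppN u n0 b) (sum_coord ru a) (sum_coord ru b).
rewrite -mulrDl -/lam.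
set Z := \sum_i `|_|; rewrite (dot_frame n0 ru a b); set X := \sum_i _ => hX.
have kR : n%:R = 2 * k%:R :> R by rewrite nk natrM.
have k1 : 1 <= k%:R :> R by rewrite ler1n.
have Wsq : W ^+ 2 = 4 * (n%:R + 1) ^+ 2 / (n%:R + 2).
  have en : ~~ odd n by rewrite nk mul2n odd_double.
  by rewrite -(sqr_simplex_width_even en) mulfK // gt_eqF // addr_gt0.
rewrite mulrC -ler_pdivlMr ?divr_gt0 ?addr_gt0 //.
apply: le_trans hX _; rewrite Wsq kR le_eqVlt; apply/orP; left; apply/eqP.
move: k1; move: (k%:R : R) (lam) (Z) => x l z x1; field.
by rewrite !gt_eqF //; lra.
Qed.

End TruncationGeometry.

Section TruncationInequality.
Context {R : realType} {n : nat} (u : 'I_n.+1 -> 'rV[R]_n).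
Context (n0 : (0 < n)%N) (ru : regular_simplex u).
Implicit Types (x y z v c a b : 'rV[R]_n) (r t s m M : R).

Let nR : 0 < n%:R :> R. Proof. by rewrite ltr0n. Qed.
Let W : R := simplex_width n.
Let h := simplex_supp u.

(** The Cauchy-Schwarz inequality and the tight frame identity give the factor
[(n + 1) / sqrt n], and [sqrt n >= 2]. *)
Lemma sum_coord_dist_le a b : (4 <= n)%N ->
  \sum_i `|dot a (u i) - dot b (u i)| <= (n%:R + 1) / 2 * enorm (a - b).
Proof.
move=> n4; have n4R : 4 <= n%:R :> R by rewrite ler_nat.
have n1 : 0 < n%:R + 1 :> R by rewrite addr_gt0.
rewrite -ler_sqr ?nnegrE; last first.
- by rewrite mulr_ge0 ?enorm_ge0 // divr_ge0 // ltW.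
- by apply: sumr_ge0 => i _; exact: normr_ge0.
apply: le_trans (sqr_sum_le _) _; rewrite exprMn sqr_enorm.
have -> : \sum_i `|dot a (u i) - dot b (u i)| ^+ 2 =
    (n%:R + 1) / n%:R * dot (a - b) (a - b).
  case: ru => _ _ _ <-; apply: eq_bigr => i _.
  by rewrite dotBl real_normK ?num_real // expr2.
rewrite mulrA ler_wpM2r ?dotxx_ge0 // -natr1 mulrA ler_pdivrMr //.
have aux (x : R) : 4 <= x -> (x + 1) * (x + 1) <= ((x + 1) / 2) ^+ 2 * x.
  move=> x4; have : 0 <= (x + 1) ^+ 2 * (x - 4); last by lra.
  by rewrite mulr_ge0 ?sqr_ge0 ?subr_ge0.
exact: aux.
Qed.

(** The width bound for the intersection of [T] with the ball of radius [W - 1], in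
dual form.  If [h a <= 1] or [h (- b) <= 1], first order estimates suffice.
Otherwise the sum of the distances is at least [1 - dot a b], and [dot a b] is
bounded by the support values; in dimension two the ball contains [T], and the
inequality is the width bound for [T] itself. *)
Lemma truncation_inequality a b v : enorm v = 1 ->
  W <= h a + h (- b) + (W - 1) * (enorm (v - a) + enorm (v - b)).
Proof.
move=> v1; have [W2 Wn] := @simplex_width_bounds R n n0; rewrite -/W in W2 Wn.
have mu0 : 0 <= h a by apply: le_trans (enorm_ge0 a) _; exact: enorm_le_simplex_supp.
have eta0 : 0 <= h (- b).
  by apply: le_trans (enorm_ge0 (- b)) _; exact: enorm_le_simplex_supp.
have D1 := enorm_ge0 (v - a); have D2 := enorm_ge0 (v - b).
have [f1 f2] := dist_ge_simplex_supp n0 ru a b v1.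
have [g1 g2] := dist_ge_simplex_supp n0 ru (- b) (- a) (etrans (enormN v) v1).
have E1 : enorm (- v - - b) = enorm (v - b) by rewrite -opprD enormN.
have E2 : enorm (- v - - a) = enorm (v - a) by rewrite -opprD enormN.
rewrite E1 in g1 g2; rewrite E2 opprK in g2.
rewrite -/h in f1 f2 g1 g2.
have dab := dot_le_simplex_supp n0 ru a b; rewrite -/h in dab.
have nT : n%:R * (h a * h (- b) / n%:R) = h a * h (- b) by rewrite mulrC divfK // gt_eqF.
have T0 : 0 <= h a * h (- b) / n%:R by apply: divr_ge0 => //; exact: mulr_ge0.
set mu := h a in mu0 f1 f2 g1 g2 dab nT T0 *.
set eta := h (- b) in eta0 f1 f2 g1 g2 dab nT T0 *.
set T := mu * eta / n%:R in f2 dab nT T0.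
have gT : eta * mu / n%:R = T by rewrite /T (mulrC eta).
rewrite gT in g2.
have sT : (W - 1) * T <= mu * eta by rewrite -nT; apply: ler_wpM2r => //; lra.
set d1 := enorm (v - a) in D1 f1 f2 g2 *; set d2 := enorm (v - b) in D2 f2 g1 g2 *.
have [m1|m1] := leP mu 1.
  have s1 : 1 <= W - 1 by lra.
  have := truncation_arith_small s1 mu0 m1 eta0 D2 sT f1 g1 f2; lra.
have [e1|e1] := leP eta 1.
  rewrite (mulrC mu) in sT; have s1 : 1 <= W - 1 by lra.
  have := truncation_arith_small s1 eta0 e1 mu0 D1 sT g1 f1 g2; lra.
have [lW|lW] := leP W (mu + eta).
  have : 0 <= (W - 1) * (d1 + d2) by rewrite mulr_ge0; lra.
  lra.
have [D1'|D1'] := leP 1 (d1 + d2).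
  have : (W - 1) * 1 <= (W - 1) * (d1 + d2) by rewrite ler_wpM2l; lra.
  lra.
have l2 : 2 <= mu + eta by lra.
have dge : 1 - dot a b <= d1 + d2 by apply: dist_sum_ge => //; rewrite -/d1 -/d2; lra.
have D0 : 0 <= d1 + d2 by lra.
have T4 : 4 * n%:R * T <= (mu + eta) ^+ 2.
  by rewrite -mulrA nT; have := sqr_ge0 (mu - eta); lra.
have hT : 1 - T <= d1 + d2 by lra.
have [on|en] := boolP (odd n).
  apply: (truncation_arith_large l2 (ltW lW) _ nR T4 hT).
  by rewrite /W sqr_simplex_width_odd.
have Wsq := sqr_simplex_width_even (R := R) en; rewrite -/W in Wsq.
pose k := n./2; have nk : n = (2 * k)%N.
  by rewrite mul2n -[LHS]odd_double_half (negPf en).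
have [n4|n4] := leqP 4 n.
  have n4R : 4 <= n%:R :> R by rewrite ler_nat.
  have [l3|l3] := leP (mu + eta) 3.
    by apply: (truncation_arith_even_mid l2 l3 n4R _ Wsq T4 hT); lra.
  apply: (truncation_arith_even_far (ltW l3) (ltW lW) n4R Wsq D0).
  have lam0 : 0 < h a + h (- b) by rewrite -/mu -/eta; lra.
  have := dot_le_even n0 ru nk lam0; rewrite -/h -/mu -/eta -/W.
  have := sum_coord_dist_le a b n4; set Z := \sum_i _ => hZ hdot.
  have ab : enorm (a - b) <= d1 + d2.
    have -> : a - b = (v - b) - (v - a) by apply/rowP => i; rewrite !mxE; ring.
    by apply: le_trans (enormD _ _) _; rewrite enormN addrC.
  have n1 : 0 < n%:R + 1 :> R by lra.
  have {}hZ : Z <= (n%:R + 1) / 2 * (d1 + d2).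
    by apply: le_trans hZ _; rewrite ler_wpM2l // divr_ge0 // ltW.
  have W2p : 0 < W ^+ 2 by rewrite exprn_gt0 //; lra.
  have nm1 : 0 < n%:R - 1 :> R by lra.
  have c0 : 0 <= (mu + eta) / (2 * (n%:R + 1) * (n%:R - 1)).
    by rewrite divr_ge0 ?mulr_ge0 //; lra.
  have h1 : 1 <= (mu + eta) ^+ 2 / W ^+ 2 + (mu + eta) / (4 * (n%:R - 1)) * (d1 + d2) + (d1 + d2).
    have E : (mu + eta) / (4 * (n%:R - 1)) * (d1 + d2) =
      (mu + eta) / (2 * (n%:R + 1) * (n%:R - 1)) * ((n%:R + 1) / 2 * (d1 + d2)).
      by field; rewrite !gt_eqF.
    have := ler_wpM2l c0 hZ; rewrite -E; lra.
  have W4 : 0 < 4 * (n%:R - 1) * W ^+ 2 by rewrite mulr_gt0 // mulr_gt0.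
  have := ler_wpM2l (ltW W4) h1; rewrite mulr1.
  have -> : 4 * (n%:R - 1) * W ^+ 2 *
     ((mu + eta) ^+ 2 / W ^+ 2 + (mu + eta) / (4 * (n%:R - 1)) * (d1 + d2) + (d1 + d2)) =
     4 * (n%:R - 1) * (mu + eta) ^+ 2
     + W ^+ 2 * (4 * (n%:R - 1) + (mu + eta)) * (d1 + d2).
    have Wz : W != 0 by rewrite gt_eqF //; lra.
    by field; rewrite Wz gt_eqF.
  lra.
(* n = 2, where W - 1 = n and h is W - 1 Lipschitz *)
have n2 : n = 2 by move: n0 n4 en; case: (n) => [|[|[|[|]]]].
have n2R : n%:R = 2 :> R by rewrite n2.
have W3 : W = 3.
  apply/eqP; rewrite -(@eqrXn2 _ 2) //; last by lra.
  by apply/eqP; move: Wsq; rewrite n2R; lra.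
have := simplex_suppN_near n0 ru (- v) (- a); rewrite E2 !opprK -/h -/mu -/d1 n2R => b1.
have := simplex_suppN_near n0 ru v b; rewrite -/h -/eta -/d2 n2R => b2.
suff : W <= h v + h (- v) by rewrite W3; lra.
have hv := enorm_le_simplex_supp n0 ru v; have hNv := enorm_le_simplex_supp n0 ru (- v).
rewrite enormN v1 -/h in hNv; rewrite v1 -/h in hv.
have lv : 0 < h v + h (- v) by lra.
have := dot_le_even n0 ru nk lv; rewrite -/h -/W -sqr_enorm v1 expr1n.
rewrite (_ : \sum_i _ = 0) ?mulr0 ?addr0; last by apply: big1 => i _; rewrite subrr normr0.
rewrite W3 ler_pdivlMr // mul1r ler_sqr ?nnegrE //; lra.
Qed.

End TruncationInequality.

(** * Truncated simplices attain the upper bound *)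

Section TruncatedSimplex.
Context {R : realType} {n : nat} (u : 'I_n.+1 -> 'rV[R]_n).
Context (n0 : (0 < n)%N) (ru : regular_simplex u).
Implicit Types (x y z v c a b : 'rV[R]_n) (r t s m M : R).

Let nR : 0 < n%:R :> R. Proof. by rewrite ltr0n. Qed.
Let W : R := simplex_width n.
Let h := simplex_supp u.

Definition truncated_simplex s : set 'rV[R]_n :=
  [set x | (forall i, dot x (u i) <= 1) /\ enorm x <= s].

Lemma eball_truncated_simplex s r : r <= 1 -> r <= s -> eball 0 r `<=` truncated_simplex s.
Proof.
move=> r1 rs x; rewrite /eball /= subr0 => xr; split=> [i|]; last exact: le_trans rs.
apply: le_trans (dot_le _ _) _; rewrite (enorm_vertex ru) mulr1.
exact: le_trans xr r1.
Qed.

Lemma truncated_simplex_outer s : truncated_simplex s `<=` eball 0 s.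
Proof. by move=> x [_ xs]; rewrite /eball /= subr0. Qed.

Lemma body_truncated_simplex s : 1 <= s -> convex_body (truncated_simplex s).
Proof.
move=> s1; split.
- apply: (@closed_enorm_bounded_compact _ _ _ s); last by move=> x [].
  have -> : truncated_simplex s =
      (\bigcap_i [set x | dot (u i) x <= 1]) `&` [set x | enorm x <= s].
    apply/seteqP; split => x [h1 h2]; split=> // i; first by move=> _ /=; rewrite dotC.
    by rewrite dotC; exact: (h1 i I).
  apply: closedI; last exact: closed_le_fun (@continuous_enorm R n).
  by apply: closed_bigI => i _; exact: closed_le_fun (@continuous_dot R n (u i)).
- apply/convexP => x y t [x1 xs] [y1 ys] /andP[t0 t1].
  have t1' : 0 <= 1 - t by rewrite subr_ge0.
  split=> [i|].
    rewrite !dotE; have := ler_wpM2l t0 (x1 i); have := ler_wpM2l t1' (y1 i); lra.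
  apply: le_trans (enormD _ _) _; rewrite !enormZ !ger0_norm //.
  have := ler_wpM2l t0 xs; have := ler_wpM2l t1' ys; lra.
exists 0; apply/interior_ball; exists 1 => //; exact: eball_truncated_simplex.
Qed.

Lemma opp_vertex_truncated s i : 0 <= s -> s <= n%:R ->
  truncated_simplex s (- s *: u i).
Proof.
move=> s0 sn; split=> [j|]; last first.
  by rewrite enormZ (enorm_vertex ru) mulr1 normrN ger0_norm.
case: ru => _ u1 uu _; rewrite dotZl; have [->|ij] := eqVneq i j; first by rewrite u1; lra.
by rewrite uu // mulrNN ler_pdivrMr // mul1r.
Qed.

(** If [c - K] lies in [rho K], the points [- s u i] of [K] give
[s + dot c (u i) <= rho]; the sum over [i] eliminates [c]. *)
Lemma asymmetry_truncated_simplex s : 1 <= s -> s <= n%:R ->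
  minkowski_asymmetry (truncated_simplex s) = s.
Proof.
move=> s1 sn; have s0 : 0 < s by lra.
have bK := body_truncated_simplex s1.
apply/eqP; rewrite eq_le; apply/andP; split.
  have := @asymmetry_nested_balls _ _ (truncated_simplex s) 0 1 0 s ltr01 s0.
  rewrite divr1; apply; last exact: truncated_simplex_outer.
  exact: eball_truncated_simplex.
apply: le_asymmetry => // rho c rho0 hc.
have key i : s + dot c (u i) <= rho.
  have [|x [xu _] E] := hc (c - (- s *: u i)).
    exists (- (- s *: u i)) => //; exists (- s *: u i) => //.
    by apply: opp_vertex_truncated => //; exact: ltW.
  have := ler_wpM2l rho0 (xu i); rewrite mulr1 -dotZl E scaleNr opprK.
  by case: ru => _ u1 _ _; rewrite dotDl dotZl u1 mulr1 addrC.
have : \sum_(i < n.+1) (s + dot c (u i)) <= \sum_(i < n.+1) rho.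
  by apply: ler_sum => i _; exact: key.
rewrite big_split /= (sum_coord ru) addr0 !sumr_const card_ord.
by rewrite ler_pMn2r.
Qed.

(** The infimum over [a] of [h a + (W - 1) |v - a|] is a sublinear function of
[v] below both [h] and [(W - 1) |v|], so the points that support it lie in [T] and
in the ball of radius [W - 1]. *)
Lemma truncated_simplex_supporting_point v :
  exists2 x, truncated_simplex (W - 1) x &
    forall w : R, (forall a, w <= h a + (W - 1) * enorm (v - a)) -> w <= dot x v.
Proof.
have [W2 Wn] := @simplex_width_bounds R n n0; rewrite -/W in W2 Wn.
have s0 : 0 <= W - 1 by lra.
have h0 a : 0 <= h a by apply: le_trans (enorm_ge0 a) (enorm_le_simplex_supp n0 ru a).
pose S y := [set h a + (W - 1) * enorm (y - a) | a in setT].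
have S0 y : S y !=set0 by exists (h 0 + (W - 1) * enorm (y - 0)), 0.
have lbS y : has_lbound (S y).
  by exists 0 => _ [a _ <-]; apply: addr_ge0 => //; rewrite mulr_ge0 ?enorm_ge0.
pose p y := inf (S y).
have ple y a : p y <= h a + (W - 1) * enorm (y - a) by apply: ge_inf => //; exists a.
have lep y w : (forall a, w <= h a + (W - 1) * enorm (y - a)) -> w <= p y.
  by move=> hw; apply: lb_le_inf => // _ [a _ <-]; exact: hw.
have sp : sublinear p.
  split=> [x y|t x t0].
    rewrite -lerBlDr; apply: (lep) => a; rewrite lerBlDr -lerBlDl.
    apply: (lep) => b; have := ple (x + y) (a + b); have := simplex_suppD u n0 a b.
    have : (W - 1) * enorm (x + y - (a + b)) <=
        (W - 1) * (enorm (x - a) + enorm (y - b)).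
      by rewrite ler_wpM2l // opprD addrACA enormD.
    rewrite -/h; lra.
  have [->|tn0] := eqVneq t 0.
    have := ple (0 *: x) 0; rewrite scale0r mul0r subr0 enorm0 mulr0 addr0.
    by rewrite /h simplex_supp0.
  have tp : 0 < t by rewrite lt_def tn0.
  rewrite -ler_pdivrMl //; apply: (lep) => a; rewrite ler_pdivrMl //.
  apply: le_trans (ple _ (t *: a)) _.
  by rewrite /h simplex_suppZ // -scalerBr enormZ ger0_norm //; lra.
have [x [xp xv]] := sublinear_support v sp; exists x; last first.
  by move=> w hw; rewrite xv; exact: lep.
split=> [i|].
  apply: le_trans (xp (u i)) _; apply: le_trans (ple _ (u i)) _.
  rewrite subrr enorm0 mulr0 addr0; exact: simplex_supp_vertex.
have := xp x; rewrite -sqr_enorm => /le_trans/(_ (ple x 0)).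
rewrite subr0 /h simplex_supp0 // add0r => hx.
have [->|x0] := eqVneq x 0; first by rewrite enorm0.
by move: hx; rewrite expr2 ler_pM2r // enorm_gt0.
Qed.

Lemma width_truncated_simplex_critical v : enorm v = 1 ->
  exists x y, [/\ truncated_simplex (W - 1) x, truncated_simplex (W - 1) y &
    W <= dot v (x - y)].
Proof.
move=> v1; have [x Kx hx] := truncated_simplex_supporting_point v.
have [y Ky hy] := truncated_simplex_supporting_point (- v).
exists x, y; split=> //; rewrite dotBr (dotC v x) (dotC v y) -(dotNr y).
rewrite -lerBlDr; apply: hx => a; rewrite lerBlDr -lerBlDl.
apply: hy => b; have := truncation_inequality n0 ru a (- b) v1.
rewrite !opprK -/h -/W.
have -> : enorm (- v - b) = enorm (v + b) by rewrite -enormN opprD !opprK.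
lra.
Qed.

(** For [s < W - 1] the body contains a convex combination of the critical
truncation and the unit ball, with the weights for which it lies in the ball of
radius [s]. *)
Lemma min_width_truncated_simplex s : 1 <= s ->
  Num.min (s + 1) W <= min_width (truncated_simplex s).
Proof.
move=> s1; have [W2 Wn] := @simplex_width_bounds R n n0; rewrite -/W in W2 Wn.
have bK := body_truncated_simplex s1; have [cK _ _] := bK.
apply: le_min_width => // v v1.
have [x [y [[x1 xs] [y1 ys] xy]]] := width_truncated_simplex_critical v1.
have [sW|sW] := leP (W - 1) s.
  have Kx : truncated_simplex s x by split=> //; exact: le_trans sW.
  have Ky : truncated_simplex s y by split=> //; exact: le_trans sW.
  rewrite ge_min; apply/orP; right; apply: le_trans xy _; exact: width_ge.
rewrite ge_min; apply/orP; left.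
(* the weight for which t (W - 1) + (1 - t) = s *)
pose t := (s - 1) / (W - 2).
have tE : t * (W - 2) = s - 1 by rewrite divfK // gt_eqF //; lra.
have t0 : 0 <= t by rewrite divr_ge0 //; lra.
have t1 : t <= 1 by rewrite ler_pdivrMr //; lra.
have mix z e : (forall i, dot z (u i) <= 1) -> enorm z <= W - 1 -> enorm e = 1 ->
    truncated_simplex s (t *: z + (1 - t) *: e).
  move=> z1 zW e1; have t1' : 0 <= 1 - t by rewrite subr_ge0.
  split=> [i|].
    have := dot_le e (u i); rewrite e1 (enorm_vertex ru) mulr1 => he.
    rewrite !dotE; have := ler_wpM2l t0 (z1 i); have := ler_wpM2l t1' he; lra.
  apply: le_trans (enormD _ _) _; rewrite !enormZ !ger0_norm // e1.
  have := ler_wpM2l t0 zW; lra.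
have := width_ge v cK (mix x v x1 xs v1) (mix y (- v) y1 ys (etrans (enormN v) v1)).
apply: le_trans; rewrite scalerN.
have -> : t *: x + (1 - t) *: v - (t *: y - (1 - t) *: v) =
   t *: (x - y) + (2 * (1 - t)) *: v by apply/rowP => i; rewrite !mxE; ring.
rewrite dotDr !dotZr -sqr_enorm v1 expr1n; have := ler_wpM2l t0 xy; lra.
Qed.

Lemma truncated_simplex_optimal s : 1 <= s -> s <= n%:R ->
  ratio_upper_bound n s <= min_width (truncated_simplex s)
    / (2 * circumradius (truncated_simplex s)).
Proof.
move=> s1 sn; have s0 : 0 < 2 * s by lra.
have bK := body_truncated_simplex s1.
have R0 := circumradius_gt0 n0 bK.
have Rs : circumradius (truncated_simplex s) <= s.
  by apply: circumradius_le (@truncated_simplex_outer s); lra.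
rewrite ratio_upper_boundE; apply: (@le_trans _ _ (min_width (truncated_simplex s) / (2 * s))).
  rewrite ler_pdivlMr //; apply: le_trans (min_width_truncated_simplex s1).
  by rewrite le_min -[X in X && _]ler_pdivlMr // -[X in _ && X]ler_pdivlMr //
    !ge_min !lexx orbT.
rewrite ler_wpM2l ?min_width_ge0 // lef_pV2 ?posrE ?mulr_gt0 //.
  by rewrite ler_wpM2l.
by lra.
Qed.

End TruncatedSimplex.

(** * Cubes, cross-polytopes and simplices *)

Section ConvexHull.
Context {R : realType} {n : nat}.
Implicit Types (K X : set 'rV[R]_n) (x y z v c a b : 'rV[R]_n) (r t s : R).

Lemma convex_comb K m (p : 'I_m -> 'rV[R]_n) (w : 'I_m -> R) : convex_set K ->
  (forall i, K (p i)) -> (forall i, 0 <= w i) -> \sum_i w i = 1 ->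
  K (\sum_i w i *: p i).
Proof.
move=> /convexP vK; elim: m p w => [|m IH] p w Kp w0.
  by rewrite big_ord0 => /eqP; rewrite eq_sym oner_eq0.
rewrite !big_ord_recr /=; set S := \sum_(i < m) w _ => S1.
have S0 : 0 <= S by apply: sumr_ge0.
have wE : w ord_max = 1 - S by rewrite -S1 [S + _]addrC addrK.
have [Sz|Snz] := eqVneq S 0.
  have wz i : w (widen_ord (leqnSn m) i) = 0.
    have : S == 0 by rewrite Sz.
    rewrite psumr_eq0 // => /allP/(_ i); rewrite mem_index_enum => /(_ isT)/eqP.
    exact.
  rewrite big1 => [|i _]; last by rewrite wz scale0r.
  by rewrite add0r wE Sz subr0 scale1r.
have -> : \sum_(i < m) w (widen_ord (leqnSn m) i) *: p (widen_ord (leqnSn m) i)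
    = S *: \sum_(i < m) (w (widen_ord (leqnSn m) i) / S) *: p (widen_ord (leqnSn m) i).
  rewrite scaler_sumr; apply: eq_bigr => i _.
  by rewrite scalerA mulrC divfK.
rewrite wE; apply: vK => //.
  apply: (IH (fun i => p (widen_ord (leqnSn m) i))
    (fun i => w (widen_ord (leqnSn m) i) / S)) => // [i|].
    by rewrite divr_ge0.
  by rewrite -mulr_suml mulfV.
rewrite S0 -subr_ge0 -wE; exact: w0.
Qed.

Lemma conv_hull_min K X : convex_set K -> X `<=` K -> conv_hull X `<=` K.
Proof. by move=> vK XK x h; apply: h. Qed.

Lemma conv_hull_sub X : X `<=` conv_hull X.
Proof. by move=> x Xx K [_ XK]; exact: XK. Qed.

Lemma conv_hull_convex X : convex_set (conv_hull X).
Proof.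
apply/convexP => x y t hx hy t01 K [vK XK].
by move/convexP: (vK); apply => //; [apply: hx|apply: hy].
Qed.

Lemma regular_crosspolytopeE :
  (0 < n)%N -> regular_crosspolytope = [set x : 'rV[R]_n | \sum_i `|x 0 i| <= 1].
Proof.
move=> n0; apply/seteqP; split.
  apply: conv_hull_min.
    apply/convexP => x y t /= hx hy /andP[t0 t1]; have t1' : 0 <= 1 - t by rewrite subr_ge0.
    apply: (@le_trans _ _ (t * \sum_i `|x 0 i| + (1 - t) * \sum_i `|y 0 i|)).
      rewrite !mulr_sumr -big_split; apply: ler_sum => i _; rewrite !mxE.
      by apply: le_trans (ler_normD _ _) _; rewrite !normrM (ger0_norm t0) (ger0_norm t1').
    have := ler_wpM2l t0 hx; have := ler_wpM2l t1' hy; lra.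
  have e1 i : \sum_j `|(delta_mx 0 i : 'rV[R]_n) 0 j| <= 1.
    rewrite (bigD1 i) //= big1 => [|j /negPf ji]; last by rewrite mxE ji andbF normr0.
    by rewrite mxE !eqxx normr1 addr0.
  move=> _ [i [->|->]] /=; first exact: e1.
  by under eq_bigr do rewrite mxE normrN; exact: e1.
move=> x /= x1; pose e (i : 'I_n) : 'rV[R]_n := Num.sg (x 0 i) *: delta_mx 0 i.
have vC := @conv_hull_convex [set x | exists i : 'I_n, x = delta_mx 0 i \/ x = - delta_mx 0 i].
have Ce i : regular_crosspolytope (delta_mx 0 i : 'rV[R]_n).
  by apply: conv_hull_sub; exists i; left.
have CNe i : regular_crosspolytope (- delta_mx 0 i : 'rV[R]_n).
  by apply: conv_hull_sub; exists i; right.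
have C0 : regular_crosspolytope (0 : 'rV[R]_n).
  have h2 : 0 <= (1 / 2 : R) <= 1 by apply/andP; split; lra.
  move/convexP: (vC) => vC'; have := vC' _ _ _ (Ce (Ordinal n0)) (CNe (Ordinal n0)) h2.
  by rewrite scalerN -scalerBl (_ : _ - _ = 0) ?scale0r //; lra.
pose p (i : 'I_n.+1) := oapp e 0 (unlift ord_max i).
pose w (i : 'I_n.+1) := oapp (fun j => `|x 0 j|) (1 - \sum_j `|x 0 j|) (unlift ord_max i).
have -> : x = \sum_i w i *: p i.
  rewrite (bigD1_ord ord_max) //= /p unlift_none /= scaler0 add0r.
  rewrite {1}(row_sum_delta x); apply: eq_bigr => i _.
  by rewrite /w liftK /= /e scalerA mulrC -numEsg.
apply: convex_comb => // [i|i|].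
- rewrite /p; case: (unlift ord_max i) => //= j; rewrite /e.
  have [xj|xj|->] := ltgtP (x 0 j) 0; last by rewrite sgr0 scale0r.
    by rewrite ltr0_sg // scaleN1r.
  by rewrite gtr0_sg // scale1r.
- by rewrite /w; case: (unlift ord_max i) => [j|] //=; rewrite subr_ge0.
rewrite (bigD1_ord ord_max) //= /w unlift_none /=.
by under [X in _ + X]eq_bigr do rewrite liftK /=; rewrite subrK.
Qed.

Lemma body_cube : convex_body (@cube R n).
Proof.
split.
- apply: (@closed_enorm_bounded_compact _ _ _ (n%:R * 1)).
    have -> : @cube R n = \bigcap_i ([set x | dot (delta_mx 0 i) x <= 1] `&`
        [set x | dot (- delta_mx 0 i) x <= 1]).
      apply/seteqP; split => x hx i; last first.
        have [/= h1 h2] := hx i I; rewrite dotNl dotC dot_delta in h2.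
        by rewrite dotC dot_delta in h1; apply/andP; split; lra.
      move=> _; have /andP[h1 h2] := hx i.
      by split=> /=; rewrite ?dotNl dotC dot_delta; lra.
    apply: closed_bigI => i _; apply: closedI; apply: closed_le_fun;
      exact: continuous_dot.
  move=> x hx; apply: le_trans (enorm_le_norm x) _; rewrite ler_wpM2l //.
  rewrite [leLHS]/Num.norm /= mx_normrE; apply/bigmax_leP; split=> // -[j i] _ /=.
  by rewrite ord1 ler_norml; exact: hx.
- apply/convexP => x y t hx hy /andP[t0 t1] i; have t1' : 0 <= 1 - t by rewrite subr_ge0.
  rewrite !mxE; have /andP[x1 x2] := hx i; have /andP[y1 y2] := hy i.
  have := ler_wpM2l t0 x1; have := ler_wpM2l t0 x2.
  have := ler_wpM2l t1' y1; have := ler_wpM2l t1' y2.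
  by move=> *; apply/andP; split; lra.
exists 0; apply/interior_ball; exists 1 => // x; rewrite /eball /= subr0 => x1 i.
by rewrite -ler_norml; exact: le_trans (coord_le_enorm x i) x1.
Qed.

Lemma sum_abs_le_enorm x : \sum_i `|x 0 i| <= n%:R * enorm x.
Proof.
apply: (@le_trans _ _ (\sum_(i < n) enorm x)).
  by apply: ler_sum => i _; exact: coord_le_enorm.
by rewrite sumr_const card_ord mulr_natl.
Qed.

Lemma body_crosspolytope : (0 < n)%N -> convex_body (@regular_crosspolytope R n).
Proof.
move=> n0; have nR : 0 < n%:R :> R by rewrite ltr0n.
split; last 1 first.
- rewrite regular_crosspolytopeE //; exists 0; apply/interior_ball.
  exists n%:R^-1; first by rewrite invr_gt0.
  move=> x; rewrite /eball /= subr0 => xr; apply: le_trans (sum_abs_le_enorm x) _.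
  by rewrite -ler_pdivlMl // mulr1.
- rewrite regular_crosspolytopeE //.
  apply: (@closed_enorm_bounded_compact _ _ _ (n%:R * 1)).
    apply: closed_le_fun; apply: continuous_sumr => i x.
    apply: (@continuous_comp _ _ _ (fun x : 'rV[R]_n => x 0 i) Num.norm).
      exact: coord_continuous.
    exact: norm_continuous.
  move=> x /= hx; apply: le_trans (enorm_le_norm x) _; rewrite ler_wpM2l //.
  rewrite [leLHS]/Num.norm /= mx_normrE; apply/bigmax_leP; split=> // -[j i] _ /=.
  rewrite ord1; apply: le_trans hx; rewrite (bigD1 i) //= lerDl.
  by apply: sumr_ge0 => k _; exact: normr_ge0.
exact: conv_hull_convex.
Qed.

End ConvexHull.

Section Extremal.
Context {R : realType} {n : nat}.
Context (n0 : (0 < n)%N).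
Implicit Types (K : set 'rV[R]_n) (x y z v c a b : 'rV[R]_n) (r t s : R).

Let nR : 0 < n%:R :> R. Proof. by rewrite ltr0n. Qed.

(** Adding [+ x] or [- x] to a vector, whichever forms no obtuse angle with it,
increases its squared length by at least [|x|^2]. *)
Lemma exists_signs m (a : 'I_m -> 'rV[R]_n) y :
  exists e : 'I_m -> R, (forall i, `|e i| = 1) /\
    dot y y + \sum_i dot (a i) (a i)
      <= dot (y + \sum_i e i *: a i) (y + \sum_i e i *: a i).
Proof.
elim: m a => [|m IH] a; first by exists (fun=> 1); rewrite !big_ord0 !addr0 normr1.
have [e [e1 he]] := IH (fun i => a (lift ord_max i)).
set z := y + \sum_i _ in he.
pose d : R := if 0 <= dot z (a ord_max) then 1 else -1.
have d1 : `|d| = 1 by rewrite /d; case: ifP; rewrite ?normrN normr1.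
have dz : 0 <= d * dot z (a ord_max).
  rewrite /d; case: ifPn; first by rewrite mul1r.
  by rewrite -ltNge mulN1r oppr_ge0 => /ltW.
pose f (i : 'I_m.+1) := oapp e d (unlift ord_max i).
exists f; split=> [i|]; first by rewrite /f; case: (unlift ord_max i) => /=.
rewrite !(bigD1_ord ord_max) //= {1 3}/f unlift_none /=.
have -> : \sum_i f (lift ord_max i) *: a (lift ord_max i) =
    \sum_i e i *: a (lift ord_max i).
  by apply: eq_bigr => i _; rewrite /f liftK.
have -> : y + (d *: a ord_max + \sum_i e i *: a (lift ord_max i)) = z + d *: a ord_max.
  by rewrite addrCA addrC.
have dd : d * d = 1 by rewrite -expr2 -real_normK ?num_real // d1 expr1n.
have E q : dot (q + d *: a ord_max) (q + d *: a ord_max) =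
    dot q q + 2 * (d * dot q (a ord_max)) + dot (a ord_max) (a ord_max).
  have -> : dot (a ord_max) (a ord_max) = d * d * dot (a ord_max) (a ord_max).
    by rewrite dd mul1r.
  by rewrite !dotE (dotC (a ord_max) q); ring: dd.
rewrite E; lra.
Qed.

Lemma is_max_inv_sqrt K :
  convex_body K ->
  (forall A, A \in unitmx -> forall r c, 0 <= r -> linear_image A K `<=` eball c r ->
     min_width (linear_image A K) <= 1 / Num.sqrt n%:R * (2 * r)) ->
  is_max (width_radius_ratios K) (1 / Num.sqrt n%:R).
Proof.
move=> bK hK; have sn : 0 < Num.sqrt n%:R :> R by rewrite sqrtr_gt0.
have ub : ubound (width_radius_ratios K) (1 / Num.sqrt n%:R).
  move=> _ [A /= uA <-]; apply: ratio_le => //; last exact: hK.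
    exact: body_linear_image.
  by rewrite divr_gt0.
have [m [[Sm um] lm]] := max_ratio_exists n0 bK.
have <- : m = 1 / Num.sqrt n%:R by apply/eqP; rewrite eq_le lm ub.
by [].
Qed.

(** The ratio is invariant under translation, and a linear image of a linear image
of [P] is a linear image of [P]. *)
Lemma affine_image_is_max (P : set 'rV[R]_n) K : convex_body P ->
  (forall A, A \in unitmx -> forall r c, 0 <= r -> linear_image A P `<=` eball c r ->
     min_width (linear_image A P) <= 1 / Num.sqrt n%:R * (2 * r)) ->
  affine_image_of P K ->
  is_max (width_radius_ratios K) (1 / Num.sqrt n%:R).
Proof.
move=> bP hP [A [c [uA ->]]].
have bAP := body_linear_image uA bP.
apply: is_max_inv_sqrt => [|B uB r d r0]; first exact: body_translate.
rewrite linear_image_translate linear_image_mul.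
have uAB : A *m B \in unitmx by rewrite unitmx_mul uA.
rewrite min_width_translate; last exact: body_linear_image.
move=> h; apply: (hP _ uAB r (d - c *m B)) => // x Lx.
have := h (c *m B + x) (ex_intro2 _ _ x Lx erefl).
by rewrite /eball /= opprB addrA [x + _]addrC.
Qed.

(** The vector [e *m (invmx A)^T] has the products [e 0 i] with the rows of
[A]. *)
Lemma dual_direction (A : 'M[R]_n) x e : A \in unitmx ->
  dot (e *m (invmx A)^T) (x *m A) = dot e x.
Proof. by move=> uA; rewrite dotC dot_mulmx -mulmxA -trmx_mul mulmxV // trmx1 mulmx1 dotC. Qed.

Lemma min_width_le_dual K A e r : A \in unitmx -> convex_body (linear_image A K) ->
  0 < r -> Num.sqrt n%:R <= r * enorm (e *m (invmx A)^T) ->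
  (forall x, K x -> `|dot e x| <= 1) ->
  min_width (linear_image A K) <= 1 / Num.sqrt n%:R * (2 * r).
Proof.
move=> uA bL r0; have K0 := body_nonempty bL; have [cL _ _] := bL.
set v := e *m _ => hv he.
have sn : 0 < Num.sqrt n%:R :> R by rewrite sqrtr_gt0.
have [_ [_ [[x Kx <-] [y Ky <-] wE]]] := width_attained v K0 cL.
have w2 : width (linear_image A K) v <= 2.
  rewrite wE dotBr !dual_direction //.
  have := he x Kx; have := he y Ky; rewrite !ler_norml => /andP[h1 h2] /andP[h3 h4]; lra.
have h1 := le_trans (min_width_le v bL) w2.
rewrite mulrAC mul1r ler_pdivlMr //.
apply: le_trans (ler_wpM2l (min_width_ge0 bL) hv) _.
have := ler_wpM2l (ltW r0) h1; lra.
Qed.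

Lemma outer_radius_gt0 K c r : convex_body K -> K `<=` eball c r -> 0 < r.
Proof.
move=> bK Kr; have := min_width_outer_ball n0 bK Kr.
have := min_width_gt0 n0 bK; lra.
Qed.

(** The width orthogonal to all generators but the shortest one is at most twice
its length, while by [exists_signs] the squared circumradius is at least the sum
of the squared lengths. *)
Lemma cube_bound A : A \in unitmx -> forall r c, 0 <= r ->
  linear_image A (@cube R n) `<=` eball c r ->
  min_width (linear_image A (@cube R n)) <= 1 / Num.sqrt n%:R * (2 * r).
Proof.
move=> uA r c r0 Lr; have bL := body_linear_image uA (@body_cube R n).
have rp := outer_radius_gt0 bL Lr.
have [e [e1 he]] := exists_signs (fun i => row i A) (- c).
have sumA : \sum_i dot (row i A) (row i A) <= r ^+ 2.
  have hx : cube (\row_i e i) by move=> i; rewrite -ler_norml mxE e1.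
  have := Lr _ (ex_intro2 _ _ _ hx erefl); rewrite /eball /=.
  have -> : \row_i e i *m A - c = - c + \sum_i e i *: row i A.
    by rewrite addrC mulmx_sum_row; congr (_ + _); apply: eq_bigr => i _; rewrite mxE.
  move=> hr; have := dotxx_ge0 (- c).
  have : enorm (- c + \sum_i e i *: row i A) ^+ 2 <= r ^+ 2.
    by rewrite ler_sqr ?nnegrE ?enorm_ge0.
  rewrite sqr_enorm; lra.
have [i hi] : exists i, n%:R * dot (row i A) (row i A) <= r ^+ 2.
  have [i hi] : exists i, forall j, dot (row i A) (row i A) <= dot (row j A) (row j A).
    by case: (@arg_minP _ _ _ (Ordinal n0) predT (fun i => dot (row i A) (row i A))) => // i _ h;
      exists i => j; exact: h.
  exists i; apply: le_trans sumA.
  rewrite -[n in n%:R]card_ord -sumr_const mulr_suml; apply: ler_sum => j _.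
  by rewrite mul1r.
apply: (@min_width_le_dual _ A (delta_mx 0 i) r) => // [|x hx]; last first.
  by rewrite dotC dot_delta ler_norml; exact: hx.
set v := _ *m _; have av : 1 <= enorm v * enorm (row i A).
  have := dot_le v (row i A); rewrite rowE dual_direction // dot_delta mxE !eqxx.
  by rewrite -rowE.
have ha : Num.sqrt n%:R * enorm (row i A) <= r.
  rewrite -ler_sqr ?nnegrE ?mulr_ge0 ?enorm_ge0 ?sqrtr_ge0 // exprMn sqr_enorm.
  by rewrite sqr_sqrtr // ltW.
have := ler_wpM2l (enorm_ge0 v) ha; have := ler_wpM2l (sqrtr_ge0 (n%:R : R)) av; lra.
Qed.

(** All generators have length at most [r], so the vectors of the dual basis have
length at least [1 / r]; a signed sum of them of length at least [sqrt n / r] is a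
direction of small width. *)
Lemma crosspolytope_bound A : A \in unitmx -> forall r c, 0 <= r ->
  linear_image A (@regular_crosspolytope R n) `<=` eball c r ->
  min_width (linear_image A (@regular_crosspolytope R n)) <= 1 / Num.sqrt n%:R * (2 * r).
Proof.
move=> uA r c r0 Lr; have bL := body_linear_image uA (@body_crosspolytope R n n0).
have rp := outer_radius_gt0 bL Lr.
pose a (i : 'I_n) : 'rV[R]_n := delta_mx 0 i *m A.
have ar i : enorm (a i) <= r.
  have h1 : eball c r (a i).
    by apply: Lr; exists (delta_mx 0 i) => //; apply: conv_hull_sub; exists i; left.
  have h2 : eball c r (- a i).
    apply: Lr; exists (- delta_mx 0 i); last by rewrite mulNmx.
    by apply: conv_hull_sub; exists i; right.
  have h3 := enormD (a i - c) (- (- a i - c)).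
  have E : a i - c - (- a i - c) = 2 *: a i by apply/rowP => j; rewrite !mxE; ring.
  rewrite E enormZ enormN ger0_norm // in h3; move: h1 h2; rewrite /eball /=; lra.
pose b (i : 'I_n) : 'rV[R]_n := delta_mx 0 i *m (invmx A)^T.
have br i : 1 <= r ^+ 2 * dot (b i) (b i).
  have h1 : 1 <= enorm (b i) * enorm (a i).
    have := dot_le (b i) (a i); rewrite /a /b dual_direction // dot_delta mxE !eqxx.
    by [].
  have h2 := le_trans h1 (ler_wpM2l (enorm_ge0 (b i)) (ar i)).
  by rewrite -sqr_enorm -exprMn mulrC -[1](expr1n _ 2) ler_sqr ?nnegrE ?mulr_ge0 ?enorm_ge0.
have [e [e1 he]] := exists_signs b 0.
apply: (@min_width_le_dual _ A (\row_i e i) r) => // [|x].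
  have -> : \row_i e i *m (invmx A)^T = \sum_i e i *: b i.
    rewrite mulmx_sum_row; apply: eq_bigr => i _; by rewrite mxE rowE.
  rewrite -ler_sqr ?nnegrE ?mulr_ge0 ?enorm_ge0 ?sqrtr_ge0 //.
  rewrite exprMn sqr_enorm sqr_sqrtr ?(ltW nR) //.
  rewrite dot0l !add0r in he; apply: le_trans (ler_wpM2l (sqr_ge0 r) he).
  rewrite mulr_sumr -[n in n%:R]card_ord -sumr_const; apply: ler_sum => i _; exact: br.
rewrite regular_crosspolytopeE //= => x1; apply: le_trans x1.
apply: le_trans (ler_norm_sum _ _ _) _; apply: ler_sum => i _.
by rewrite normrM mxE e1 mul1r.
Qed.

(** Every simplex is an invertible affine image of this one. *)
Definition corner_simplex : set 'rV[R]_n :=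
  [set x | (forall i, 0 <= x 0 i) /\ \sum_i x 0 i <= 1].

Lemma body_corner_simplex : convex_body corner_simplex.
Proof.
split.
- apply: (@closed_enorm_bounded_compact _ _ _ (n%:R * 1)).
    have -> : corner_simplex = (\bigcap_i [set x | dot (- delta_mx 0 i) x <= 0])
        `&` [set x | dot (const_mx 1) x <= 1].
      have E x : dot (const_mx 1) x = \sum_i x 0 i.
        by apply: eq_bigr => i _; rewrite mxE mul1r.
      apply/seteqP; split => x [h1 h2]; split => //=; rewrite ?E //.
      - by move=> i _ /=; rewrite dotNl oppr_le0 dotC dot_delta.
      - by move=> i; have := h1 i I; rewrite /= dotNl oppr_le0 dotC dot_delta.
      - by rewrite -E.
    apply: closedI; last exact: closed_le_fun (@continuous_dot R n (const_mx 1)).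
    by apply: closed_bigI => i _; apply: closed_le_fun; exact: continuous_dot.
  move=> x [h1 h2]; apply: le_trans (enorm_le_norm x) _; rewrite ler_wpM2l //.
  rewrite [leLHS]/Num.norm /= mx_normrE; apply/bigmax_leP; split=> // -[j i] _ /=.
  rewrite ord1 ger0_norm //; apply: le_trans h2; rewrite (bigD1 i) //= lerDl.
  by apply: sumr_ge0 => k _; exact: h1.
- apply/convexP => x y t [x0 x1] [y0 y1] /andP[t0 t1].
  have t1' : 0 <= 1 - t by rewrite subr_ge0.
  split=> [i|]; first by rewrite !mxE addr_ge0 // mulr_ge0.
  under eq_bigr do rewrite !mxE; rewrite big_split /= -!mulr_sumr.
  have := ler_wpM2l t0 x1; have := ler_wpM2l t1' y1; lra.
(* the ball of radius d around (d, ..., d) *)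
pose d : R := (2 * n%:R)^-1; have d0 : 0 < d by rewrite invr_gt0 mulr_gt0.
exists (const_mx d); apply/interior_ball; exists d => // x; rewrite /eball /= => xd.
have xi i : `|x 0 i - d| <= d.
  by have := le_trans (coord_le_enorm _ i) xd; rewrite !mxE.
split=> [i|]; first by have := xi i; rewrite ler_norml => /andP[]; lra.
apply: (@le_trans _ _ (\sum_(i < n) (2 * d))).
  by apply: ler_sum => i _; have := xi i; rewrite ler_norml => /andP[_]; lra.
by rewrite sumr_const card_ord -[_ *+ _]mulr_natl /d le_eqVlt; apply/orP; left;
  apply/eqP; field; rewrite gt_eqF.
Qed.

Lemma conv_hull_range m (p : 'I_m -> 'rV[R]_n) :
  conv_hull (range p) = [set x | exists w : 'I_m -> R,
    [/\ forall i, 0 <= w i, \sum_i w i = 1 & x = \sum_i w i *: p i]].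
Proof.
apply/seteqP; split; last first.
  move=> x [w [w0 w1 ->]]; apply: convex_comb => //; first exact: conv_hull_convex.
  by move=> i; apply: conv_hull_sub; exists i.
apply: conv_hull_min.
  apply/convexP => x y t [w [w0 w1 ->]] [w' [w0' w1' ->]] /andP[t0 t1].
  have t1' : 0 <= 1 - t by rewrite subr_ge0.
  exists (fun i => t * w i + (1 - t) * w' i); split.
  - by move=> i; rewrite addr_ge0 // mulr_ge0.
  - by rewrite big_split /= -!mulr_sumr w1 w1'; ring.
  - rewrite !scaler_sumr -big_split; apply: eq_bigr => i _ /=.
    by rewrite [RHS]scalerDl -!scalerA.
move=> _ [i _ <-]; exists (fun j => (j == i)%:R); split.
- by move=> j; case: (j == i).
- by rewrite (bigD1 i) //= eqxx big1 ?addr0 // => j /negPf ->.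
- rewrite (bigD1 i) //= eqxx scale1r big1 ?addr0 // => j /negPf ->.
  by rewrite scale0r.
Qed.

Lemma body_simplex K : is_simplex K -> convex_body K.
Proof.
move=> [p [ip ->]].
pose A : 'M[R]_n := \matrix_i (p (lift ord0 i) - p ord0).
have xA x : x *m A = \sum_i x 0 i *: (p (lift ord0 i) - p ord0).
  by rewrite mulmx_sum_row; apply: eq_bigr => i _; rewrite rowK.
have uA : A \in unitmx.
  rewrite unitmxE unitfE; apply/negP => /eqP/eqP/det0P[x x0 xA0].
  pose f (i : 'I_n.+1) := oapp (fun j => x 0 j) (- \sum_j x 0 j) (unlift ord0 i).
  have f0 : f ord0 = - \sum_j x 0 j by rewrite /f unlift_none.
  have fl i : f (lift ord0 i) = x 0 i by rewrite /f liftK.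
  have s0 : \sum_i f i = 0.
    by rewrite (bigD1_ord ord0) //= f0 (eq_bigr _ (fun i _ => fl i)) addNr.
  have sp : \sum_i f i *: p i = 0.
    apply: etrans xA0; rewrite xA (bigD1_ord ord0) //= f0.
    rewrite (eq_bigr _ (fun i _ => congr1 (fun t => t *: _) (fl i))).
    rewrite [RHS](eq_bigr _ (fun i _ => scalerBr _ _ _)) sumrB -scaler_suml.
    by rewrite scaleNr addrC.
  move/eqP: x0; apply; apply/rowP => i; rewrite mxE -fl; exact: ip.
suff -> : conv_hull (range p) = translate (p ord0) (linear_image A corner_simplex).
  by apply: body_translate; apply: body_linear_image => //; exact: body_corner_simplex.
rewrite conv_hull_range; apply/seteqP; split => x.
  move=> [w [w0 w1 ->]]; pose y : 'rV[R]_n := \row_i w (lift ord0 i).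
  have ws : \sum_i w (lift ord0 i) = 1 - w ord0.
    by rewrite -w1 (bigD1_ord ord0) //= addrC addrK.
  exists (y *m A); last first.
    rewrite xA [RHS](bigD1_ord ord0) //=.
    rewrite (eq_bigr (fun i => w (lift ord0 i) *: p (lift ord0 i)
      - w (lift ord0 i) *: p ord0)); last by move=> i _; rewrite mxE scalerBr.
    rewrite sumrB -scaler_suml ws scalerBl scale1r.
    by move: (\sum_i _) (w ord0 *: _) => S q; apply/rowP => i; rewrite !mxE; ring.
  exists y => //; split=> [i|]; first by rewrite mxE.
  by under eq_bigr do rewrite mxE; rewrite ws gerBl.
move=> [_ [y [y0 y1] <-] <-].
pose w (i : 'I_n.+1) := oapp (fun j => y 0 j) (1 - \sum_j y 0 j) (unlift ord0 i).
have w0 : w ord0 = 1 - \sum_j y 0 j by rewrite /w unlift_none.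
have wl i : w (lift ord0 i) = y 0 i by rewrite /w liftK.
exists w; split.
- by move=> i; case: (unliftP ord0 i) => [j|] ->; rewrite ?wl // w0 subr_ge0.
- by rewrite (bigD1_ord ord0) //= w0 (eq_bigr _ (fun i _ => wl i)) subrK.
rewrite (bigD1_ord ord0) //= w0 xA.
rewrite (eq_bigr _ (fun i _ => scalerBr _ _ _)) sumrB -scaler_suml.
rewrite [X in _ = _ + X](eq_bigr _ (fun i _ => congr1 (fun t => t *: _) (wl i))).
rewrite scalerBl scale1r.
by move: (\sum_i _ *: _) (_ *: p ord0) => S q; apply/rowP => i; rewrite !mxE; ring.
Qed.

(** If [c - K] lies in [rho K] then, for each vertex, [c = p i + rho x_i] with [x_i]
in [K].  By affine independence the coefficient [k j] of [p j] in this
representation does not depend on [i]; for [i = j] it is at least one, and the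
coefficients have sum [1 + rho]. *)
Lemma asymmetry_simplex K : is_simplex K -> n%:R <= minkowski_asymmetry K.
Proof.
move=> sK; have bK := body_simplex sK; case: sK => p [ip KE].
apply: le_asymmetry => // rho c rho0 hc.
rewrite KE conv_hull_range in hc.
have key i : exists w : 'I_n.+1 -> R, [/\ forall j, 0 <= w j, \sum_j w j = 1 &
    c = p i + rho *: \sum_j w j *: p j].
  have [|_ [w [w0 w1 ->]] E] := hc (c - p i).
    exists (- p i) => //; exists (p i) => //.
    exists (fun j => (j == i)%:R); split.
    - by move=> j; case: (j == i).
    - by rewrite (bigD1 i) //= eqxx big1 ?addr0 // => j /negPf ->.
    - rewrite (bigD1 i) //= eqxx scale1r big1 ?addr0 // => j /negPf ->.
      by rewrite scale0r.
  by exists w; split=> //; rewrite E addrC subrK.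
have [w0 [w00 w01 cE0]] := key ord0.
pose k j := (j == ord0)%:R + rho * w0 j.
have k1 i : 1 <= k i.
  have [w [wp w1 cE]] := key i.
  have pe l : p l = \sum_j (j == l)%:R *: p j.
    rewrite (bigD1 l) //= eqxx scale1r big1 ?addr0 // => j /negPf ->.
    by rewrite scale0r.
  have := ip (fun j => k j - ((j == i)%:R + rho * w j)).
  have d1 l : \sum_(j < n.+1) (j == l)%:R = 1 :> R.
    by rewrite (bigD1 l) //= eqxx big1 ?addr0 // => j /negPf ->.
  rewrite sumrB !big_split /= -!mulr_sumr w01 w1 !d1 subrr => /(_ erefl).
  have -> : \sum_j (k j - ((j == i)%:R + rho * w j)) *: p j = 0.
    under eq_bigr do rewrite scalerBl !scalerDl -!scalerA.
    rewrite sumrB !big_split /= -!scaler_sumr -!pe -cE0 -cE subrr //.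
  move=> /(_ erefl i) /eqP; rewrite subr_eq0 eqxx => /eqP ->.
  by rewrite lerDl mulr_ge0.
have : \sum_(i < n.+1) 1 <= \sum_i k i by apply: ler_sum => i _; exact: k1.
rewrite sumr_const card_ord big_split /= -mulr_sumr w01 (bigD1 ord0) //=.
rewrite big1 => [|j /negPf -> //]; rewrite -natr1; lra.
Qed.

Lemma simplex_is_max K : odd n -> is_simplex K ->
  is_max (width_radius_ratios K) (1 / Num.sqrt n%:R).
Proof.
move=> on sK; have bK := body_simplex sK.
have sn : 0 < Num.sqrt n%:R :> R by rewrite sqrtr_gt0.
apply: is_max_inv_sqrt => // A uA r c r0 Lr.
have bL := body_linear_image uA bK.
have := simplex_width_asymmetry_le n0 bL r0 Lr; rewrite asymmetry_linear_image //.
rewrite /simplex_width on => h.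
have := ler_wpM2r (min_width_ge0 bL) (asymmetry_simplex sK).
move=> /le_trans/(_ h); have qq : Num.sqrt n%:R ^+ 2 = n%:R :> R.
  by rewrite sqr_sqrtr // ltW.
rewrite -{1}qq => h2; rewrite mulrAC mul1r ler_pdivlMr // -(ler_pM2l sn); lra.
Qed.

End Extremal.

(** * The theorem *)

Unset Implicit Arguments.

Theorem corollary5p3 (R : realType) (n : nat) (n_gt0 : (0 < n)%N) :
  [/\ (forall K : set 'rV[R]_n, convex_body K ->
         exists m : R,
           is_max (width_radius_ratios K) m /\
           1 / Num.sqrt n%:R <= m <= ratio_upper_bound n (minkowski_asymmetry K)),
      (forall s : R, 1 <= s <= n%:R ->
         exists K : set 'rV[R]_n,
           [/\ convex_body K, minkowski_asymmetry K = s &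
               is_max (width_radius_ratios K) (ratio_upper_bound n s)]),
      (forall K : set 'rV[R]_n, is_crosspolytope K \/ is_parallelotope K ->
         is_max (width_radius_ratios K) (1 / Num.sqrt n%:R)) &
      (odd n -> forall K : set 'rV[R]_n, is_simplex K ->
         is_max (width_radius_ratios K) (1 / Num.sqrt n%:R))].
Proof.
have upper (K : set 'rV[R]_n) : convex_body K ->
    ubound (width_radius_ratios K) (ratio_upper_bound n (minkowski_asymmetry K)).
  move=> bK _ [A /= uA <-]; rewrite -(asymmetry_linear_image K uA).
  by apply: ratio_le_upper_bound => //; exact: body_linear_image.
split.
- move=> K bK; have [m [[Sm um] lm]] := max_ratio_exists n_gt0 bK.
  by exists m; split=> //; rewrite lm; exact: upper.
- move=> s /andP[s1 sn]; have [u ru] := @regular_simplex_exists R n n_gt0.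
  have bK := body_truncated_simplex ru s1.
  have sK := asymmetry_truncated_simplex n_gt0 ru s1 sn.
  exists (truncated_simplex u s); split=> //; rewrite -{2}sK.
  split; last exact: upper.
  have idK : linear_image 1%:M (truncated_simplex u s) = truncated_simplex u s.
    apply/seteqP; split=> [_ [x Kx <-]|x Kx]; first by rewrite mulmx1.
    by exists x; rewrite ?mulmx1.
  exists 1%:M; first exact: unitmx1.
  rewrite idK; apply/eqP; rewrite eq_le ratio_le_upper_bound //= sK.
  exact: truncated_simplex_optimal.
- move=> K [cK|pK].
    exact: affine_image_is_max (body_crosspolytope n_gt0) (crosspolytope_bound n_gt0) cK.
  exact: affine_image_is_max (body_cube) (cube_bound n_gt0) pK.
- by move=> on K; exact: simplex_is_max.
Qed.
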